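(* Let $u$ be the solution of the boundary value problem described in the context, satisfying the decomposition assumption stated there, and let $\varepsilon\le N^{-1}$. Let $\sigma_x=kN^{-1}\ln N$ and $\sigma_y=kN^{-1/2}$. Then there is a constant $C>0$, independent of $\varepsilon$ and $N$, such that for any mesh node $\boldsymbol{x}^{*}\in\Omega_s\cup\Omega_1$, with associated discrete Green's function $G\in V^N$ and associated mesh domain $\Omega_0'=\Omega_0'(\boldsymbol{x}^* )$: 1. if $\Omega_0'\subset\Omega_s\cup\Omega_1$, then $$\left|(\varepsilon\Delta u,\delta bG_x)\right|\le C\left(N^{-\rho}+\varepsilon N^{-5/4}\right)(\ln N)\,|||G|||;$$ 2. if $\Omega_0'\not\subset\Omega_s\cup\Omega_1$, then $$\left|(\varepsilon\Delta u,\delta bG_x)\right|\le C\left(N^{-\rho}+\varepsilon^{1/4}\delta_y\right)(\ln N)\,|||G|||.$$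
   Context: **Problem.** Let $\Omega=(0,1)^2$, $0<\varepsilon\ll1$, let $b,c>0$ be constants with $b\ge\beta$ for a constant $\beta>0$, and let $f$ be sufficiently smooth. $u$ is the solution of $-\varepsilon\Delta u+bu_x+cu=f$ in $\Omega$, $u=0$ on $\partial\Omega$. Here $(\cdot,\cdot)$ is the $L^2(\Omega)$ inner product. **Decomposition assumption on $u$.** $u=S+E_1+E_2+E_{12}$ where, for all $(x,y)\in\bar\Omega$ and $0\le i+j\le 3$, with $C$ independent of $\varepsilon$: $|\partial_x^i\partial_y^jS|\le C$; $|\partial_x^i\partial_y^jE_1|\le C\varepsilon^{-i}e^{-\beta(1-x)/\varepsilon}$; $|\partial_x^i\partial_y^jE_2|\le C\varepsilon^{-j/2}(e^{-y/\sqrt\varepsilon}+e^{-(1-y)/\sqrt\varepsilon})$; $|\partial_x^i\partial_y^jE_{12}|\le C\varepsilon^{-(i+j/2)}e^{-\beta(1-x)/\varepsilon}(e^{-y/\sqrt\varepsilon}+e^{-(1-y)/\sqrt\varepsilon})$. **Shishkin mesh.** $N$ is a positive integer divisible by $6$, $\rho=2.5$, $\lambda_x:=\min\{1/2,\rho\frac{\varepsilon}{\beta}\ln N\}$, $\lambda_y:=\min\{1/4,\rho\sqrt\varepsilon\ln N\}$. It is assumed that $\varepsilon\le N^{-1}$, $\lambda_x=\rho\varepsilon\beta^{-1}\ln N$ and $\lambda_y=\rho\sqrt\varepsilon\ln N$. Set $\Omega_s=[0,1-\lambda_x]\times[\lambda_y,1-\lambda_y]$, $\Omega_1=[1-\lambda_x,1]\times[\lambda_y,1-\lambda_y]$,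 $\Omega_2=[0,1-\lambda_x]\times([0,\lambda_y]\cup[1-\lambda_y,1])$, $\Omega_{12}=[1-\lambda_x,1]\times([0,\lambda_y]\cup[1-\lambda_y,1])$. The mesh nodes are $(x_i,y_j)$, $0\le i,j\le N$, with $x_i=2i(1-\lambda_x)/N$ for $0\le i\le N/2$, $x_i=1-2(N-i)\lambda_x/N$ for $N/2<i\le N$; $y_j=3j\lambda_y/N$ for $0\le j\le N/3$, $y_j=(3j/N-1)-3(2j-N)\lambda_y/N$ for $N/3<j\le 2N/3$, $y_j=1-3(N-j)\lambda_y/N$ for $2N/3<j\le N$. $\Omega^N$ is the set of mesh rectangles $\tau_{ij}=[x_{i-1},x_i]\times[y_{j-1},y_j]$. **Finite element space and bilinear form.** $V^N=\{v\in C(\bar\Omega): v|_{\partial\Omega}=0,\ v|_\tau \text{ bilinear for all }\tau\in\Omega^N\}$. The parameter $\delta(\boldsymbol{x})$ equals $C^*N^{-1}$ on $\Omega_s\cup\Omega_2$ and $0$ otherwise, where $C^*=O(1)$ is a positive constant and $N$ satisfies $0<C^*N^{-1}\le 1/c$. $\delta_y$ denotes the constant value of $\delta$ on $\Omega_2$ (so $\delta_y=C^*N^{-1}$). For $w,v\in V^N$, $$B(w,v):=\varepsilon(\nabla w,\nabla v)+(bw_x+cw,v)+(bw_x+cw,\delta b v_x),$$ and the energy norm is $|||v|||^2:=((\varepsilon+b^2\delta)v_x,v_x)+\varepsilon(v_y,v_y)+(cv,v)$. **Discrete Green's function.** For a mesh node $\boldsymbol{x}^*=(x^*,y^* )$,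 $G\in V^N$ is defined by $B(v,G)=v(\boldsymbol{x}^* )$ for all $v\in V^N$. **The domain $\Omega_0'$.** With $k>0$ a sufficiently large constant and $K>0$ a suitably chosen, sufficiently large constant, both independent of $\varepsilon$ and $N$, $$\Omega_0:=\{\boldsymbol{x}=(x,y)\in\Omega: x-x^*\le K\sigma_x\ln N\ \text{and}\ |y-y^*|\le K\sigma_y\ln N\},$$ and $\Omega_0':=\bigcup\{\tau\in\Omega^N:\operatorname{meas}(\Omega_0\cap\tau)\ne0\}$ is the smallest mesh domain extending $\Omega_0$. *)

(* Defs.v *)
From HB Require Import structures.
From mathcomp Require Import all_boot all_order all_algebra.
From mathcomp Require Import all_classical all_reals all_analysis.

Set Implicit Arguments.
Unset Strict Implicit.
Unset Printing Implicit Defensive.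

Import Order.TTheory GRing.Theory Num.Theory.
Import numFieldTopology.Exports numFieldNormedType.Exports.

Local Open Scope classical_set_scope.
Local Open Scope ring_scope.

(* Points of the plane are pairs p : R * R; p.1 and p.2 are the coordinates
   x and y. *)

Definition Omega {R : realType} : set (R * R) := `]0, 1[ `*` `]0, 1[.
Definition Omega_bar {R : realType} : set (R * R) := `[0, 1] `*` `[0, 1].

Definition area {R : realType} : set (R * R) -> \bar R :=
  (@lebesgue_measure R \x @lebesgue_measure R)%E.

(* First-order partial derivatives. On piecewise smooth functions they are
   meaningful off the mesh lines, a null set for every integral below. *)
Definition dx (R : realType) (v : R * R -> R) (p : R * R) : R :=
  derive1 (fun t : R => v (t, p.2)) p.1.
Definition dy (R : realType) (v : R * R -> R) (p : R * R) : R :=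
  derive1 (fun t : R => v (p.1, t)) p.2.
Definition laplacian (R : realType) (v : R * R -> R) (p : R * R) : R :=
  dx (dx v) p + dy (dy v) p.

Definition L2_inner (R : realType) (g h : R * R -> R) : R :=
  Rintegral area Omega (fun p => g p * h p).

(* [partials A m g D], for A = Omega or A = Omega_bar: g is of class C^m on A
   and D i j is its derivative of order i in x and j in y (i + j <= m). On the
   boundary of Omega, D i j is the continuous extension from the interior. *)
Definition partials (R : realType) (A : set (R * R)) (m : nat)
    (g : R * R -> R) (D : nat -> nat -> R * R -> R) : Prop :=
  [/\ forall p, A p -> D 0%N 0%N p = g p,
      forall i j : nat, (i + j <= m)%N -> {within A, continuous (D i j)} &
      forall (i j : nat) (p : R * R), (i + j < m)%N -> Omega p ->
        is_derive p.1 1 (fun t : R => D i j (t, p.2)) (D i.+1 j p) /\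
        is_derive p.2 1 (fun t : R => D i j (p.1, t)) (D i j.+1 p)].

Definition class_C (R : realType) (A : set (R * R)) (m : nat)
    (g : R * R -> R) : Prop :=
  exists D, partials A m g D.

(* Classical solutions of - eps Delta u + b u_x + c u = f in Omega, u = 0 on
   the boundary of Omega. *)
Definition is_solution (R : realType) (eps b c : R) (f u : R * R -> R) : Prop :=
  [/\ class_C Omega 2 u,
      {within Omega_bar, continuous u},
      forall p, Omega p -> - eps * laplacian u p + b * dx u p + c * u p = f p &
      forall p, (Omega_bar `\` Omega) p -> u p = 0].

Definition layer_x (R : realType) (beta eps : R) (p : R * R) : R :=
  expR (- (beta * (1 - p.1) / eps)).
Definition layer_y (R : realType) (eps : R) (p : R * R) : R :=
  expR (- (p.2 / Num.sqrt eps)) + expR (- ((1 - p.2) / Num.sqrt eps)).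

(* [has_bounds g w]: g is C^3 on the closed square, with |d_x^i d_y^j g| <= w i j
   there for i + j <= 3. *)
Definition has_bounds (R : realType) (g : R * R -> R)
    (w : nat -> nat -> R * R -> R) : Prop :=
  exists2 D, partials Omega_bar 3 g D &
    forall (i j : nat) (p : R * R), (i + j <= 3)%N -> Omega_bar p ->
      `|D i j p| <= w i j p.

Definition decomposes (R : realType) (beta eps C : R) (u : R * R -> R) : Prop :=
  exists S E1 E2 E12 : R * R -> R,
  [/\ forall p, Omega_bar p -> u p = S p + E1 p + E2 p + E12 p,
      has_bounds S (fun _ _ _ => C),
      has_bounds E1 (fun i _ p => C * eps `^ (- i%:R) * layer_x beta eps p),
      has_bounds E2 (fun _ j p => C * eps `^ (- (j%:R / 2)) * layer_y eps p) &
      has_bounds E12 (fun i j p =>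
        C * eps `^ (- (i%:R + j%:R / 2)) * layer_x beta eps p * layer_y eps p)].

Definition rho {R : realType} : R := 5 / 2.

Definition lambda_x (R : realType) (beta eps : R) (N : nat) : R :=
  Num.min (1 / 2) (rho * (eps / beta) * ln N%:R).
Definition lambda_y (R : realType) (eps : R) (N : nat) : R :=
  Num.min (1 / 4) (rho * Num.sqrt eps * ln N%:R).

(* In what follows lx and ly stand for lambda_x and lambda_y. *)

Definition Omega_s (R : realType) (lx ly : R) : set (R * R) :=
  `[0, 1 - lx] `*` `[ly, 1 - ly].
Definition Omega_1 (R : realType) (lx ly : R) : set (R * R) :=
  `[1 - lx, 1] `*` `[ly, 1 - ly].
Definition Omega_2 (R : realType) (lx ly : R) : set (R * R) :=
  `[0, 1 - lx] `*` (`[0, ly] `|` `[1 - ly, 1]).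

Definition node_x (R : realType) (lx : R) (N i : nat) : R :=
  if (i <= N %/ 2)%N then 2 * i%:R * (1 - lx) / N%:R
  else 1 - 2 * (N%:R - i%:R) * lx / N%:R.

Definition node_y (R : realType) (ly : R) (N j : nat) : R :=
  if (j <= N %/ 3)%N then 3 * j%:R * ly / N%:R
  else if (j <= (2 * N) %/ 3)%N then
    (3 * j%:R / N%:R - 1) - 3 * (2 * j%:R - N%:R) * ly / N%:R
  else 1 - 3 * (N%:R - j%:R) * ly / N%:R.

Definition mesh_node (R : realType) (lx ly : R) (N : nat) (p : R * R) : Prop :=
  exists i j : nat,
    [/\ (i <= N)%N, (j <= N)%N & p = (node_x lx N i, node_y ly N j)].

Definition mesh (R : realType) (lx ly : R) (N : nat) : set (set (R * R)) :=
  [set tau | exists i j : nat, [/\ (0 < i <= N)%N, (0 < j <= N)%N &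
    tau = `[node_x lx N i.-1, node_x lx N i] `*`
          `[node_y ly N j.-1, node_y ly N j]]].

Definition bilinear_on (R : realType) (tau : set (R * R)) (v : R * R -> R) :=
  exists a0 a1 a2 a3 : R, forall p, tau p ->
    v p = a0 + a1 * p.1 + a2 * p.2 + a3 * p.1 * p.2.

(* The space V^N; values outside the closed square are irrelevant. *)
Definition fe_space (R : realType) (lx ly : R) (N : nat) : set (R * R -> R) :=
  [set v | [/\ {within Omega_bar, continuous v},
               forall p, (Omega_bar `\` Omega) p -> v p = 0 &
               forall tau, mesh lx ly N tau -> bilinear_on tau v]].

Definition delta_y (R : realType) (Cs : R) (N : nat) : R := Cs / N%:R.

Definition delta (R : realType) (Cs lx ly : R) (N : nat) (p : R * R) : R :=
  if p \in Omega_s lx ly `|` Omega_2 lx ly then Cs / N%:R else 0.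

Definition bform (R : realType) (eps b c : R) (del w v : R * R -> R) : R :=
  eps * (L2_inner (dx w) (dx v) + L2_inner (dy w) (dy v))
  + L2_inner (fun p => b * dx w p + c * w p) v
  + L2_inner (fun p => b * dx w p + c * w p) (fun p => del p * b * dx v p).

Definition energy_norm (R : realType) (eps b c : R) (del v : R * R -> R) : R :=
  Num.sqrt (L2_inner (fun p => (eps + b ^+ 2 * del p) * dx v p) (dx v)
            + eps * L2_inner (dy v) (dy v)
            + L2_inner (fun p => c * v p) v).

Definition is_green (R : realType) (eps b c : R) (del : R * R -> R)
    (VN : set (R * R -> R)) (xs : R * R) (G : R * R -> R) : Prop :=
  VN G /\ forall v, VN v -> bform eps b c del v G = v xs.

Definition sigma_x (R : realType) (k : R) (N : nat) : R :=
  k * N%:R^-1 * ln N%:R.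
Definition sigma_y (R : realType) (k : R) (N : nat) : R :=
  k * N%:R `^ (- (1 / 2)).

Definition Omega0 (R : realType) (k K : R) (N : nat) (xs : R * R) :
    set (R * R) :=
  [set p | [/\ Omega p,
               p.1 - xs.1 <= K * sigma_x k N * ln N%:R &
               `|p.2 - xs.2| <= K * sigma_y k N * ln N%:R]].

Definition Omega0' (R : realType) (lx ly k K : R) (N : nat) (xs : R * R) :
    set (R * R) :=
  \bigcup_(tau in [set tau | mesh lx ly N tau /\
                             area (Omega0 k K N xs `&` tau) <> 0%E]) tau.

(* Main.v *)
Require Import Defs.
From HB Require Import structures.
From mathcomp Require Import all_boot all_order all_algebra.
From mathcomp Require Import all_classical all_reals all_analysis.
From mathcomp Require Import measurable_realfun ring lra zify.

Set Implicit Arguments.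
Unset Strict Implicit.
Unset Printing Implicit Defensive.

Import Order.TTheory GRing.Theory Num.Theory.
Import numFieldTopology.Exports numFieldNormedType.Exports.

Local Open Scope classical_set_scope.
Local Open Scope ring_scope.

(** Write [n = N/2], [d = Cs/N], [F = eps * laplacian u] and let [e] be the
    energy norm of [G]. Since [delta] vanishes to the right of the transition
    line [x = 1 - lx] and equals [d] to its left, the quantity to bound is
    [d * b] times the sum, over the cells of the columns [i < n], of the
    integrals of [F * dx G]. The decomposition of [u] splits [F] into four
    pieces: a smooth one of size and Lipschitz constant [O(eps)], two of size
    [O(layer_x / eps)], and the side layer, of size [O(layer_y)] and with
    Lipschitz constants [O(1)] in [x] and [O(eps^(-1/2))] in [y].

    The energy norm contains [sqrt d * b * dx G] to the left of the transition
    line and [sqrt eps * dx G] everywhere. By Cauchy-Schwarz alone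
    ([bound_crude]) a piece contributes [sqrt d * sup|F| * e], which suffices
    for the side layer in the middle rows, where it is at most [2 * N^(-rho)].
    For the exponential layers the cell integrals telescope in [x], up to
    [exp(-beta * lx / eps) = N^(-rho)] ([bound_layer]). The two remaining
    contributions, the smooth piece and the side layer in the strips, require a
    full power of [d]. It comes from freezing [F] at cell centres and summing
    by parts in [x] along each row ([bound_abel]): the differences of [F] meet
    [G] itself, which the term [c * G^2] of the energy controls, and the
    boundary term is the value of [G] on the transition line. That value is an
    integral of [dx G] across the layer down to the zero boundary value, so its
    square is at most [lx / eps = O(ln N)] times the energy. Rows of total
    height [L] thus contribute [O(d * sup|F| * sqrt(L * ln N) * e)].

    With [L = 1] for the smooth piece, where [eps <= eps^(1/4)], and
    [L = 2 * ly = O(sqrt eps * ln N)] for the side layer, this is already the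
    bound for a mesh domain that meets the strips ([bound_near_strips]).

    The sharper bound for a mesh domain away from the strips uses that [G]
    decays in [y]. Let [W] be [exp(|y - ys| / sigma)] with
    [sigma = k / sqrt N], where [xs = (x0, ys)] is the node of [G], and let [v]
    be the nodal interpolant of [W * G]. As [W = 1] at that node,
    [B(v, G) = v(xs) = G(xs) = B(G, G)]. On each row [v] is a multiple of [G]
    plus a small perturbation, so [B(v, G)] dominates a quarter of the energy
    weighted by [W], while [B(G, G)] is at most [3/2] of the plain energy
    ([green_weighted_energy]). Hence the rows with [W >= N^4] carry at most a
    fraction [O(N^(-4))] of the energy, and on them [bound_crude] gives
    [sqrt d * N^(-2) = O(N^(-rho))]. The rows of the strips are among them
    ([far_layer_rows]), and the others have total height [O(sigma * ln N)], for
    which [bound_abel] yields [eps * d * N^(-1/4) * ln N]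
    ([bound_away_from_strips]). *)

(** * Integrals and null sets *)
Section null.
Context d (T : measurableType d) (R : realType) (mu : {measure set T -> \bar R}).

Import HBNNSimple.

(** The functions need not be measurable: the integral of a nonnegative
    function is a supremum over simple functions below it, and restricting such
    a simple function to the complement of [A] does not change its integral.
    This matters because [dx G] is uncontrolled on the mesh lines. *)
Lemma ge0_le_integral_off_null (A : set T) (f g : T -> \bar R) :
  measurable A -> mu A = 0%E ->
  (forall x, (0 <= f x)%E) -> (forall x, (0 <= g x)%E) ->
  (forall x, ~ A x -> f x = g x) -> (\int[mu]_x f x <= \int[mu]_x g x)%E.
Proof.
move=> mA A0 f0 g0 fg; rewrite !ge0_integralTE//; apply: ge_ereal_sup => _ [h /= hf <-].
have mC : measurable (~` A) by exact: measurableC.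
pose h' := proj_nnsfun h mC.
have -> : sintegral mu h = sintegral mu h'.
  rewrite -!integralT_nnsfun; apply: ge0_ae_eq_integral => //.
  - by apply/measurable_EFinP.
  - by apply/measurable_EFinP.
  - by move=> x _; rewrite lee_fin; exact: fun_ge0.
  - by move=> x _; rewrite lee_fin; exact: fun_ge0.
  exists A; split => // x /= /not_implyP[_ hne]; apply: contrapT => nA.
  by apply: hne; rewrite /= mindicE mem_set// mulr1.
apply: ereal_sup_ubound; exists h' => // x.
rewrite /= mindicE; have [/set_mem xA|/negP xA] := boolP (x \in A).
  by rewrite memNset ?mulr0//= => /(_ xA).
have nA : ~ A x by move=> /mem_set.
by rewrite mem_set// mulr1 -fg.
Qed.

Lemma integral_eq_off_null (A : set T) (f g : T -> \bar R) :
  measurable A -> mu A = 0%E -> (forall x, ~ A x -> f x = g x) ->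
  (\int[mu]_x f x = \int[mu]_x g x)%E.
Proof.
move=> mA A0 fg; rewrite integralE [RHS]integralE.
have fgP : forall x, ~ A x -> g x = f x by move=> x /fg.
congr (_ - _)%E; apply/eqP; rewrite eq_le.
- by apply/andP; split; apply: (ge0_le_integral_off_null mA A0) => // x nA;
    rewrite ?funeposE (fg _ nA).
- by apply/andP; split; apply: (ge0_le_integral_off_null mA A0) => // x nA;
    rewrite ?funenegE (fg _ nA).
Qed.

Lemma integral_off_null (D D' : set T) (f : T -> \bar R) :
  measurable (D `\` D') -> D' `<=` D -> mu (D `\` D') = 0%E ->
  (\int[mu]_(x in D) f x = \int[mu]_(x in D') f x)%E.
Proof.
move=> mD sD D0; rewrite integral_mkcond [RHS]integral_mkcond.
apply: (integral_eq_off_null mD D0) => x nx; rewrite !patchE.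
have [/set_mem xD'|xD'] := boolP (x \in D').
  by rewrite mem_set//; exact: sD.
case: ifPn => // /set_mem xD; exfalso; apply: nx; split => //.
by move=> h; move: xD'; rewrite mem_set.
Qed.
End null.

(** * Rectangles in the plane *)
Section plane.
Context {R : realType}.
Implicit Types (a b c d : R).
Local Notation RR := (measurableTypeR R * measurableTypeR R)%type.

Definition orect a b c d : set (R * R) := `]a, b[ `*` `]c, d[.

Lemma measurable_orect a b c d : @measurable _ RR (orect a b c d).
Proof. exact: measurableX. Qed.

(** An open set is a countable union of open squares with rational centres and
    radii. *)
Lemma open_measurable2 (U : set (R * R)) : open U -> @measurable _ RR U.
Proof.
move=> oU.
pose B (q : rat * rat * rat) : set (R * R) :=
  let a : R := ratr q.1.1 in let b : R := ratr q.1.2 in let r : R := ratr q.2 in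
  orect (a - r) (a + r) (b - r) (b + r).
pose F (n : nat) : set (R * R) :=
  if unpickle n is Some q then
    if `[< B q `<=` U >] then B q else set0 else set0.
suff -> : U = \bigcup_n F n.
  apply: bigcup_measurable => n _; rewrite /F.
  case: unpickle => [q|]//; case: ifP => // _; exact: measurable_orect.
apply/seteqP; split=> [[x y] Uxy|p [n _]]; last first.
  by rewrite /F; case: unpickle => [q|]//; case: asboolP => // + Bp; exact.
have /nbhs_ballP[e /= e0 eU] : nbhs (x, y) U by exact: open_nbhs_nbhs.
have [r] : exists r : rat, (ratr r : R) \in `]0, (e / 2)[.
  by apply: rat_in_itvoo; rewrite divr_gt0.
rewrite in_itv/= => /andP[r0 re].
have [a] : exists a : rat, (ratr a : R) \in `](x - ratr r), (x + ratr r)[.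
  by apply: rat_in_itvoo; lra.
rewrite in_itv/= => /andP[a1 a2].
have [b] : exists b : rat, (ratr b : R) \in `](y - ratr r), (y + ratr r)[.
  by apply: rat_in_itvoo; lra.
rewrite in_itv/= => /andP[b1 b2].
have Bp : B (a, b, r) (x, y) by split; rewrite /= in_itv/=; apply/andP; split; lra.
have BU : B (a, b, r) `<=` U.
  move=> [x' y'] [/=]; rewrite !in_itv/= => /andP[h1 h2] /andP[h3 h4].
  by apply: eU; split; rewrite /ball/= ltr_norml; apply/andP; split; lra.
exists (pickle (a, b, r)); first exact: I.
by rewrite /F pickleK (asboolT BU).
Qed.

Lemma open_orect a b c d : open (orect a b c d).
Proof.
rewrite openE => -[x y] [/= ax cy]; exists (`]a, b[%classic, `]c, d[%classic) => //.
by split; apply: open_nbhs_nbhs; split => //=; exact: interval_open.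
Qed.

Lemma open_continuous_measurable_fun2 (U : set (R * R)) (f : R * R -> R) :
  open U -> (forall p, U p -> {for p, continuous f}) ->
  @measurable_fun _ _ RR R U f.
Proof.
move=> oU cf; apply: (measurability _ (RGenOpens.measurableE R)).
move=> _ [_ [a [b ->] <-]].
have -> : U `&` f @^-1` `]a, b[ = (U `&` f @^-1` `]a, b[)^°.
  apply/seteqP; split; last exact: interior_subset.
  move=> p [Up fp]; apply: filterI; first exact: open_nbhs_nbhs.
  apply: (cf p Up); apply: open_nbhs_nbhs; split => //; exact: interval_open.
by apply: open_measurable2; exact: open_interior.
Qed.
End plane.

(** [area] is a bare set function; integration theory applies to the measure. *)
Definition plane {R : realType} :
    {measure set (measurableTypeR R * measurableTypeR R) -> \bar R} :=
  (@lebesgue_measure R \x @lebesgue_measure R)%E.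

Lemma L2_innerE (R : realType) (f g : R * R -> R) :
  L2_inner f g = Rintegral plane Omega (fun p => f p * g p).
Proof. by []. Qed.

Section rect.
Context {R : realType}.
Implicit Types (a b c d : R).
Local Notation RR := (measurableTypeR R * measurableTypeR R)%type.
Local Notation mu := (@lebesgue_measure R).

Lemma area_orectE a b c d : a <= b -> c <= d ->
  plane (orect a b c d) = ((b - a) * (d - c))%:E.
Proof.
have E (x y : R) : x <= y -> mu `]x, y[%classic = (y - x)%:E.
  rewrite lebesgue_measure_itv/= lte_fin => xy; have [//|yx] := ltP x y.
  by congr (_%:E); lra.
move=> ab cd; transitivity (mu `]a, b[%classic * mu `]c, d[%classic)%E.
  exact: product_measure1E.
rewrite EFinM.
by congr (_ * _)%E; exact: E.
Qed.

Lemma integrable_orect a b c d (F : R * R -> R) (M : R) :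
  @measurable_fun _ _ RR R (orect a b c d) F -> (forall p, orect a b c d p -> `|F p| <= M) ->
  (@plane R).-integrable (orect a b c d) (EFin \o F).
Proof.
move=> mF bF; apply: measurable_bounded_integrable => //.
- exact: measurable_orect.
- have [ab|ab] := leP a b; have [cd|cd] := leP c d; last 3 first.
  + suff -> : orect a b c d = set0 by rewrite /plane measure0.
    by apply/seteqP; split => // -[x y] [_]/=; rewrite in_itv/=; lra.
  + suff -> : orect a b c d = set0 by rewrite /plane measure0.
    by apply/seteqP; split => // -[x y] []/=; rewrite in_itv/=; lra.
  + suff -> : orect a b c d = set0 by rewrite /plane measure0.
    by apply/seteqP; split => // -[x y] []/=; rewrite in_itv/=; lra.
  by rewrite [ltLHS](area_orectE ab cd) ltry.
- exists M; split; first exact: num_real.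
  by move=> x Mx p op /=; rewrite (le_trans (bF _ op))// ltW.
Qed.

Lemma Rintegral_orectM a b c d (f g : R -> R) (M1 M2 : R) :
  continuous f -> continuous g ->
  (forall x, a < x < b -> `|f x| <= M1) ->
  (forall x, c < x < d -> `|g x| <= M2) ->
  Rintegral plane (orect a b c d) (fun p => f p.1 * g p.2) =
  Rintegral mu `]a, b[ f * Rintegral mu `]c, d[ g.
Proof.
move=> cf cg bf bg.
have mfg : @measurable_fun _ _ RR R (orect a b c d) (fun p : R * R => f p.1 * g p.2).
  apply: measurable_funM; apply: measurable_funTS; apply: measurableT_comp => //.
  - exact: continuous_measurable_fun.
  - exact: continuous_measurable_fun.
have int : (@plane R).-integrable (orect a b c d) (EFin \o (fun p => f p.1 * g p.2)).
  apply: (@integrable_orect _ _ _ _ _ (M1 * M2)) => // -[x y] [/=]; rewrite !in_itv/=.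
  by move=> /bf fM /bg gM; rewrite normrM ler_pM.
have mu_lty (x y : R) : (mu `]x, y[%classic < +oo)%E.
  by rewrite lebesgue_measure_itv/=; case: ifPn => _; rewrite -?EFinB ltry.
have ig : mu.-integrable `]c, d[ (EFin \o g).
  apply: measurable_bounded_integrable => //.
  - exact: mu_lty.
  - by apply: measurable_funTS; exact: continuous_measurable_fun.
  - exists M2; split; first exact: num_real.
    by move=> x Mx y /=; rewrite in_itv/= => /bg h; rewrite (le_trans h)// ltW.
have iF : mu.-integrable `]a, b[ (EFin \o f).
  apply: measurable_bounded_integrable => //.
  - exact: mu_lty.
  - by apply: measurable_funTS; exact: continuous_measurable_fun.
  - exists M1; split; first exact: num_real.
    by move=> x Mx y /=; rewrite in_itv/= => /bf h; rewrite (le_trans h)// ltW.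
rewrite /Rintegral -fineM; [|exact: integrable_fin_num|exact: integrable_fin_num].
congr fine.
pose F (p : R * R) : \bar R := (f p.1 * g p.2)%:E.
have int' : (@plane R).-integrable setT
    (F \_ (orect a b c d)).
  by apply/(integrable_mkcond _ _).1 => //; exact: measurable_orect.
rewrite integral_mkcond -/F -(integral12_prod_meas1 int').
have E (x : R) : (\int[mu]_y (F \_ (orect a b c d)) (x, y)
   = ((EFin \o f) \_ `]a, b[%classic) x * \int[mu]_(y in `]c, d[) (g y)%:E)%E.
  rewrite [in RHS]patchE; case: ifPn => [/set_mem ax|ax].
    rewrite -integralZl// [RHS]integral_mkcond; apply: eq_integral => y _.
    rewrite !patchE; congr (if _ then _ else _).
    by apply/idP/idP => /set_mem h; apply/mem_set => //; case: h.
  rewrite mul0e; apply: integral0_eq => y _; rewrite patchE memNset//.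
  by move=> [/= h _]; move: ax; rewrite mem_set.
set z := (\int[mu]_(y in _) _)%E in E *.
transitivity (\int[mu]_x (((EFin \o f) \_ `]a, b[%classic) x * z))%E.
  by apply: eq_integral => x _; exact: E.
have zfin : z \is a fin_num by exact: integrable_fin_num.
rewrite -(fineK zfin) integralZr//; last exact/(integrable_mkcond _ _).1.
by rewrite -integral_mkcond.
Qed.

End rect.

Section has_integral.
Context d (T : measurableType d) (R : realType) (mu : {measure set T -> \bar R}).

Definition has_integral (D : set T) (F : T -> R) (v : R) :=
  mu.-integrable D (EFin \o F) /\ Rintegral mu D F = v.

Lemma has_integralD D F G u v : measurable D ->
  has_integral D F u -> has_integral D G v ->
  has_integral D (fun x => F x + G x) (u + v).
Proof.
move=> mD [iF Fu] [iG Gv]; split; last by rewrite RintegralD// Fu Gv.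
by apply: eq_integrable (integrableD mD iF iG).
Qed.

Lemma has_integralZ D F c v : measurable D ->
  has_integral D F v -> has_integral D (fun x => c * F x) (c * v).
Proof.
move=> mD [iF Fv]; split; last by rewrite RintegralZl// Fv.
by apply: eq_integrable (integrableZl mD c iF).
Qed.

Lemma has_integral_eq D F G u v : measurable D ->
  (forall x, D x -> F x = G x) -> u = v ->
  has_integral D F u -> has_integral D G v.
Proof.
move=> mD FG <- [iF Fu]; split.
  by apply: eq_integrable iF => // x /set_mem /FG /= ->.
by rewrite -Fu; apply: eq_Rintegral => x /set_mem /FG.
Qed.
End has_integral.

(** * Bilinear functions on a rectangle *)
Section cell.
Context {R : realType}.
Local Notation RR := (measurableTypeR R * measurableTypeR R)%type.
Local Notation mu := (@lebesgue_measure R).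
Implicit Types (a b c d : R).

Lemma Rintegral_oo_FTC2 (f F : R -> R) a b : a < b -> continuous f ->
  (forall x : R, is_derive x 1 F (f x)) ->
  Rintegral mu `]a, b[ f = F b - F a.
Proof.
move=> ab cf dF.
have cF : continuous F.
  by move=> x; have [/derivable1_diffP dx _] := dF x; exact: differentiable_continuous dx.
have iab : mu.-integrable `[a, b] (EFin \o f).
  apply: continuous_compact_integrable; first exact: segment_compact.
  exact: continuous_subspaceT.
rewrite Rintegral_itv_bndo_bndc; last first.
  by apply: integrableS iab => //; exact: subset_itv_oo_cc.
rewrite Rintegral_itv_obnd_cbnd; last first.
  by apply: integrableS iab => //; exact: subset_itv_oc_cc.
rewrite /Rintegral (continuous_FTC2 (F := F))//.
- exact: continuous_subspaceT.
- split => //.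
  + by apply: cvg_at_right_filter; exact: cF.
  + by apply: cvg_at_left_filter; exact: cF.
- by move=> x _; rewrite derive1E; have [_ ->] := dF x.
Qed.

Lemma continuous_monomial a h n : continuous (fun x : R => ((x - a) / h) ^+ n).
Proof.
move=> x; apply: (@continuous_comp _ _ _ (fun x : R => (x - a) / h) (@GRing.exp R ^~ n)).
  apply: continuousM; last exact: cst_continuous.
  by apply: continuousB => //; exact: cst_continuous.
exact: exprn_continuous.
Qed.

Lemma Rintegral_oo_monomial a b (n : nat) : a < b ->
  Rintegral mu `]a, b[ (fun x => ((x - a) / (b - a)) ^+ n) =
  (b - a) / n.+1%:R.
Proof.
move=> ab; have h0 : b - a != 0 by lra.
have n0 : n.+1%:R != 0 :> R by rewrite pnatr_eq0.
have dF (x : R) : is_derive x 1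
    (fun x : R => (b - a) / n.+1%:R * ((x - a) / (b - a)) ^+ n.+1)
    (((x - a) / (b - a)) ^+ n).
  have d1 : is_derive x 1 (fun x : R => (x - a) / (b - a)) (b - a)^-1.
    have := is_deriveZ (b - a)^-1 (is_deriveB (is_derive_id x 1) (is_derive_cst a x 1)).
    rewrite subr0 /GRing.scale/= mulr1.
    by congr (is_derive _ _ _ _); apply/funext => t /=; rewrite mulrC.
  have := is_deriveZ ((b - a) / n.+1%:R) (is_deriveX n.+1 d1).
  rewrite exprfctE /=; congr (is_derive _ _ _ _).
  rewrite /GRing.scale/=.
  by field; rewrite h0 -(natrD _ 1 n).
rewrite (Rintegral_oo_FTC2 ab (@continuous_monomial a (b - a) n) dF).
by rewrite divff// subrr mul0r expr1n expr0n/= mulr1 mulr0 subr0.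
Qed.

(** Values at the corners (a, c), (b, c), (a, d), (b, d) of a rectangle, in this
    order. *)
Definition quad := (R * R * R * R)%type.

Definition bil a b c d (P : quad) (z : R * R) : R :=
  let: (p, q, r, s) := P in
  let x := (z.1 - a) / (b - a) in let y := (z.2 - c) / (d - c) in
  p * (1 - x) * (1 - y) + q * x * (1 - y) + r * (1 - x) * y + s * x * y.

(** The mean over the rectangle of the product of two bilinear functions. In this
    form [mass P P] is visibly a sum of squares. *)
Definition mass (P Q : quad) : R :=
  let: (p, q, r, s) := P in let: (p', q', r', s') := Q in
  (p * p' + q * q' + r * r' + s * s' + (p + q) * (p' + q') + (r + s) * (r' + s')
   + (p + r) * (p' + r') + (q + s) * (q' + s')
   + (p + q + r + s) * (p' + q' + r' + s')) / 36.

Lemma unit_coordinate a b x : a < x < b -> `|(x - a) / (b - a)| <= 1.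
Proof.
move=> /andP[ax xb]; have ab : 0 < b - a by lra.
rewrite ger0_norm; last by rewrite divr_ge0//; lra.
by rewrite ler_pdivrMr//; lra.
Qed.

Lemma has_integral_monomial a b c d (m n : nat) : a < b -> c < d ->
  has_integral plane (orect a b c d)
    (fun z => ((z.1 - a) / (b - a)) ^+ m * ((z.2 - c) / (d - c)) ^+ n)
    ((b - a) * (d - c) / (m.+1%:R * n.+1%:R)).
Proof.
move=> ab cd.
have cm (e f : R) l := @continuous_monomial e (f - e) l.
have bm (e f : R) l x : e < x < f -> `|((x - e) / (f - e)) ^+ l| <= 1.
  by move=> h; rewrite normrX exprn_ile1//; exact: unit_coordinate.
split; last first.
  rewrite (Rintegral_orectM (M1 := 1) (M2 := 1) (cm a b m) (cm c d n)); last first.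
  - exact: bm.
  - exact: bm.
  rewrite !Rintegral_oo_monomial//.
  by rewrite mulf_div.
apply: (@integrable_orect _ _ _ _ _ _ 1).
  apply: measurable_funM; apply: measurable_funTS.
    by apply: (measurableT_comp (continuous_measurable_fun (cm a b m))).
  by apply: (measurableT_comp (continuous_measurable_fun (cm c d n))).
move=> z [/=]; rewrite !in_itv/= => h1 h2; rewrite normrM mulr_ile1//; exact: bm.
Qed.

(** In the unit coordinates of the rectangle the product is a combination of the
    nine monomials of degree at most 2 in each variable. *)
Lemma has_integral_bilM a b c d (P Q : quad) : a < b -> c < d ->
  has_integral plane (orect a b c d) (fun z => bil a b c d P z * bil a b c d Q z)
    ((b - a) * (d - c) * mass P Q).
Proof.
move: P Q => [[[p q] r] s] [[[p' q'] r'] s'] ab cd.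
have mo := measurable_orect a b c d.
have M m n e := has_integralZ e mo (has_integral_monomial m n ab cd).
set be := q - p; set ga := r - p; set om := s - r - q + p.
set be' := q' - p'; set ga' := r' - p'; set om' := s' - r' - q' + p'.
have H := has_integralD mo (M 0%N 0%N (p * p'))
 (has_integralD mo (M 1%N 0%N (p * be' + be * p'))
 (has_integralD mo (M 2%N 0%N (be * be'))
 (has_integralD mo (M 0%N 1%N (p * ga' + ga * p'))
 (has_integralD mo (M 1%N 1%N (p * om' + om * p' + be * ga' + ga * be'))
 (has_integralD mo (M 2%N 1%N (be * om' + om * be'))
 (has_integralD mo (M 0%N 2%N (ga * ga'))
 (has_integralD mo (M 1%N 2%N (ga * om' + om * ga'))
  (M 2%N 2%N (om * om'))))))))).
apply: (has_integral_eq mo _ _ H).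
  by move=> [x y] _; rewrite /bil /om /om' /be /be' /ga /ga' /=; ring.
by rewrite /mass /om /om' /be /be' /ga /ga'; field.
Qed.
End cell.

(** * Assembling an integral from mesh cells *)
Section pieces.
Context {R : realType}.
Local Notation RR := (measurableTypeR R * measurableTypeR R)%type.
Local Notation mu := (@lebesgue_measure R).
Implicit Types (a b c d : R) (F : R * R -> R).

(** The integrand is only known to be integrable off a null set, here the mesh
    lines inside [D]. *)
Definition has_integral_ae (D : set (R * R)) F (v : R) :=
  exists D' : set (R * R), [/\ @measurable _ RR D', D' `<=` D,
    (@plane R).-negligible (D `\` D') & has_integral plane D' F v].

Lemma has_integralW D F v : @measurable _ RR D ->
  has_integral plane D F v -> has_integral_ae D F v.
Proof.
move=> mD iF; exists D; split => //.
by rewrite setDv; exact: negligible_set0.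
Qed.

Lemma has_integral_aeE D F v : @measurable _ RR D ->
  has_integral_ae D F v -> Rintegral plane D F = v.
Proof.
move=> mD [D' [mD' D'D nD [iF <-]]]; rewrite /Rintegral.
have mDD : @measurable _ RR (D `\` D') by exact: measurableD.
rewrite (@integral_off_null _ RR _ plane D D')//.
exact: measure_negligible.
Qed.

Lemma has_integral_aeU D A B L F u v :
  A `<=` D -> B `<=` D -> A `&` B = set0 -> D `\` (A `|` B) `<=` L ->
  (@plane R).-negligible L ->
  has_integral_ae A F u -> has_integral_ae B F v ->
  has_integral_ae D F (u + v).
Proof.
move=> AD BD AB0 DL nL [A' [mA A'A nA [iA FA]]] [B' [mB B'B nB [iB FB]]].
have mU : @measurable _ RR (A' `|` B') by exact: measurableU.
have dAB : [disjoint A' & B'].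
  apply/disj_set2P; rewrite -subset0 -AB0 => p [/A'A ? /B'B ?].
  by split.
have iU : (@plane R).-integrable (A' `|` B') (EFin \o F).
  move/integrableP : iA => [mFA fA]; move/integrableP : iB => [mFB fB].
  have mF : measurable_fun (A' `|` B') (EFin \o F) by apply/measurable_funU.
  apply/integrableP; split => //; rewrite ge0_integral_setU//.
  - exact: lte_add_pinfty.
  - exact: measurableT_comp.
exists (A' `|` B'); split => //.
- by move=> p [/A'A/AD|/B'B/BD].
- apply: (negligibleS _ (negligibleU nL (negligibleU nA nB))).
  move=> p [Dp nU]; have [Ap|nAp] := pselect (A p).
    by right; left; split => // A'p; apply: nU; left.
  have [Bp|nBp] := pselect (B p).
    by right; right; split => // B'p; apply: nU; right.
  by left; apply: DL; split => // -[].
- by split => //; rewrite Rintegral_setU ?FA ?FB.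
Qed.

Lemma has_integral_ae_glue_x (m : R) a b c d F u v : a < m -> m < b ->
  has_integral_ae (orect a m c d) F u -> has_integral_ae (orect m b c d) F v ->
  has_integral_ae (orect a b c d) F (u + v).
Proof.
move=> am mb.
apply: (@has_integral_aeU _ _ _ ([set m] `*` setT)).
- by move=> [x y] [/=]; rewrite !in_itv/= => h1 h2; split; rewrite /= in_itv/=; lra.
- by move=> [x y] [/=]; rewrite !in_itv/= => h1 h2; split; rewrite /= in_itv/=; lra.
- rewrite -subset0 => -[x y] [[/= + _] [/= + _]]; rewrite !in_itv/=; lra.
- move=> [x y] [[/= + h2] nU]; rewrite in_itv/= => h1; split => //=.
  have [xm|mx|//] := ltgtP x m; exfalso; apply: nU; [left|right];
    by split => //=; rewrite in_itv/=; lra.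
- exists ([set m] `*` setT); split => //; first exact: measurableX.
  transitivity (mu [set m] * mu setT)%E; first exact: product_measure1E.
  by rewrite lebesgue_measure_set1 mul0e.
Qed.

Lemma has_integral_ae_glue_y (m : R) a b c d F u v : c < m -> m < d ->
  has_integral_ae (orect a b c m) F u -> has_integral_ae (orect a b m d) F v ->
  has_integral_ae (orect a b c d) F (u + v).
Proof.
move=> cm md.
apply: (@has_integral_aeU _ _ _ (setT `*` [set m])).
- by move=> [x y] [/=]; rewrite !in_itv/= => h1 h2; split; rewrite /= in_itv/=; lra.
- by move=> [x y] [/=]; rewrite !in_itv/= => h1 h2; split; rewrite /= in_itv/=; lra.
- rewrite -subset0 => -[x y] [[/= _ +] [/= _ +]]; rewrite !in_itv/=; lra.
- move=> [x y] [[/= h1 +] nU]; rewrite in_itv/= => h2; split => //=.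
  have [xm|mx|//] := ltgtP y m; exfalso; apply: nU; [left|right];
    by split => //=; rewrite in_itv/=; lra.
- exists (setT `*` [set m]); split => //; first exact: measurableX.
  transitivity (mu setT * mu [set m])%E; first exact: product_measure1E.
  by rewrite lebesgue_measure_set1 mule0.
Qed.

Definition cell (X Y : nat -> R) (i j : nat) := orect (X i) (X i.+1) (Y j) (Y j.+1).

Lemma Rintegral_cells (X Y : nat -> R) (M N : nat) F (v : nat -> nat -> R) :
  (0 < M)%N -> (0 < N)%N ->
  (forall i, (i < M)%N -> X i < X i.+1) -> (forall j, (j < N)%N -> Y j < Y j.+1) ->
  (forall i j, (i < M)%N -> (j < N)%N ->
     has_integral plane (cell X Y i j) F (v i j)) ->
  Rintegral plane (orect (X 0%N) (X M) (Y 0%N) (Y N)) F =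
  \sum_(j < N) \sum_(i < M) v i j.
Proof.
move=> M0 N0 Xi Yj hv; apply: has_integral_aeE; first exact: measurable_orect.
have lt0 (Z : nat -> R) K : (forall i, (i < K)%N -> Z i < Z i.+1) ->
    forall i, (0 < i <= K)%N -> Z 0%N < Z i.
  move=> ZK; elim=> [//|[|i] IH /andP[_ iK]]; first exact: ZK.
  by apply: lt_trans (ZK _ iK); apply: IH; rewrite /= ltnW.
have row j : (j < N)%N ->
    has_integral_ae (orect (X 0%N) (X M) (Y j) (Y j.+1)) F (\sum_(i < M) v i j).
  move=> jN.
  have : forall m, (0 < m <= M)%N ->
      has_integral_ae (orect (X 0%N) (X m) (Y j) (Y j.+1)) F (\sum_(i < m) v i j).
    elim=> [//|[|m] IH /andP[_ mM]].
      rewrite big_ord1; apply: has_integralW (hv _ _ _ _) => //.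
      exact: measurable_orect.
    rewrite big_ord_recr /=; apply: (@has_integral_ae_glue_x (X m.+1)).
    - by apply: (lt0 _ M) => //=; rewrite ltnW.
    - exact: Xi.
    - by apply: IH; rewrite /= ltnW.
    - by apply: has_integralW (hv _ _ _ _) => //; exact: measurable_orect.
  by apply; rewrite M0/=.
have : forall m, (0 < m <= N)%N -> has_integral_ae
    (orect (X 0%N) (X M) (Y 0%N) (Y m)) F (\sum_(j < m) \sum_(i < M) v i j).
  elim=> [//|[|m] IH /andP[_ mM]].
    by rewrite big_ord1; exact: row.
  rewrite big_ord_recr /=; apply: (@has_integral_ae_glue_y (Y m.+1)).
  - by apply: (lt0 _ N) => //=; rewrite ltnW.
  - exact: Yj.
  - by apply: IH; rewrite /= ltnW.
  - exact: row.
by apply; rewrite N0/=.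
Qed.

End pieces.

(** * The bilinear form on one cell *)
Section quads.
Context {R : realType}.
Implicit Types (P Q S : @quad R) (a h k t : R).

Definition qadd P Q : quad :=
  let: (p, q, r, s) := P in let: (p', q', r', s') := Q in
  (p + p', q + q', r + r', s + s').
Definition qscale a P : quad :=
  let: (p, q, r, s) := P in (a * p, a * q, a * r, a * s).
Definition qdx h P : quad :=
  let: (p, q, r, s) := P in
  ((q - p) / h, (q - p) / h, (s - r) / h, (s - r) / h).
Definition qdy k P : quad :=
  let: (p, q, r, s) := P in
  ((r - p) / k, (s - q) / k, (r - p) / k, (s - q) / k).
(** Corner values multiplied by the sign of the row: the part of a reweighted
    function that is not proportional to the original one, see [qrowsE]. *)
Definition qflip P : quad := let: (p, q, r, s) := P in (- p, - q, r, s).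
Definition qrows (v w : R) P : quad :=
  let: (p, q, r, s) := P in (v * p, v * q, w * r, w * s).

Lemma massC P Q : mass P Q = mass Q P.
Proof.
by case: P Q => [[[p q] r] s] [[[p' q'] r'] s']; rewrite /mass; ring.
Qed.

Lemma massDl P Q S : mass (qadd P Q) S = mass P S + mass Q S.
Proof.
by case: P Q S => [[[p q] r] s] [[[p' q'] r'] s'] [[[p2 q2] r2] s2];
  rewrite /mass/=; ring.
Qed.

Lemma massZl a P Q : mass (qscale a P) Q = a * mass P Q.
Proof.
by case: P Q => [[[p q] r] s] [[[p' q'] r'] s']; rewrite /mass/=; ring.
Qed.

Lemma massDr P Q S : mass S (qadd P Q) = mass S P + mass S Q.
Proof. by rewrite massC massDl !(massC S). Qed.

Lemma massZr a P Q : mass Q (qscale a P) = a * mass Q P.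
Proof. by rewrite massC massZl massC. Qed.

Lemma mass_ge0 P : 0 <= mass P P.
Proof.
case: P => [[[p q] r] s]; rewrite /mass divr_ge0//.
by rewrite -!expr2 !addr_ge0// sqr_ge0.
Qed.

Lemma mass_cauchy a t P Q :
  2 * a * t * `|mass P Q| <= a ^+ 2 * mass P P + t ^+ 2 * mass Q Q.
Proof.
have H1 := mass_ge0 (qadd (qscale a P) (qscale t Q)).
have H2 := mass_ge0 (qadd (qscale a P) (qscale (- t) Q)).
rewrite !massDl !massDr !massZl !massZr (massC Q P) in H1 H2.
by case: (ger0P (mass P Q)) => _; lra.
Qed.

Lemma mass_flip P : mass (qflip P) (qflip P) <= 3 * mass P P.
Proof.
case: P => [[[p q] r] s]; rewrite /mass/=.
have h1 := sqr_ge0 (p + r); have h2 := sqr_ge0 (q + s).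
have h3 := sqr_ge0 (p + r + (q + s)).
rewrite !expr2 in h1 h2 h3; lra.
Qed.

Lemma qdx_flip h P : qdx h (qflip P) = qflip (qdx h P).
Proof.
by case: P => [[[p q] r] s]; rewrite /qdx/=; congr (_, _, _, _); lra.
Qed.

Lemma mass_flipl P : `|mass (qflip P) P| <= 2 * mass P P.
Proof.
by have := mass_cauchy 1 1 (qflip P) P; have := mass_flip P; lra.
Qed.

Lemma mass_dy_flip k P : k != 0 ->
  k ^+ 2 * mass (qdy k (qflip P)) (qdy k (qflip P)) <= 4 * mass P P.
Proof.
move=> k0; case: P => [[[p q] r] s]; rewrite /mass/=.
set E := k ^+ 2 * _.
have -> : E = ((r + p) ^+ 2 + (s + q) ^+ 2 + (r + p + (s + q)) ^+ 2) * 6 / 36.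
  by rewrite /E; field.
have h1 := sqr_ge0 (p - r); have h2 := sqr_ge0 (q - s).
have h3 := sqr_ge0 (p - r + (q - s)).
rewrite !expr2 in h1 h2 h3 *; lra.
Qed.

Lemma qrowsE v w P :
  qrows v w P = qadd (qscale ((v + w) / 2) P) (qscale ((w - v) / 2) (qflip P)).
Proof.
by case: P => [[[p q] r] s]; rewrite /qrows/=; congr (_, _, _, _); field.
Qed.

Lemma qdxD h P Q : qdx h (qadd P Q) = qadd (qdx h P) (qdx h Q).
Proof.
by case: P Q => [[[p q] r] s] [[[p' q'] r'] s']; rewrite /=; congr (_, _, _, _); ring.
Qed.
Lemma qdxZ h a P : qdx h (qscale a P) = qscale a (qdx h P).
Proof. by case: P => [[[p q] r] s]; rewrite /=; congr (_, _, _, _); ring. Qed.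
Lemma qdyD h P Q : qdy h (qadd P Q) = qadd (qdy h P) (qdy h Q).
Proof.
by case: P Q => [[[p q] r] s] [[[p' q'] r'] s']; rewrite /=; congr (_, _, _, _); ring.
Qed.
Lemma qdyZ h a P : qdy h (qscale a P) = qscale a (qdy h P).
Proof. by case: P => [[[p q] r] s]; rewrite /=; congr (_, _, _, _); ring. Qed.

(** The mean over a cell of size [h * k] of the integrand of the stabilized form,
    and in [Ecell] of the integrand of the squared energy norm. *)
Definition Bcell (eps b c del h k : R) P Q : R :=
  eps * (mass (qdx h P) (qdx h Q) + mass (qdy k P) (qdy k Q))
  + mass (qadd (qscale b (qdx h P)) (qscale c P)) Q
  + mass (qadd (qscale b (qdx h P)) (qscale c P)) (qscale (del * b) (qdx h Q)).

Definition Ecell (eps b c del h k : R) P : R :=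
  (eps + b ^+ 2 * del) * mass (qdx h P) (qdx h P)
  + eps * mass (qdy k P) (qdy k P) + c * mass P P.

Section coercive.
Variables (eps b c del h k : R).
Hypotheses (eps0 : 0 < eps) (b0 : 0 < b) (c0 : 0 < c) (del0 : 0 <= del)
  (delc : del * c <= 1) (k0 : 0 < k).

Lemma Ecell_ge0 P : 0 <= Ecell eps b c del h k P.
Proof.
rewrite !addr_ge0//; apply: mulr_ge0; rewrite ?mass_ge0 ?ltW//.
by rewrite ltr_wpDr// mulr_ge0// sqr_ge0.
Qed.

(** The stabilization pairs the reaction term with the streamline derivative;
    [del * c <= 1] is what lets the energy absorb this product. *)
Lemma cross_le (t z x : R) : 0 <= z ->
  2 * c * b * t <= c ^+ 2 * z + b ^+ 2 * x ->
  c * b * del * t <= (c * z + b ^+ 2 * del * x) / 2.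
Proof.
move=> z0 H.
have H1 : del * (2 * c * b * t) <= del * (c ^+ 2 * z + b ^+ 2 * x).
  exact: ler_wpM2l.
have H2 : del * c * (c * z) <= 1 * (c * z).
  by apply: ler_wpM2r => //; rewrite mulr_ge0// ltW.
rewrite !expr2 in H1 *; lra.
Qed.

(** The term [b * mass (qdx h P) P] is kept: it cancels when a row is summed, by
    [row_convection]. *)
Lemma Bcell_le P :
  Bcell eps b c del h k P P <=
    3 / 2 * Ecell eps b c del h k P + b * mass (qdx h P) P.
Proof.
have z0 := mass_ge0 P; have x0 := mass_ge0 (qdx h P); have y0 := mass_ge0 (qdy k P).
have H : c * b * del * `|mass P (qdx h P)| <=
    (c * mass P P + b ^+ 2 * del * mass (qdx h P) (qdx h P)) / 2.
  apply: cross_le => //; have := mass_cauchy c b P (qdx h P); lra.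
have cbd : 0 <= c * b * del by rewrite !mulr_ge0// ltW.
have H' := ler_wpM2l cbd (ler_norm (mass P (qdx h P))).
rewrite /Bcell /Ecell !massDl !massZl !massZr.
have := mulr_ge0 (ltW eps0) x0; have := mulr_ge0 (ltW eps0) y0.
have cz := mulr_ge0 (ltW c0) z0.
have bx := mulr_ge0 (mulr_ge0 (sqr_ge0 b) del0) x0.
rewrite !expr2 in bx H *; lra.
Qed.

(** With corner values reweighted by [v] on the lower and [w] on the upper row,
    the test function is the mean weight times the trial function, plus
    [(w - v) / 2] times the flipped one. As [|w - v|] is at most [k / sigma] times
    [v + w], all flipped terms are perturbations except the convective one, which
    the energy of a cell with [del = 0] controls only with a constant of order
    [eps^(-1/2)]; it is left to [row_flip_le]. *)
Lemma Bcell_rows_ge sigma v w P : 0 < v -> 0 < w -> 0 < sigma ->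
  `|w - v| <= k / sigma * (v + w) -> 56 * k <= sigma ->
  256 * eps <= c * sigma ^+ 2 ->
  3 / 8 * ((v + w) / 2) * Ecell eps b c del h k P
  + b * ((v + w) / 2 * mass (qdx h P) P + (w - v) / 2 * mass (qdx h (qflip P)) P)
  <= Bcell eps b c del h k (qrows v w P) P.
Proof.
move=> v0 w0 s0 vw ks es; rewrite qrowsE.
set W := (v + w) / 2; set D := (w - v) / 2.
have W0 : 0 < W by rewrite /W; lra.
set tau := k / sigma.
have DW : `|D| <= tau * W.
  rewrite /D normrM [`|2^-1|]ger0_norm//.
  by rewrite /W mulrA ler_wpM2r.
have tau0 : 0 < tau by exact: divr_gt0.
have taule : tau <= 56^-1 by rewrite /tau ler_pdivrMr//; lra.
rewrite /Bcell /Ecell !(qdxD, qdxZ, qdyD, qdyZ, massDl, massZl, massZr, massDr).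
set x := mass (qdx h P) (qdx h P); set y := mass (qdy k P) (qdy k P).
set z := mass P P; set xz := mass P (qdx h P).
set hx := mass (qdx h (qflip P)) (qdx h P).
set hy := mass (qdy k (qflip P)) (qdy k P).
set hz := mass (qflip P) P; set hzx := mass (qflip P) (qdx h P).
have x0 : 0 <= x by exact: mass_ge0.
have y0 : 0 <= y by exact: mass_ge0.
have z0 : 0 <= z by exact: mass_ge0.
have bd : 0 <= b ^+ 2 * del by rewrite mulr_ge0// sqr_ge0.
have Hxz : c * b * del * `|xz| <= (c * z + b ^+ 2 * del * x) / 2.
  by apply: cross_le => //; have := mass_cauchy c b P (qdx h P); rewrite -/x -/z -/xz; lra.
have Hhx : `|hx| <= 2 * x by rewrite /hx qdx_flip; exact: mass_flipl.
have Hhz : `|hz| <= 2 * z by exact: mass_flipl.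
have Hhzx : c * b * del * `|hzx| <= (c * (3 * z) + b ^+ 2 * del * x) / 2.
  apply: cross_le; first lra.
  have := mass_cauchy c b (qflip P) (qdx h P); rewrite -/x -/hzx.
  have := ler_wpM2l (sqr_ge0 c) (mass_flip P); rewrite -/z; lra.
have Hhy : tau * `|hy| <= 16 / sigma ^+ 2 * z + y / 16.
  (* the y-derivative of the flipped function costs [1 / k], so the diffusion
     term is traded for the reaction term through [256 * eps <= c * sigma^2] *)
  have := mass_cauchy (8 * k / sigma) 1 (qdy k (qflip P)) (qdy k P).
  have := mass_dy_flip P (lt0r_neq0 k0); rewrite -/y -/hy -/z.
  set m := mass _ _ => m4.
  have : (8 / sigma) ^+ 2 * (k ^+ 2 * m) <= (8 / sigma) ^+ 2 * (4 * z).
    by apply: ler_wpM2l => //; exact: sqr_ge0.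
  have -> : (8 * k / sigma) ^+ 2 * m = (8 / sigma) ^+ 2 * (k ^+ 2 * m) by ring.
  have -> : 16 / sigma ^+ 2 * z = (8 / sigma) ^+ 2 * (4 * z) / 16.
    by field; exact: lt0r_neq0.
  have -> : 2 * (8 * k / sigma) * 1 * `|hy| = 16 * (tau * `|hy|) by rewrite /tau; ring.
  lra.
have Des : eps * (16 / sigma ^+ 2) <= c / 16.
  by rewrite mulrA ler_pdivrMr ?exprn_gt0//; lra.
(* the flipped terms all carry the factor [D], at most [tau * W] in size *)
have Dle t u : `|t| <= u -> - (tau * W * u) <= D * t.
  move=> tu; have : `|D * t| <= tau * W * u by rewrite normrM ler_pM.
  by rewrite ler_norml => /andP[].
have T1 : - (tau * W * (2 * x)) <= D * hx by exact: Dle.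
have T2 : - (tau * W * (2 * z)) <= D * hz by exact: Dle.
have cbd : 0 <= c * b * del by rewrite !mulr_ge0// ltW.
have T3 : - (tau * W * ((c * (3 * z) + b ^+ 2 * del * x) / 2)) <= D * (c * b * del * hzx).
  by apply: Dle; rewrite normrM ger0_norm.
have T4 : - (W * (16 / sigma ^+ 2 * z + y / 16)) <= D * hy.
  have : `|D * hy| <= W * (tau * `|hy|).
    by rewrite normrM mulrA [W * _]mulrC ler_wpM2r.
  have := ler_wpM2l (ltW W0) Hhy.
  by rewrite ler_norml => + /andP[]; lra.
have T5 : - (W * ((c * z + b ^+ 2 * del * x) / 2)) <= W * (c * b * del * xz).
  have : - ((c * z + b ^+ 2 * del * x) / 2) <= c * b * del * xz.
    have : `|c * b * del * xz| <= (c * z + b ^+ 2 * del * x) / 2.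
      by rewrite normrM ger0_norm.
    by rewrite ler_norml => /andP[].
  by move=> /(ler_wpM2l (ltW W0)); rewrite mulrN.
have T4' := ler_wpM2l (ltW eps0) T4.
have T1' := ler_wpM2l (addr_ge0 (ltW eps0) bd) T1.
have T2' := ler_wpM2l (ltW c0) T2.
have Wz0 : 0 <= W * z by rewrite mulr_ge0// ltW.
have Wx0 : 0 <= W * x by rewrite mulr_ge0// ltW.
have S1 := ler_wpM2r Wz0 Des.
have S2 : (eps + b ^+ 2 * del) * (tau * (W * x)) <= (eps + b ^+ 2 * del) * (56^-1 * (W * x)).
  by apply: ler_wpM2l; [exact: addr_ge0 (ltW eps0) bd|exact: ler_wpM2r].
have S3 : c * (tau * (W * z)) <= c * (56^-1 * (W * z)).
  by apply: ler_wpM2l; [exact: ltW|exact: ler_wpM2r].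
have S4 : b ^+ 2 * del * (tau * (W * x)) <= b ^+ 2 * del * (56^-1 * (W * x)).
  by apply: ler_wpM2l => //; exact: ler_wpM2r.
have e1 := mulr_ge0 (ltW eps0) Wx0.
have e2 := mulr_ge0 (ltW c0) Wz0.
have e3 := mulr_ge0 bd Wx0.
have e4 := mulr_ge0 (ltW eps0) (mulr_ge0 (ltW W0) y0).
move: T4' T1' T2' T3 T5 S1 S2 S3 S4 e1 e2 e3 e4.
have -> : mass (qdx h P) P = xz by rewrite massC.
set s2 := 16 / sigma ^+ 2.
rewrite !expr2; lra.
Qed.
End coercive.
End quads.

(** * Weighted stability of the discrete form *)
Section sums.
Context {R : realType}.

Lemma sum_cauchy (I : Type) (r : seq I) (Q : pred I) (F G : I -> R) :
  (\sum_(i <- r | Q i) F i * G i) ^+ 2 <=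
  (\sum_(i <- r | Q i) F i ^+ 2) * (\sum_(i <- r | Q i) G i ^+ 2).
Proof.
elim: r => [|i r IH]; first by rewrite !big_nil mulr0 expr0n.
rewrite !big_cons; case: ifP => // _.
set x := \sum_(_ <- _ | _) _ in IH *; set A := \sum_(_ <- _ | _) _ in IH *.
set B := \sum_(_ <- _ | _) _ in IH *.
have A0 : 0 <= A by apply: sumr_ge0 => *; exact: sqr_ge0.
have B0 : 0 <= B by apply: sumr_ge0 => *; exact: sqr_ge0.
have H : 2 * x * (F i * G i) <= A * G i ^+ 2 + B * F i ^+ 2.
  have S0 : 0 <= A * G i ^+ 2 + B * F i ^+ 2.
    by rewrite addr_ge0// mulr_ge0// sqr_ge0.
  apply: le_trans (ler_norm _) _; rewrite -ler_sqr ?nnegrE// -normrX ger0_norm ?sqr_ge0//.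
  have h1 := sqr_ge0 (A * G i ^+ 2 - B * F i ^+ 2).
  have h2 := ler_wpM2r (mulr_ge0 (sqr_ge0 (F i)) (sqr_ge0 (G i))) IH.
  move: h1 h2; rewrite !expr2; lra.
move: IH H; rewrite !expr2; lra.
Qed.

Lemma sum_sqr_le (I : Type) (r : seq I) (Q : pred I) (k F : I -> R) (X : R) :
  (forall i, Q i -> 0 <= k i) -> \sum_(i <- r | Q i) k i <= X ->
  (\sum_(i <- r | Q i) k i * F i) ^+ 2 <=
  X * \sum_(i <- r | Q i) k i * F i ^+ 2.
Proof.
move=> k0 kX.
have -> : \sum_(i <- r | Q i) k i * F i =
    \sum_(i <- r | Q i) Num.sqrt (k i) * (Num.sqrt (k i) * F i).
  by apply: eq_bigr => i Qi; rewrite mulrA -expr2 sqr_sqrtr// k0.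
apply: le_trans (sum_cauchy _ _ _ _) _.
have -> : \sum_(i <- r | Q i) Num.sqrt (k i) ^+ 2 = \sum_(i <- r | Q i) k i.
  by apply: eq_bigr => i Qi; rewrite sqr_sqrtr// k0.
have -> : \sum_(i <- r | Q i) (Num.sqrt (k i) * F i) ^+ 2 =
    \sum_(i <- r | Q i) k i * F i ^+ 2.
  by apply: eq_bigr => i Qi; rewrite exprMn sqr_sqrtr// k0.
apply: ler_wpM2r => //; apply: sumr_ge0 => i Qi.
by rewrite mulr_ge0 ?k0 ?sqr_ge0.
Qed.

Lemma telescope_ord (f : nat -> R) m :
  \sum_(i < m) (f i.+1 - f i) = f m - f 0%N.
Proof. by rewrite -(big_mkord xpredT (fun i => f i.+1 - f i)) telescope_sumr. Qed.
End sums.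

Section rows.
Context {R : realType}.
Variables (eps b c del0 : R) (N n : nat) (h k : nat -> R) (g : nat -> nat -> R).
Hypotheses (eps0 : 0 < eps) (b0 : 0 < b) (c0 : 0 < c) (d0 : 0 <= del0)
  (dc : del0 * c <= 1) (nN : (n <= N)%N).
Hypotheses (hi : forall i, (i < N)%N -> 0 < h i)
  (kj : forall j, (j < N)%N -> 0 < k j).
Hypotheses (gl : forall j, (j <= N)%N -> g 0%N j = 0)
  (gr : forall j, (j <= N)%N -> g N j = 0).

Definition nodal i j : quad := (g i j, g i.+1 j, g i j.+1, g i.+1 j.+1).
Definition stab i := if (i < n)%N then del0 else 0.
Let E i j := Ecell eps b c (stab i) (h i) (k j) (nodal i j).
Let B i j P := Bcell eps b c (stab i) (h i) (k j) P (nodal i j).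
Let gx i j := qdx (h i) (nodal i j).

Lemma stab_ge0 i : 0 <= stab i.
Proof. by rewrite /stab; case: ifP. Qed.
Lemma stab_le i : stab i * c <= 1.
Proof. by rewrite /stab; case: ifP => // _; rewrite mul0r. Qed.

(** The convective term is the integral of half the derivative of a square that
    vanishes at both ends of the row. *)
Lemma row_convection j : (j < N)%N ->
  \sum_(i < N) h i * mass (gx i j) (nodal i j) = 0.
Proof.
move=> jN.
pose f i := (g i j ^+ 2 + g i j * g i j.+1 + g i j.+1 ^+ 2) / 6.
transitivity (\sum_(i < N) (f i.+1 - f i)).
  apply: eq_bigr => i _; have := lt0r_neq0 (hi (ltn_ord i)).
  by rewrite /gx /nodal /mass /f /= => h0; field.
by rewrite telescope_ord /f !gl ?gr// ?(ltnW jN)//; ring.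
Qed.

Lemma diff_le_mass_dx i j : (i < N)%N ->
  (g i.+1 j - g i j) ^+ 2 + (g i.+1 j.+1 - g i j.+1) ^+ 2 <=
  6 * h i ^+ 2 * mass (gx i j) (gx i j).
Proof.
move=> /hi /lt0r_neq0 h0; rewrite /gx /nodal /mass /=.
set a := g i.+1 j - _; set d := g i.+1 j.+1 - _.
rewrite [leRHS](_ : _ = a ^+ 2 + d ^+ 2 + (a + d) ^+ 2); last by field.
by rewrite lerDl sqr_ge0.
Qed.

(** A value in the fine columns is a sum of increments up to the boundary
    [x = 1]. *)
Lemma layer_nodal_le i j : (n <= i <= N)%N -> (j <= N)%N ->
  `|g i j| <= \sum_(l < N | (n <= l)%N) `|g l.+1 j - g l j|.
Proof.
move=> /andP[ni iN] jN.
have -> : g i j = - \sum_(i <= l < N) (g l.+1 j - g l j).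
  by rewrite telescope_sumr// gr// sub0r opprK.
rewrite normrN; apply: le_trans (ler_norm_sum _ _ _) _.
rewrite -(big_geq_mkord _ _ xpredT (fun l => `|g l.+1 j - g l j|)).
rewrite (@big_cat_nat _ _ _ i n N)//= lerDr.
by apply: sumr_ge0 => *; exact: normr_ge0.
Qed.

Lemma layer_sum_le j : (j < N)%N ->
  \sum_(i < N | (n <= i)%N) h i * `|mass (qdx (h i) (qflip (nodal i j))) (nodal i j)|
  <= ((\sum_(i < N | (n <= i)%N) `|g i.+1 j - g i j|) ^+ 2
      + (\sum_(i < N | (n <= i)%N) `|g i.+1 j.+1 - g i j.+1|) ^+ 2) / 2.
Proof.
move=> jN; set A := \sum_(i < N | _) `|g i.+1 j - _|.
set D := \sum_(i < N | _) `|g i.+1 j.+1 - _|.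
have AD i : (i < N)%N && (n <= i)%N ->
    h i * `|mass (qdx (h i) (qflip (nodal i j))) (nodal i j)| <=
    (`|g i.+1 j - g i j| * (2 * A + D) + `|g i.+1 j.+1 - g i j.+1| * (A + 2 * D)) / 6.
  move=> /andP[iN ni].
  have p1 : `|g i j| <= A by apply: layer_nodal_le; rewrite ?ni/= ltnW.
  have p2 : `|g i.+1 j| <= A by apply: layer_nodal_le; rewrite ?(leqW ni)//= ltnW.
  have p3 : `|g i j.+1| <= D by apply: layer_nodal_le; rewrite ?ni//= ltnW.
  have p4 : `|g i.+1 j.+1| <= D by apply: layer_nodal_le; rewrite ?(leqW ni).
  have h0 := hi iN.
  rewrite -{1}(gtr0_norm h0) -normrM.
  rewrite (_ : h i * _ = - ((g i.+1 j - g i j) *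
      (g i j + g i.+1 j + (g i j.+1 + g i.+1 j.+1) / 2)) / 6 +
    ((g i.+1 j.+1 - g i j.+1) *
      ((g i j + g i.+1 j) / 2 + (g i j.+1 + g i.+1 j.+1))) / 6); last first.
    by rewrite /nodal/mass/=; field; exact: lt0r_neq0.
  apply: le_trans (ler_normD _ _) _; rewrite [leRHS]mulrDl.
  apply: lerD; rewrite normrM [`|6^-1|]ger0_norm// ?normrN ler_wpM2r// normrM.
    apply: ler_wpM2l => //; move: p1 p2 p3 p4; rewrite !ler_norml; lra.
  apply: ler_wpM2l => //; move: p1 p2 p3 p4; rewrite !ler_norml; lra.
apply: (@le_trans _ _ (\sum_(i < N | (n <= i)%N) (`|g i.+1 j - g i j| * (2 * A + D)
   + `|g i.+1 j.+1 - g i j.+1| * (A + 2 * D)) / 6)).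
  by apply: ler_sum => i ni; apply: AD; rewrite ltn_ord.
rewrite -mulr_suml big_split/= -!mulr_suml -/A -/D.
by have := sqr_ge0 (A - D); rewrite !expr2; lra.
Qed.

Variable lx : R.
Hypothesis (hlx : forall i, (n <= i < N)%N -> (N - n)%:R * h i = lx).

Lemma layer_sum_sqr_le (r : nat -> R) :
  (\sum_(i < N | (n <= i)%N) `|r i|) ^+ 2 <= (N - n)%:R * \sum_(i < N | (n <= i)%N) r i ^+ 2.
Proof.
have -> : \sum_(i < N | (n <= i)%N) `|r i| = \sum_(i < N | (n <= i)%N) 1 * `|r i|.
  by apply: eq_bigr => i _; rewrite mul1r.
have -> : \sum_(i < N | (n <= i)%N) r i ^+ 2 =
    \sum_(i < N | (n <= i)%N) 1 * `|r i| ^+ 2.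
  by apply: eq_bigr => i _; rewrite mul1r -normrX ger0_norm ?sqr_ge0.
apply: sum_sqr_le => //.
by rewrite -(big_geq_mkord _ _ xpredT (fun _ => 1)) sumr_const_nat.
Qed.

(** In the fine columns there is no stabilization, and the convective term must be
    bounded by [eps] times the squared x-derivative. A Poincare inequality across
    the layer does it, at the cost of the layer width [lx = O(eps * ln N)]. *)
Lemma layer_flip_le j : (j < N)%N ->
  \sum_(i < N | (n <= i)%N) h i * `|mass (qdx (h i) (qflip (nodal i j))) (nodal i j)|
  <= 3 * lx * \sum_(i < N | (n <= i)%N) h i * mass (gx i j) (gx i j).
Proof.
move=> jN; apply: le_trans (layer_sum_le jN) _.
have H1 := layer_sum_sqr_le (fun i => g i.+1 j - g i j).
have H2 := layer_sum_sqr_le (fun i => g i.+1 j.+1 - g i j.+1).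
apply: (@le_trans _ _ ((N - n)%:R / 2 * \sum_(i < N | (n <= i)%N)
    ((g i.+1 j - g i j) ^+ 2 + (g i.+1 j.+1 - g i j.+1) ^+ 2))).
  by rewrite big_split/=; lra.
rewrite !mulr_sumr; apply: ler_sum => i ni.
rewrite -(hlx (i := i)) ?ni ?ltn_ord//.
have := @diff_le_mass_dx i j (ltn_ord i).
have N0 : 0 <= (N - n)%:R :> R by [].
move=> /(ler_wpM2l N0); rewrite !expr2; lra.
Qed.

(** The convective term of the flipped function: in the coarse columns the
    stabilization absorbs it cell by cell, in the fine ones [layer_flip_le]. *)
Lemma row_flip_le j (tau : R) : (j < N)%N -> 0 <= tau ->
  192 * tau ^+ 2 <= c * del0 -> 48 * b * tau * lx <= eps ->
  b * tau * \sum_(i < N) h i * `|mass (qdx (h i) (qflip (nodal i j))) (nodal i j)|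
  <= 1 / 16 * \sum_(i < N) h i * E i j.
Proof.
move=> jN t0 td tl.
rewrite (bigID (fun i : 'I_N => n <= i)%N)/= [X in _ <= _ * X](bigID (fun i : 'I_N => n <= i)%N)/=.
rewrite !mulrDr; apply: lerD.
  have H := ler_wpM2l (mulr_ge0 (ltW b0) t0) (layer_flip_le jN).
  apply: le_trans H _.
  set X := \sum_(i < N | _) _.
  have X0 : 0 <= X.
    by apply: sumr_ge0 => i _; rewrite mulr_ge0 ?mass_ge0// ltW// hi.
  apply: (@le_trans _ _ (1 / 16 * (eps * X))).
    have := ler_wpM2r X0 tl; lra.
  rewrite ler_wpM2l// mulr_sumr; apply: ler_sum => i ni.
  rewrite mulrCA ler_wpM2l ?(ltW (hi _))//.
  have -> : E i j = Ecell eps b c 0 (h i) (k j) (nodal i j).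
    by rewrite /E /stab ltnNge ni.
  rewrite /Ecell mulr0 addr0 -/(gx i j).
  by rewrite -addrA lerDl addr_ge0// mulr_ge0 ?mass_ge0// ltW.
rewrite !mulr_sumr; apply: ler_sum => i ni.
rewrite -ltnNge in ni.
rewrite mulrCA [leRHS]mulrCA ler_wpM2l ?(ltW (hi _))//.
set m := `|_|; rewrite /E /Ecell /stab ni -/(gx i j).
set x := mass _ _; set y := mass (qdy _ _) _; set z := mass _ _.
have x0 : 0 <= x by exact: mass_ge0.
have y0 : 0 <= y by exact: mass_ge0.
have z0 : 0 <= z by exact: mass_ge0.
have := mass_cauchy (8 * b * tau) c (qdx (h i) (qflip (nodal i j))) (nodal i j).
rewrite -/m -/z qdx_flip.
have := mass_flip (gx i j); rewrite -/x; set X := mass _ _ => Xx H.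
have e1 : (8 * b * tau) ^+ 2 * X <= (8 * b * tau) ^+ 2 * (3 * x).
  by rewrite ler_wpM2l ?sqr_ge0.
have e2 := ler_wpM2r (mulr_ge0 (sqr_ge0 b) x0) td.
have e3 := mulr_ge0 (ltW eps0) x0.
have e4 := mulr_ge0 (ltW eps0) y0.
rewrite -(ler_pM2l c0).
move: H e1 e2 (mulr_ge0 (ltW c0) e3) (mulr_ge0 (ltW c0) e4).
rewrite !expr2; lra.
Qed.

Definition sumcells (F : nat -> nat -> R) := \sum_(j < N) \sum_(i < N) h i * k j * F i j.

Variables (sigma : R) (W : nat -> R).
Hypotheses (s0 : 0 < sigma) (W0 : forall j, 0 < W j)
  (WS : forall j, (j < N)%N -> `|W j.+1 - W j| <= k j / sigma * (W j + W j.+1))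
  (ks : forall j, (j < N)%N -> 56 * k j <= sigma)
  (es : 256 * eps <= c * sigma ^+ 2)
  (kd : forall j, (j < N)%N -> 192 * (k j / sigma) ^+ 2 <= c * del0)
  (kl : forall j, (j < N)%N -> 48 * b * (k j / sigma) * lx <= eps).
Let Wm j := (W j + W j.+1) / 2.

Lemma sum_Bcell_le :
  sumcells (fun i j => B i j (nodal i j)) <= 3 / 2 * sumcells E.
Proof.
rewrite /sumcells mulr_sumr; apply: ler_sum => j _.
apply: (@le_trans _ _ (\sum_(i < N) (3 / 2 * (h i * k j * E i j) +
    b * k j * (h i * mass (gx i j) (nodal i j))))).
  apply: ler_sum => i _.
  have := Bcell_le (h i) (k j) eps0 b0 c0 (stab_ge0 i) (stab_le i) (nodal i j).
  have hk : 0 <= h i * k j by rewrite mulr_ge0// ltW ?hi ?kj.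
  by move=> /(ler_wpM2l hk); rewrite -/(gx i j) -/(E i j) -/(B i j _); lra.
by rewrite big_split/= -!mulr_sumr row_convection// mulr0 addr0.
Qed.

Lemma sum_Bcell_rows_ge :
  1 / 4 * sumcells (fun i j => Wm j * E i j) <=
  sumcells (fun i j => B i j (qrows (W j) (W j.+1) (nodal i j))).
Proof.
rewrite /sumcells mulr_sumr; apply: ler_sum => j _.
have jN := ltn_ord j; have k0 := kj jN.
have Wm0 : 0 < Wm j by rewrite /Wm; have := W0 j; have := W0 j.+1; lra.
pose D := (W j.+1 - W j) / 2.
set tau := k j / sigma.
have t0 : 0 <= tau by rewrite divr_ge0// ltW.
have DW : `|D| <= tau * Wm j.
  rewrite /D normrM [`|2^-1|]ger0_norm// /Wm mulrA ler_wpM2r//; exact: WS.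
pose m i := mass (qdx (h i) (qflip (nodal i j))) (nodal i j).
have low : \sum_(i < N) (3 / 8 * (Wm j * (k j * (h i * E i j))) +
     b * Wm j * k j * (h i * mass (gx i j) (nodal i j)) + b * D * k j * (h i * m i))
   <= \sum_(i < N) h i * k j * B i j (qrows (W j) (W j.+1) (nodal i j)).
  apply: ler_sum => i _.
  have := Bcell_rows_ge (h i) eps0 b0 c0 (stab_ge0 i) (stab_le i) k0 (nodal i j)
    (W0 j) (W0 j.+1) s0 (WS jN) (ks jN) es.
  have hk : 0 <= h i * k j by rewrite mulr_ge0// ltW ?hi.
  move=> /(ler_wpM2l hk); rewrite -/(gx i j) -/(E i j) -/(B i j _) -/(m i) -/D -/(Wm j).
  lra.
apply: le_trans low.
rewrite !big_split/= -!mulr_sumr row_convection// mulr0 addr0.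
set S := \sum_(i < N) h i * E i j.
have S0 : 0 <= S.
  apply: sumr_ge0 => i _; rewrite mulr_ge0// ?(ltW (hi _))//.
  by apply: Ecell_ge0 => //; exact: stab_ge0.
have -> : \sum_(i < N) h i * k j * (Wm j * E i j) = k j * (Wm j * S).
  by rewrite /S !mulr_sumr; apply: eq_bigr => i _; ring.
set M := \sum_(i < N) h i * m i.
have bM : - (Wm j * S / 16) <= b * D * M.
  have : `|b * D * M| <= Wm j * S / 16.
    have MM : `|M| <= \sum_(i < N) h i * `|m i|.
      apply: le_trans (ler_norm_sum _ _ _) _; apply: ler_sum => i _.
      by rewrite normrM ger0_norm// ltW// hi.
    have := row_flip_le jN t0 (kd jN) (kl jN).
    rewrite -/S -/tau => H.
    have -> : Wm j * S / 16 = Wm j * (1 / 16 * S) by field.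
    apply: le_trans (ler_wpM2l (ltW Wm0) H); rewrite 2!normrM (gtr0_norm b0).
    apply: (@le_trans _ _ (b * (tau * Wm j) * \sum_(i < N) h i * `|m i|)).
      by apply: ler_pM => //; [rewrite mulr_ge0// ltW|apply: ler_wpM2l => //; exact: ltW].
    by rewrite le_eqVlt; apply/orP; left; apply/eqP; ring.
  by rewrite ler_norml => /andP[].
have := ler_wpM2l (ltW k0) bM.
have := mulr_ge0 (ltW k0) (mulr_ge0 (ltW Wm0) S0).
lra.
Qed.

(** The hypothesis is the equality [B(v, G) = B(G, G)] of a Green function tested
    with its reweighting by weights equal to 1 at its node. *)
Lemma weighted_energy_le :
  sumcells (fun i j => B i j (qrows (W j) (W j.+1) (nodal i j))) =
  sumcells (fun i j => B i j (nodal i j)) ->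
  sumcells (fun i j => Wm j * E i j) <= 6 * sumcells E.
Proof. by have := sum_Bcell_rows_ge; have := sum_Bcell_le; lra. Qed.
End rows.

(** * Discrete sums against the energy *)
Section estimates.
Context {R : realType}.

Lemma sum2_sqr_le (N : nat) (J Q : pred nat) (u w : nat -> R)
    (F : nat -> nat -> R) (L X : R) :
  (forall j, (j < N)%N -> 0 <= w j) -> (forall i, (i < N)%N -> 0 <= u i) ->
  \sum_(j < N | J j) w j <= L -> \sum_(i < N | Q i) u i <= X ->
  (\sum_(j < N | J j) \sum_(i < N | Q i) u i * w j * F i j) ^+ 2 <=
  L * X * \sum_(j < N | J j) \sum_(i < N | Q i) u i * w j * F i j ^+ 2.
Proof.
move=> w0 u0 wL uX.
have L0 : 0 <= L by apply: le_trans wL; apply: sumr_ge0 => j _; exact: w0.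
have -> : \sum_(j < N | J j) \sum_(i < N | Q i) u i * w j * F i j =
    \sum_(j < N | J j) w j * \sum_(i < N | Q i) u i * F i j.
  by apply: eq_bigr => j _; rewrite mulr_sumr; apply: eq_bigr => i _; ring.
apply: le_trans (sum_sqr_le _ _ wL) _; first by move=> j _; exact: w0.
rewrite -mulrA ler_wpM2l// mulr_sumr; apply: ler_sum => j _.
rewrite (_ : X * _ = w j * (X * \sum_(i < N | Q i) u i * F i j ^+ 2)).
  apply: ler_wpM2l; first exact: w0.
  by apply: sum_sqr_le => // i _; exact: u0.
by rewrite !mulr_sumr; apply: eq_bigr => i _; ring.
Qed.

Variables (eps b c del0 : R) (N n : nat) (h k : nat -> R) (g : nat -> nat -> R).
Hypotheses (eps0 : 0 < eps) (b0 : 0 < b) (c0 : 0 < c) (d0 : 0 < del0)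
  (nN : (n <= N)%N).
Hypotheses (hi : forall i, (i < N)%N -> 0 < h i)
  (kj : forall j, (j < N)%N -> 0 < k j).
Hypotheses (gl : forall j, (j <= N)%N -> g 0%N j = 0)
  (gr : forall j, (j <= N)%N -> g N j = 0).
Hypotheses (h1 : \sum_(i < N | (i < n)%N) h i <= 1).
Variable lx : R.
Hypothesis (hl : \sum_(i < N | (n <= i)%N) h i <= lx).

Let E i j := Ecell eps b c (stab del0 n i) (h i) (k j) (nodal g i j).
Let gx i j := qdx (h i) (nodal g i j).

Definition energy (J : pred nat) :=
  \sum_(j < N | J j) \sum_(i < N) h i * k j * E i j.

(** Divided by the cell width, this bounds the x-derivative on the cell. *)
Definition xvar i j := `|g i.+1 j - g i j| + `|g i.+1 j.+1 - g i j.+1|.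

Lemma xvar_ge0 i j : 0 <= xvar i j.
Proof. exact: addr_ge0. Qed.

Lemma hk_ge0 (i j : 'I_N) : 0 <= h i * k j.
Proof. by rewrite mulr_ge0// ltW ?hi ?kj. Qed.

Lemma E_parts i j :
  [/\ eps * mass (gx i j) (gx i j) <= E i j,
      (i < n)%N -> b ^+ 2 * del0 * mass (gx i j) (gx i j) <= E i j,
      c * mass (nodal g i j) (nodal g i j) <= E i j & 0 <= E i j].
Proof.
rewrite /E /Ecell -/(gx i j).
have s0 : 0 <= b ^+ 2 * stab del0 n i.
  by rewrite mulr_ge0 ?sqr_ge0//; apply: stab_ge0; exact: ltW.
have := mulr_ge0 (ltW eps0) (mass_ge0 (gx i j)).
have := mulr_ge0 s0 (mass_ge0 (gx i j)).
have := mulr_ge0 (ltW eps0) (mass_ge0 (qdy (k j) (nodal g i j))).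
have := mulr_ge0 (ltW c0) (mass_ge0 (nodal g i j)).
set x := mass (gx i j) _; set y := mass (qdy _ _) _; set z := mass (nodal _ _ _) _.
move=> z0 y0 bx ex; split => [| ni | |]; rewrite ?mulrDl; try lra.
by move: bx; rewrite /stab ni => bx; lra.
Qed.

Lemma xvar_sqr_le i j : (i < N)%N ->
  (xvar i j / h i) ^+ 2 <= 12 * mass (gx i j) (gx i j).
Proof.
move=> iN; have h0 := hi iN.
rewrite expr_div_n ler_pdivrMr ?exprn_gt0//.
have := @diff_le_mass_dx _ N h g hi i j iN; rewrite -/(gx i j) /xvar.
set a := _ - g i j; set d := _ - g i j.+1 => H.
have := sqr_ge0 (`|a| - `|d|).
have : `|a| ^+ 2 = a ^+ 2 by rewrite -normrX ger0_norm ?sqr_ge0.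
have : `|d| ^+ 2 = d ^+ 2 by rewrite -normrX ger0_norm ?sqr_ge0.
move: H; rewrite !expr2; lra.
Qed.

Lemma xvar_sum_sqr_le (J Q : pred nat) (L X a : R) : 0 < a ->
  \sum_(j < N | J j) k j <= L -> \sum_(i < N | Q i) h i <= X ->
  (forall i j, (i < N)%N -> Q i -> a * mass (gx i j) (gx i j) <= E i j) ->
  (\sum_(j < N | J j) \sum_(i < N | Q i) k j * xvar i j) ^+ 2 <=
  12 * L * X / a * \sum_(j < N | J j) \sum_(i < N | Q i) h i * k j * E i j.
Proof.
move=> a0 kL hX aE.
have L0 : 0 <= L.
  by apply: le_trans kL; apply: sumr_ge0 => j _; exact/ltW/kj.
have X0 : 0 <= X.
  by apply: le_trans hX; apply: sumr_ge0 => j _; exact/ltW/hi.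
have -> : \sum_(j < N | J j) \sum_(i < N | Q i) k j * xvar i j =
    \sum_(j < N | J j) \sum_(i < N | Q i) h i * k j * (xvar i j / h i).
  apply: eq_bigr => j _; apply: eq_bigr => i _.
  by field; exact/lt0r_neq0/hi.
apply: le_trans (sum2_sqr_le (fun i j => xvar i j / h i) _ _ kL hX) _.
- by move=> j /kj/ltW.
- by move=> j /hi/ltW.
rewrite (_ : 12 * L * X / a = L * X * (12 / a)); last by ring.
rewrite -[leRHS]mulrA ler_wpM2l ?mulr_ge0// mulr_sumr; apply: ler_sum => j _.
rewrite mulr_sumr; apply: ler_sum => i Qi.
rewrite [leRHS]mulrCA ler_wpM2l ?hk_ge0//.
apply: le_trans (xvar_sqr_le j (ltn_ord i)) _.
rewrite mulrAC -ler_pdivrMr ?invr_gt0// invrK -mulrA ler_wpM2l// mulrC.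
exact: aE.
Qed.

Lemma energyQ_le (J Q : pred nat) :
  \sum_(j < N | J j) \sum_(i < N | Q i) h i * k j * E i j <= energy J.
Proof.
apply: ler_sum => j _; rewrite [leRHS](bigID (fun i : 'I_N => Q i))/= lerDl.
by apply: sumr_ge0 => i _; rewrite mulr_ge0 ?hk_ge0//; have [] := E_parts i j.
Qed.

Lemma energy_ge0 J : 0 <= energy J.
Proof.
apply: sumr_ge0 => j _; apply: sumr_ge0 => i _.
by rewrite mulr_ge0 ?hk_ge0//; have [] := E_parts i j.
Qed.

(** In the coarse columns the stabilization part of the energy controls the
    x-derivative with constant [b^2 * del0]; in the fine ones, in [layer_xvar],
    only [eps] is available, on a region of width [lx]. *)
Lemma upstream_xvar (J : pred nat) (L : R) : \sum_(j < N | J j) k j <= L ->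
  (\sum_(j < N | J j) \sum_(i < N | (i < n)%N) k j * xvar i j) ^+ 2 <=
  12 * L / (b ^+ 2 * del0) * energy J.
Proof.
move=> kL; have bd : 0 < b ^+ 2 * del0 by rewrite mulr_gt0// exprn_gt0.
have L0 : 0 <= L.
  by apply: le_trans kL; apply: sumr_ge0 => j _; exact/ltW/kj.
apply: le_trans (xvar_sum_sqr_le (Q := fun i => (i < n)%N) bd kL h1 _) _.
  by move=> i j _ ni; have [_ + _ _] := E_parts i j; exact.
rewrite mulr1 ler_wpM2l//; first by rewrite divr_ge0 ?mulr_ge0// ltW.
exact: (energyQ_le J (fun i => i < n)%N).
Qed.

Lemma layer_xvar (J : pred nat) (L : R) : \sum_(j < N | J j) k j <= L ->
  (\sum_(j < N | J j) \sum_(i < N | (n <= i)%N) k j * xvar i j) ^+ 2 <=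
  12 * L * lx / eps * energy J.
Proof.
move=> kL.
have L0 : 0 <= L.
  by apply: le_trans kL; apply: sumr_ge0 => j _; exact/ltW/kj.
have X0 : 0 <= lx.
  by apply: le_trans hl; apply: sumr_ge0 => j _; exact/ltW/hi.
apply: le_trans (xvar_sum_sqr_le (Q := fun i => (n <= i)%N) eps0 kL hl _) _.
  by move=> i j _ ni; have [] := E_parts i j.
rewrite ler_wpM2l//; first by rewrite divr_ge0 ?mulr_ge0// ltW.
exact: (energyQ_le J (fun i => n <= i)%N).
Qed.

Lemma upstream_nodal (J : pred nat) (L : R) : \sum_(j < N | J j) k j <= L ->
  (\sum_(j < N | J j) \sum_(i < N | (i < n)%N)
     h i * k j * (`|g i j| + `|g i j.+1|)) ^+ 2 <=
  72 * L / c * energy J.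
Proof.
move=> kL.
have L0 : 0 <= L.
  by apply: le_trans kL; apply: sumr_ge0 => j _; exact/ltW/kj.
apply: le_trans (sum2_sqr_le (Q := fun i => (i < n)%N) (fun i j => `|g i j| + `|g i j.+1|) _ _ kL h1) _.
- by move=> j /kj/ltW.
- by move=> j /hi/ltW.
rewrite mulr1 (_ : 72 * L / c * energy J = L * (72 / c * energy J)); last by ring.
rewrite ler_wpM2l//.
apply: (@le_trans _ _ (72 / c *
    \sum_(j < N | J j) \sum_(i < N | (i < n)%N) h i * k j * E i j)).
  rewrite mulr_sumr; apply: ler_sum => j _.
  rewrite mulr_sumr; apply: ler_sum => i Qi.
  rewrite [leRHS]mulrCA ler_wpM2l ?hk_ge0//.
  rewrite mulrAC ler_pdivlMr//.
  have [_ _ + _] := E_parts i j.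
  have cm : c * (g i j ^+ 2 + g i j.+1 ^+ 2) / 36 <= c * mass (nodal g i j) (nodal g i j).
    rewrite -mulrA ler_wpM2l ?(ltW c0)// /nodal /mass ler_wpM2r//.
    set p := g i j; set q := g i.+1 j; set r := g i j.+1; set s := g i.+1 j.+1.
    have := sqr_ge0 q; have := sqr_ge0 s; have := sqr_ge0 (p + q).
    have := sqr_ge0 (r + s); have := sqr_ge0 (p + r); have := sqr_ge0 (q + s).
    have := sqr_ge0 (p + q + r + s); rewrite !expr2; lra.
  have : `|g i j| ^+ 2 = g i j ^+ 2 by rewrite -normrX ger0_norm ?sqr_ge0.
  have : `|g i j.+1| ^+ 2 = g i j.+1 ^+ 2 by rewrite -normrX ger0_norm ?sqr_ge0.
  have := sqr_ge0 (`|g i j| - `|g i j.+1|).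
  rewrite !expr2 => s1 s2 s3.
  have s4 : (`|g i j| + `|g i j.+1|) * (`|g i j| + `|g i j.+1|) <=
      2 * (g i j ^+ 2 + g i j.+1 ^+ 2) by rewrite !expr2; lra.
  by have := ler_wpM2l (ltW c0) s4; lra.
rewrite ler_wpM2l//; first by rewrite divr_ge0// ltW.
exact: (energyQ_le J (fun i => i < n)%N).
Qed.

Variable I : nat -> nat -> R.

Lemma upstream_sum_le (J : pred nat) (L M : R) : \sum_(j < N | J j) k j <= L ->
  0 <= M ->
  (forall i j, (i < n)%N -> (j < N)%N -> J j -> `|I i j| <= M * (k j * xvar i j)) ->
  (\sum_(j < N | J j) \sum_(i < N | (i < n)%N) I i j) ^+ 2 <=
  M ^+ 2 * (12 * L / (b ^+ 2 * del0) * energy J).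
Proof.
move=> kL M0 IM.
apply: le_trans (ler_wpM2l (sqr_ge0 M) (upstream_xvar kL)).
rewrite -exprMn -ler_sqrt ?sqr_ge0// !sqrtr_sqr; apply: le_trans (ler_norm _).
rewrite mulr_sumr; apply: le_trans (ler_norm_sum _ _ _) _; apply: ler_sum => j Jj.
rewrite mulr_sumr; apply: le_trans (ler_norm_sum _ _ _) _; apply: ler_sum => i ni.
exact: IM.
Qed.

(** Summation by parts. *)
Lemma abel (phi f : nat -> R) m : f 0%N = 0 ->
  \sum_(i < m.+1) phi i * (f i.+1 - f i) =
  phi m * f m.+1 - \sum_(i < m) (phi i.+1 - phi i) * f i.+1.
Proof.
move=> f0; elim: m => [|m IH]; first by rewrite big_ord1 big_ord0 f0; ring.
by rewrite big_ord_recr/= IH [in RHS]big_ord_recr/=; ring.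
Qed.

Lemma abel_le (phi f : nat -> R) (M : R) : f 0%N = 0 -> 0 <= M ->
  (forall i, (i < n)%N -> `|phi i| <= M) ->
  (forall i, (i.+1 < n)%N -> `|phi i.+1 - phi i| <= M * h i.+1) ->
  `|\sum_(i < n) phi i * (f i.+1 - f i)| <=
  M * `|f n| + M * \sum_(i < n) h i * `|f i|.
Proof.
move=> f0 M0 pM dM; case: n nN pM dM => [|m] mN pM dM.
  by rewrite !big_ord0 normr0 mulr0 addr0 mulr_ge0.
rewrite abel//; apply: le_trans (ler_normB _ _) _; apply: lerD.
  by rewrite normrM ler_wpM2r// pM.
apply: le_trans (ler_norm_sum _ _ _) _.
rewrite big_ord_recl f0 normr0 mulr0 add0r mulr_sumr; apply: ler_sum => i _.
by rewrite normrM mulrA ler_wpM2r// dM// ltnS.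
Qed.

(** The numbers [phi i j] are the frozen values of the integrand, [e] the relative
    freezing error. The three summands of the constant come from the freezing error,
    from the boundary term on the transition line, bounded by [layer_nodal_le]
    through the fine columns, and from the differences of [phi] against the
    nodal values. *)
Lemma abel_sum_le (J : pred nat) (L M e : R) (phi : nat -> nat -> R) :
  \sum_(j < N | J j) k j <= L -> 0 <= M -> 0 <= e ->
  (forall i j, (i < n)%N -> (j < N)%N -> J j ->
    `|I i j - phi i j * (k j * ((g i.+1 j - g i j) + (g i.+1 j.+1 - g i j.+1)) / 2)|
     <= M * e * (k j * xvar i j)) ->
  (forall i j, (i < n)%N -> (j < N)%N -> J j -> `|phi i j| <= M) ->
  (forall i j, (i.+1 < n)%N -> (j < N)%N -> J j ->
    `|phi i.+1 j - phi i j| <= M * h i.+1) ->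
  (\sum_(j < N | J j) \sum_(i < N | (i < n)%N) I i j) ^+ 2 <=
  3 * M ^+ 2 * L * (12 * e ^+ 2 / (b ^+ 2 * del0) + 3 * lx / eps + 18 / c) * energy J.
Proof.
move=> kL M0 e0 Ie pM dM.
have H1 := upstream_xvar kL; have H2 := layer_xvar kL; have H3 := upstream_nodal kL.
set S1 := \sum_(j < N | J j) _ in H1; set S2 := \sum_(j < N | J j) _ in H2.
set S3 := \sum_(j < N | J j) _ in H3.
have H : `|\sum_(j < N | J j) \sum_(i < N | (i < n)%N) I i j| <=
    M * (e * S1 + S2 / 2 + S3 / 2).
  have -> : M * (e * S1 + S2 / 2 + S3 / 2) = \sum_(j < N | J j)
     (M * e * \sum_(i < N | (i < n)%N) k j * xvar i j
      + (M / 2 * (\sum_(i < N | (n <= i)%N) k j * xvar i j) +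
         M / 2 * \sum_(i < N | (i < n)%N) h i * k j * (`|g i j| + `|g i j.+1|))).
    by rewrite !big_split/= -!mulr_sumr /S1 /S2 /S3; ring.
  apply: le_trans (ler_norm_sum _ _ _) _; apply: ler_sum => j Jj.
  have jN := ltn_ord j.
  pose A (l : nat) := \sum_(i < N | (i < n)%N) phi i j * (g i.+1 l - g i l).
  have AM l : (l <= N)%N -> `|A l| <=
      M * \sum_(i < N | (n <= i)%N) `|g i.+1 l - g i l| +
      M * \sum_(i < N | (i < n)%N) h i * `|g i l|.
    move=> lN; rewrite /A -(big_ord_widen N (fun i => phi i j * (g i.+1 l - g i l)))//.
    apply: le_trans (abel_le (phi := phi^~ j) (f := g^~ l) (gl lN) M0 _ _) _.
    - by move=> i ni; exact: pM.
    - by move=> i ni; exact: dM.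
    apply: lerD; rewrite ler_wpM2l//; first by apply: layer_nodal_le; rewrite ?leqnn.
    by rewrite (big_ord_widen N (fun i => h i * `|g i l|)).
  pose er i := I i j - phi i j *
    (k j * ((g i.+1 j - g i j) + (g i.+1 j.+1 - g i j.+1)) / 2).
  have -> : \sum_(i < N | (i < n)%N) I i j =
     \sum_(i < N | (i < n)%N) er i + k j / 2 * (A j + A j.+1).
    rewrite /A mulrDr !mulr_sumr -!big_split/=; apply: eq_bigr => i _.
    by rewrite /er; field.
  apply: le_trans (ler_normD _ _) _; apply: lerD.
    rewrite mulr_sumr; apply: le_trans (ler_norm_sum _ _ _) _.
    by apply: ler_sum => i ni; exact: Ie.
  have k20 : 0 <= k j / 2 by rewrite divr_ge0// ltW// kj.
  rewrite normrM ger0_norm//.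
  apply: le_trans (ler_wpM2l k20 (ler_normD _ _)) _.
  apply: le_trans (ler_wpM2l k20 (lerD (AM j (ltnW jN)) (AM j.+1 jN))) _.
  rewrite le_eqVlt; apply/orP; left; apply/eqP.
  have -> : \sum_(i < N | (n <= i)%N) k j * xvar i j =
     k j * (\sum_(i < N | (n <= i)%N) `|g i.+1 j - g i j| +
            \sum_(i < N | (n <= i)%N) `|g i.+1 j.+1 - g i j.+1|).
    by rewrite -mulr_sumr -big_split.
  have -> : \sum_(i < N | (i < n)%N) h i * k j * (`|g i j| + `|g i j.+1|) =
     k j * (\sum_(i < N | (i < n)%N) h i * `|g i j| +
            \sum_(i < N | (i < n)%N) h i * `|g i j.+1|).
    by rewrite -big_split/= mulr_sumr; apply: eq_bigr => i _; ring.
  by ring.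
have S10 : 0 <= S1.
  apply: sumr_ge0 => j _; apply: sumr_ge0 => i _.
  by rewrite mulr_ge0 ?xvar_ge0// ltW// kj.
have S20 : 0 <= S2.
  apply: sumr_ge0 => j _; apply: sumr_ge0 => i _.
  by rewrite mulr_ge0 ?xvar_ge0// ltW// kj.
have S30 : 0 <= S3.
  apply: sumr_ge0 => j _; apply: sumr_ge0 => i _.
  by rewrite mulr_ge0 ?addr_ge0 ?hk_ge0.
have := ler_pM (normr_ge0 _) (normr_ge0 _) H H.
rewrite -normrM -expr2 ger0_norm ?sqr_ge0// => H'; apply: le_trans H' _.
have q : (e * S1 + S2 / 2 + S3 / 2) ^+ 2 <=
    3 * (e ^+ 2 * S1 ^+ 2 + S2 ^+ 2 / 4 + S3 ^+ 2 / 4).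
  have := sqr_ge0 (e * S1 - S2 / 2); have := sqr_ge0 (e * S1 - S3 / 2).
  have := sqr_ge0 (S2 / 2 - S3 / 2); rewrite !expr2; lra.
have H1' := ler_wpM2l (sqr_ge0 e) H1.
have q' : (e * S1 + S2 / 2 + S3 / 2) ^+ 2 <= 3 * (L *
    (12 * e ^+ 2 / (b ^+ 2 * del0) + 3 * lx / eps + 18 / c) * energy J).
  apply: le_trans q _; rewrite ler_wpM2l//; lra.
rewrite -expr2 exprMn.
rewrite (_ : 3 * M ^+ 2 * L * _ * _ = M ^+ 2 * (3 * (L *
    (12 * e ^+ 2 / (b ^+ 2 * del0) + 3 * lx / eps + 18 / c) * energy J))); last by ring.
by rewrite ler_wpM2l ?sqr_ge0.
Qed.

(** Column by column: each column contributes the same bound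
    [O(hx * Num.sqrt Q)] for the sum of [k j * xvar i j], and the coefficients
    [ex i.+1 - ex i] telescope to at most [ex n]. Cauchy-Schwarz over all cells
    at once would lose this, since most of [ex n] sits in the last columns. *)
Lemma telescoping_sum_le (M hx : R) (ex : nat -> R) : 0 <= M -> 0 < hx ->
  (forall i, (i < n)%N -> h i = hx) -> \sum_(j < N) k j <= 1 ->
  (forall i, (i < n)%N -> ex i <= ex i.+1) -> 0 <= ex 0%N ->
  (forall i j, (i < n)%N -> (j < N)%N ->
     `|I i j| <= M * (ex i.+1 - ex i) / hx * (k j * xvar i j)) ->
  (\sum_(j < N) \sum_(i < N | (i < n)%N) I i j) ^+ 2 <=
  M ^+ 2 * ex n ^+ 2 * (12 / (hx * (b ^+ 2 * del0)) * energy xpredT).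
Proof.
move=> M0 hx0 hE k1 exm ex0 IM.
have bd : 0 < b ^+ 2 * del0 by rewrite mulr_gt0// exprn_gt0.
set Q := 12 / _ * _.
have Q0 : 0 <= Q by rewrite mulr_ge0 ?energy_ge0// divr_ge0// ltW// mulr_gt0.
have col i : (i < n)%N -> \sum_(j < N) k j * xvar i j <= hx * Num.sqrt Q.
  move=> ni; have iN : (i < N)%N by exact: leq_trans ni nN.
  rewrite -[hx in leRHS]gtr0_norm// -sqrtr_sqr -sqrtrM ?sqr_ge0//.
  apply: le_trans (ler_norm _) _; rewrite -sqrtr_sqr ler_wsqrtr//.
  have hsum : \sum_(l < N | l == i :> nat) h l <= hx.
    by rewrite (big_pred1 (Ordinal iN)) ?hE.
  have := @xvar_sum_sqr_le xpredT (fun l => l == i) 1 hx (b ^+ 2 * del0) bd k1 hsum.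
  under eq_bigr do rewrite (big_pred1 (Ordinal iN))//.
  move=> H; apply: le_trans (H _) _.
    by move=> l j _ /eqP ->; have [_ + _ _] := E_parts i j; exact.
  rewrite /Q (_ : hx ^+ 2 * _ = 12 * 1 * hx / (b ^+ 2 * del0) * energy xpredT).
    rewrite ler_wpM2l//; first by rewrite divr_ge0 ?mulr_ge0// ltW.
    exact: (energyQ_le xpredT (fun l => l == i)).
  by field; rewrite !lt0r_neq0.
have S : `|\sum_(j < N) \sum_(i < N | (i < n)%N) I i j| <= M * ex n * Num.sqrt Q.
  rewrite exchange_big/=; apply: le_trans (ler_norm_sum _ _ _) _.
  apply: (@le_trans _ _ (\sum_(i < N | (i < n)%N) M * (ex i.+1 - ex i) * Num.sqrt Q)).
    apply: ler_sum => i ni; apply: le_trans (ler_norm_sum _ _ _) _.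
    apply: (@le_trans _ _ (\sum_(j < N) M * (ex i.+1 - ex i) / hx * (k j * xvar i j))).
      by apply: ler_sum => j _; exact: IM.
    have m0 : 0 <= M * (ex i.+1 - ex i) / hx.
      by rewrite divr_ge0 ?mulr_ge0 ?subr_ge0 ?exm// ltW.
    rewrite -mulr_sumr; apply: le_trans (ler_wpM2l m0 (col i ni)) _.
    rewrite le_eqVlt; apply/orP; left; apply/eqP; field; exact: lt0r_neq0.
  rewrite -mulr_suml -mulr_sumr ler_wpM2r ?sqrtr_ge0// ler_wpM2l//.
  rewrite -(big_ord_widen N (fun i => ex i.+1 - ex i))// telescope_ord; lra.
have := ler_pM (normr_ge0 _) (normr_ge0 _) S S.
rewrite -normrM -expr2 ger0_norm ?sqr_ge0// => H; apply: le_trans H _.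
by rewrite -[leLHS]expr2 !exprMn sqr_sqrtr.
Qed.
End estimates.

Lemma node_incr (R : realType) (Z : nat -> R) (N : nat) :
  (forall i, (i < N)%N -> 0 < Z i.+1 - Z i) ->
  forall i j, (i <= j <= N)%N -> Z i <= Z j.
Proof.
move=> ZK i j /andP[]; elim: j => [|j IH]; first by rewrite leqn0 => /eqP ->.
rewrite leq_eqVlt => /predU1P[-> //|ij] jN.
by apply: le_trans (IH ij (ltnW jN)) _; have := ZK j jN; rewrite subr_gt0 => /ltW.
Qed.

(** * The Shishkin mesh *)
Section mesh.
Context {R : realType}.
Variables (lx ly : R) (N : nat).
Hypotheses (N0 : (0 < N)%N) (N6 : (6 %| N)%N) (lx0 : 0 < lx) (lx1 : lx <= 1 / 2)
  (ly0 : 0 < ly) (ly1 : ly <= 1 / 4).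
Let X := node_x lx N.
Let Y := node_y ly N.
Let n := (N %/ 2)%N.

Definition width_x i := X i.+1 - X i.
Definition width_y j := Y j.+1 - Y j.
Local Notation hx := width_x.
Local Notation hy := width_y.

Let NR : N%:R != 0 :> R.
Proof. by rewrite pnatr_eq0 -lt0n. Qed.
Let NR0 : 0 < N%:R :> R.
Proof. by rewrite ltr0n. Qed.
Let q := (N %/ 6)%N.
Let NE : N = (6 * q)%N.
Proof. by rewrite mulnC divnK. Qed.
Let q0 : (0 < q)%N.
Proof. by move: N0; rewrite {1}NE muln_gt0. Qed.
Let nE : n = (3 * q)%N.
Proof. by rewrite /n NE -(mulnA 2 3) mulKn. Qed.
Let n3q : (N %/ 3 = 2 * q)%N.
Proof. by rewrite NE -(mulnA 3 2) mulKn. Qed.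
Let n23' : ((2 * N) %/ 3 = 4 * q)%N.
Proof. by rewrite NE mulnA -(mulnA 3 4) mulKn. Qed.
Let n2 : N%:R = 2 * n%:R :> R.
Proof. by rewrite -natrM nE mulnA -NE. Qed.
Let n3 : N%:R = 3 * (N %/ 3)%:R :> R.
Proof. by rewrite -natrM n3q mulnA -NE. Qed.
Let n23 : ((2 * N) %/ 3)%:R = 2 * (N %/ 3)%:R :> R.
Proof. by rewrite -natrM n3q n23' mulnA. Qed.
Let nR0 : n%:R != 0 :> R.
Proof. by rewrite pnatr_eq0 -lt0n nE muln_gt0. Qed.
Let mR0 : (N %/ 3)%:R != 0 :> R.
Proof. by rewrite pnatr_eq0 -lt0n n3q muln_gt0. Qed.

Lemma natr_half : N%:R = 2 * n%:R :> R.
Proof. exact: n2. Qed.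

Lemma half_le : (n <= N)%N.
Proof. by rewrite nE NE leq_mul2r orbT. Qed.

Lemma hx_coarse i : (i < n)%N -> hx i = 2 * (1 - lx) / N%:R.
Proof.
move=> ni; rewrite /width_x /X /node_x ni (ltnW ni) -(natr1 i).
by field.
Qed.

Lemma hx_fine i : (n <= i < N)%N -> hx i = 2 * lx / N%:R.
Proof.
move=> /andP[ni iN]; rewrite /width_x /X /node_x ltnNge ni /= -(natr1 i).
case: ifP => h; last by field.
have -> : i%:R = n%:R :> R by congr (_%:R); apply/eqP; rewrite eqn_leq h ni.
by rewrite n2; field; exact: nR0.
Qed.

Lemma node_xE i : (i <= n)%N -> X i = 2 * i%:R * (1 - lx) / N%:R.
Proof. by move=> h; rewrite /X /node_x h. Qed.

Lemma node_x0 : X 0%N = 0.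
Proof. by rewrite node_xE// mulr0 !mul0r. Qed.

Lemma node_xn : X n = 1 - lx.
Proof. by rewrite node_xE// n2; field; exact: nR0. Qed.

Lemma node_xN : X N = 1.
Proof.
rewrite /X /node_x -/n ifN; first by rewrite subrr; ring.
by rewrite -ltnNge nE NE ltn_mul2r q0.
Qed.

(** The y-mesh has only two cell heights, the larger one in the middle third. *)
Lemma hy_cases j : (j < N)%N ->
  hy j = 3 * ly / N%:R \/
  (N %/ 3 <= j < (2 * N) %/ 3)%N /\ hy j = 3 * (1 - 2 * ly) / N%:R.
Proof.
move=> jN; rewrite /width_y /Y /node_y.
have /orP[h1|h1] := leqVgt (N %/ 3) j; last first.
  by left; rewrite h1 (ltnW h1) -(natr1 j); field.
have /orP[h2|h2] := leqVgt ((2 * N) %/ 3) j; last first.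
  right; split; first by rewrite h1 h2.
  rewrite (_ : (j < N %/ 3)%N = false); last by rewrite ltnNge h1.
  rewrite h2; case: ifP => h.
    have jE : j%:R = (N %/ 3)%:R :> R by congr (_%:R); apply/eqP; rewrite eqn_leq h h1.
    by rewrite -(natr1 j) jE n3; field; exact: mR0.
  by rewrite (ltnW h2) -(natr1 j); field.
left.
rewrite (_ : (j < N %/ 3)%N = false); last by rewrite ltnNge h1.
rewrite (_ : (j < (2 * N) %/ 3)%N = false); last by rewrite ltnNge h2.
rewrite (_ : (j <= N %/ 3)%N = false); last first.
  by apply/negbTE; rewrite -ltnNge; apply: leq_trans h2; rewrite n23' n3q ltn_mul2r q0.
case: ifP => h; last by rewrite -(natr1 j); field.
have jE : j%:R = 2 * (N %/ 3)%:R :> R.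
  by rewrite -n23; congr (_%:R); apply/eqP; rewrite eqn_leq h h2.
by rewrite -(natr1 j) jE n3; field; exact: mR0.
Qed.

Lemma node_y0 : Y 0%N = 0.
Proof. by rewrite /Y /node_y leq0n mulr0 !mul0r. Qed.

Lemma node_yN : Y N = 1.
Proof.
rewrite /Y /node_y n3q n23' !ifN; first by rewrite subrr; ring.
- by rewrite -ltnNge NE ltn_mul2r q0.
- by rewrite -ltnNge NE ltn_mul2r q0.
Qed.

Lemma node_y_third : Y (N %/ 3)%N = ly.
Proof. by rewrite /Y /node_y leqnn n3; field; exact: mR0. Qed.

Lemma node_y_two_thirds : Y ((2 * N) %/ 3)%N = 1 - ly.
Proof.
rewrite /Y /node_y ifN; last by rewrite -ltnNge n3q n23' ltn_mul2r q0.
by rewrite leqnn n23 n3; field; exact: mR0.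
Qed.

Lemma hx_gt0 i : (i < N)%N -> 0 < hx i.
Proof.
move=> iN; have [ni|ni] := ltnP i n.
  rewrite hx_coarse//; apply: divr_gt0; last exact: NR0.
  by have := lx1; lra.
rewrite hx_fine ?ni//; apply: divr_gt0; last exact: NR0.
by have := lx0; lra.
Qed.

Lemma hy_gt0 j : (j < N)%N -> 0 < hy j.
Proof.
by move=> /hy_cases[->|[_ ->]]; (apply: divr_gt0; last exact: NR0);
  have := ly0; have := ly1; lra.
Qed.

Lemma hy_le j : (j < N)%N -> hy j <= 3 / N%:R.
Proof.
move=> /hy_cases[->|[_ ->]]; rewrite ler_wpM2r ?invr_ge0 ?ler0n//;
  have := ly0; have := ly1; lra.
Qed.

Lemma node_x_incr i j : (i <= j <= N)%N -> X i <= X j.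
Proof. by apply: node_incr => l /hx_gt0. Qed.
Lemma node_y_incr i j : (i <= j <= N)%N -> Y i <= Y j.
Proof. by apply: node_incr => l /hy_gt0. Qed.

Lemma node_x_in i : (i <= N)%N -> 0 <= X i <= 1.
Proof.
move=> iN; have := @node_x_incr 0%N i; have := @node_x_incr i N.
by rewrite node_x0 node_xN iN leqnn => -> // ->.
Qed.
Lemma node_y_in i : (i <= N)%N -> 0 <= Y i <= 1.
Proof.
move=> iN; have := @node_y_incr 0%N i; have := @node_y_incr i N.
by rewrite node_y0 node_yN iN leqnn => -> // ->.
Qed.

Lemma sum_hy : \sum_(j < N) hy j = 1.
Proof. by rewrite /width_y telescope_ord node_y0 node_yN subr0. Qed.

Lemma OmegaE : Omega = orect (X 0%N) (X N) (Y 0%N) (Y N).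
Proof. by rewrite node_x0 node_xN node_y0 node_yN. Qed.

Lemma cell_Omega i j : (i < N)%N -> (j < N)%N -> cell X Y i j `<=` Omega.
Proof.
move=> iN jN [x y] [/=]; rewrite !in_itv/= => h1 h2.
have /andP[a1 a2] := node_x_in (ltnW iN); have /andP[a3 a4] := node_x_in iN.
have /andP[b1 b2] := node_y_in (ltnW jN); have /andP[b3 b4] := node_y_in jN.
by split; rewrite /= in_itv/=; lra.
Qed.

(** Bilinear on every open cell: the derivatives of finite element functions have
    this form, and nothing can be said about them on the mesh lines. *)
Definition cellwise (P : nat -> nat -> quad) (f : R * R -> R) :=
  forall i j, (i < N)%N -> (j < N)%N -> forall p, cell X Y i j p ->
    f p = bil (X i) (X i.+1) (Y j) (Y j.+1) (P i j) p.

Lemma L2_inner_cellwise P Q f g : cellwise P f -> cellwise Q g ->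
  L2_inner f g = sumcells N hx hy (fun i j => mass (P i j) (Q i j)).
Proof.
move=> fP gQ; rewrite L2_innerE OmegaE.
apply: (@Rintegral_cells _ X Y N N _ (fun i j => hx i * hy j * mass (P i j) (Q i j))) => //.
- by move=> i /hx_gt0; rewrite subr_gt0.
- by move=> i /hy_gt0; rewrite subr_gt0.
move=> i j iN jN.
apply: has_integral_eq (has_integral_bilM (P i j) (Q i j) _ _) => //.
- exact: measurable_orect.
- by move=> p cp; rewrite (fP i j)// (gQ i j).
- by have := hx_gt0 iN; rewrite subr_gt0.
- by have := hy_gt0 jN; rewrite subr_gt0.
Qed.
End mesh.

(** * Finite element functions through nodal values *)
Section bilinear.
Context {R : realType}.
Implicit Types (a b c d : R).

Lemma bilinear_interp (v : R * R -> R) a b c d : a < b -> c < d ->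
  bilinear_on (`[a, b] `*` `[c, d]) v ->
  forall p, (`[a, b] `*` `[c, d]) p ->
  v p = bil a b c d (v (a, c), v (b, c), v (a, d), v (b, d)) p.
Proof.
move=> ab cd [a0 [a1 [a2 [a3 vE]]]] p cp.
have la : a \in `[a, b] by rewrite in_itv/= lexx ltW.
have lb : b \in `[a, b] by rewrite in_itv/= lexx ltW.
have lc : c \in `[c, d] by rewrite in_itv/= lexx ltW.
have ld : d \in `[c, d] by rewrite in_itv/= lexx ltW.
rewrite /bil (vE p)// !vE//=; field.
by rewrite !subr_eq0 !gt_eqF.
Qed.

Lemma derive1_near_eq (f g : R -> R) a b (x l : R) : a < x < b ->
  (forall t, a < t < b -> f t = g t) -> is_derive x 1 g l -> derive1 f x = l.
Proof.
move=> axb fg gl; rewrite derive1E.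
have : is_derive x 1 f l.
  apply: near_eq_is_derive gl.
  have : \forall t \near x, t \in `]a, b[.
    by apply: near_in_itvoo; rewrite in_itv.
  by apply: filterS => t; rewrite in_itv/= => /fg.
by case.
Qed.

Lemma is_derive_affine (u v x : R) : is_derive x 1 (fun t : R => u + v * t) v.
Proof.
have := is_deriveD (is_derive_cst u x 1) (is_deriveZ v (is_derive_id x 1)).
by rewrite add0r /GRing.scale/= mulr1.
Qed.

Lemma dx_bil (v : R * R -> R) a b c d (P : quad) : 
  (forall p, orect a b c d p -> v p = bil a b c d P p) ->
  forall p, orect a b c d p -> dx v p = bil a b c d (qdx (b - a) P) p.
Proof.
move: P => [[[p q] r] s] vE [x y] [/= xab ycd].
rewrite /dx/=; apply: (@derive1_near_eq _ (fun t => bil a b c d (p, q, r, s) (t, y)) a b).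
- by move: xab; rewrite in_itv.
- by move=> t tab; apply: vE; split => //=; rewrite in_itv.
set e := (y - c) / (d - c); set h := b - a.
set l := (X in is_derive _ _ _ X).
rewrite (_ : (fun t => _) = (fun t : R => (p * (1 - e) + r * e - l * a) + l * t)).
  exact: is_derive_affine.
by apply/funext => t; rewrite /l /bil /= -/e -/h; ring.
Qed.

Lemma dy_bil (v : R * R -> R) a b c d (P : quad) : 
  (forall p, orect a b c d p -> v p = bil a b c d P p) ->
  forall p, orect a b c d p -> dy v p = bil a b c d (qdy (d - c) P) p.
Proof.
move: P => [[[p q] r] s] vE [x y] [/= xab ycd].
rewrite /dy/=; apply: (@derive1_near_eq _ (fun t => bil a b c d (p, q, r, s) (x, t)) c d).
- by move: ycd; rewrite in_itv.
- by move=> t tab; apply: vE; split => //=; rewrite in_itv.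
set e := (x - a) / (b - a); set h := d - c.
set l := (X in is_derive _ _ _ X).
rewrite (_ : (fun t => _) = (fun t : R => (p * (1 - e) + q * e - l * c) + l * t)).
  exact: is_derive_affine.
by apply/funext => t; rewrite /l /bil /= -/e -/h; ring.
Qed.

Lemma bil_add a b c d (P Q : quad) z :
  bil a b c d (qadd P Q) z = bil a b c d P z + bil a b c d Q z.
Proof.
by move: P Q => [[[p q] r] s] [[[p' q'] r'] s']; rewrite /bil/=; ring.
Qed.

Lemma bil_scale a b c d (P : quad) (l : R) z :
  bil a b c d (qscale l P) z = l * bil a b c d P z.
Proof. by move: P => [[[p q] r] s]; rewrite /bil/=; ring. Qed.

End bilinear.

Section fe.
Context {R : realType}.
Variables (lx ly : R) (N : nat).
Hypotheses (N0 : (0 < N)%N) (N6 : (6 %| N)%N) (lx0 : 0 < lx) (lx1 : lx <= 1 / 2)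
  (ly0 : 0 < ly) (ly1 : ly <= 1 / 4).
Let X := node_x lx N.
Let Y := node_y ly N.
Let n := (N %/ 2)%N.
Local Notation VN := (fe_space lx ly N).
Local Notation hx := (width_x lx N).
Local Notation hy := (width_y ly N).
Local Notation cellwise := (cellwise lx ly N).

Definition nodes (v : R * R -> R) (i j : nat) : R := v (node_x lx N i, node_y ly N j).

Let hx0 i : (i < N)%N -> X i < X i.+1.
Proof. by move=> iN; rewrite -subr_gt0; exact: hx_gt0. Qed.
Let hy0 j : (j < N)%N -> Y j < Y j.+1.
Proof. by move=> iN; rewrite -subr_gt0; exact: hy_gt0. Qed.

Lemma fe_closed_cell v i j : VN v -> (i < N)%N -> (j < N)%N ->
  forall p, (`[X i, X i.+1] `*` `[Y j, Y j.+1]) p ->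
  v p = bil (X i) (X i.+1) (Y j) (Y j.+1) (nodal (nodes v) i j) p.
Proof.
move=> [_ _ vb] iN jN; apply: bilinear_interp; [exact: hx0|exact: hy0|].
by apply: vb; exists i.+1, j.+1.
Qed.

Lemma cell_closed i j : cell X Y i j `<=` `[X i, X i.+1] `*` `[Y j, Y j.+1].
Proof.
move=> [x y] [/= h1 h2]; move: h1 h2; rewrite !in_itv/= => /andP[a b] /andP[c d].
by split; rewrite /= ?in_itv/= !ltW.
Qed.

Lemma fe_cellwise v : VN v -> cellwise (nodal (nodes v)) v.
Proof. by move=> Vv i j iN jN p cp; apply: fe_closed_cell => //; exact: cell_closed. Qed.

Lemma dx_cellwise v P : cellwise P v ->
  cellwise (fun i j => qdx (hx i) (P i j)) (dx v).
Proof. by move=> vP i j iN jN; apply: dx_bil; exact: vP. Qed.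

Lemma dy_cellwise v P : cellwise P v ->
  cellwise (fun i j => qdy (hy j) (P i j)) (dy v).
Proof. by move=> vP i j iN jN; apply: dy_bil; exact: vP. Qed.

Lemma delta_cell (Cs : R) i j p : (i < N)%N -> (j < N)%N -> cell X Y i j p ->
  delta Cs lx ly N p = stab (Cs / N%:R) n i.
Proof.
move: p => [x y] iN jN cp.
have [/= + +] := cell_Omega N0 N6 lx0 lx1 ly0 ly1 iN jN cp.
rewrite ?in_itv/= => /andP[x0 x1] /andP[y0 y1].
have [/= + _] := cp; rewrite ?in_itv/= => /andP[xi xi1].
have Xn : X n = 1 - lx by exact: node_xn.
have nN : (n <= N)%N by exact: half_le.
have incr := node_x_incr N0 N6 lx0 lx1.
rewrite /delta /stab; case: ifPn => [|] pin; case: ifPn => // ni.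
  have : 1 - lx < x.
    by apply: le_lt_trans xi; rewrite -Xn; apply: incr; rewrite (ltnW iN) leqNgt ni.
  by move/set_mem: pin => [] [/= + _]; rewrite ?in_itv/=; lra.
exfalso; move: pin; rewrite notin_setE; apply.
have x1l : x <= 1 - lx.
  by apply/ltW/(lt_le_trans xi1); rewrite -Xn; apply: incr; rewrite nN andbT.
have [h|h] := leP ly y; last first.
  by right; split => /=; rewrite ?in_itv/=; [lra|left => /=; rewrite ?in_itv/=; lra].
have [h'|h'] := leP y (1 - ly); last first.
  by right; split => /=; rewrite ?in_itv/=; [lra|right => /=; rewrite ?in_itv/=; lra].
by left; split => /=; rewrite ?in_itv/=; lra.
Qed.

Variables (eps b c Cs : R).
Hypotheses (eps0 : 0 < eps) (b0 : 0 < b) (c0 : 0 < c) (Cs0 : 0 < Cs).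
Let del := delta Cs lx ly N.
Let dl i := stab (Cs / N%:R) n i.

Lemma sumcellsD F G :
  sumcells N hx hy (fun i j => F i j + G i j) = sumcells N hx hy F + sumcells N hx hy G.
Proof.
rewrite /sumcells -big_split/=; apply: eq_bigr => j _.
by rewrite -big_split/=; apply: eq_bigr => i _; rewrite mulrDr.
Qed.

Lemma sumcellsZ a F :
  sumcells N hx hy (fun i j => a * F i j) = a * sumcells N hx hy F.
Proof.
rewrite /sumcells mulr_sumr; apply: eq_bigr => j _.
by rewrite mulr_sumr; apply: eq_bigr => i _; rewrite mulrCA.
Qed.

Lemma eq_sumcells F G : (forall i j, (i < N)%N -> (j < N)%N -> F i j = G i j) ->
  sumcells N hx hy F = sumcells N hx hy G.
Proof.
by move=> FG; apply: eq_bigr => j _; apply: eq_bigr => i _; rewrite FG.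
Qed.

Lemma bform_cells w v : VN w -> VN v ->
  bform eps b c del w v = sumcells N hx hy (fun i j =>
    Bcell eps b c (dl i) (hx i) (hy j) (nodal (nodes w) i j) (nodal (nodes v) i j)).
Proof.
move=> /fe_cellwise cw /fe_cellwise cv; rewrite /bform.
have L2 := L2_inner_cellwise N0 N6 lx0 lx1 ly0 ly1.
rewrite (L2 _ _ _ _ (dx_cellwise cw) (dx_cellwise cv)).
rewrite (L2 _ _ _ _ (dy_cellwise cw) (dy_cellwise cv)).
have cbc : cellwise (fun i j => qadd (qscale b (qdx (hx i) (nodal (nodes w) i j)))
    (qscale c (nodal (nodes w) i j))) (fun p => b * dx w p + c * w p).
  move=> i j iN jN p cp.
  by rewrite bil_add !bil_scale (dx_cellwise cw iN jN cp) (cw _ _ iN jN _ cp).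
have cdb : cellwise (fun i j => qscale (dl i * b) (qdx (hx i) (nodal (nodes v) i j)))
    (fun p => del p * b * dx v p).
  move=> i j iN jN p cp.
  by rewrite bil_scale (dx_cellwise cv iN jN cp) /del (delta_cell Cs iN jN cp).
rewrite (L2 _ _ _ _ cbc cv) (L2 _ _ _ _ cbc cdb).
by rewrite -sumcellsD -sumcellsZ -!sumcellsD.
Qed.

Lemma energy_cells v : VN v ->
  energy_norm eps b c del v = Num.sqrt (sumcells N hx hy (fun i j =>
    Ecell eps b c (dl i) (hx i) (hy j) (nodal (nodes v) i j))).
Proof.
move=> /fe_cellwise cv; rewrite /energy_norm; congr Num.sqrt.
have L2 := L2_inner_cellwise N0 N6 lx0 lx1 ly0 ly1.
have c1 : cellwise (fun i j => qscale (eps + b ^+ 2 * dl i) (qdx (hx i) (nodal (nodes v) i j)))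
    (fun p => (eps + b ^+ 2 * del p) * dx v p).
  move=> i j iN jN p cp.
  by rewrite bil_scale (dx_cellwise cv iN jN cp) /del (delta_cell Cs iN jN cp).
have c2 : cellwise (fun i j => qscale c (nodal (nodes v) i j)) (fun p => c * v p).
  by move=> i j iN jN p cp; rewrite bil_scale (cv _ _ iN jN _ cp).
rewrite (L2 _ _ _ _ c1 (dx_cellwise cv)) (L2 _ _ _ _ c2 cv).
rewrite (L2 _ _ _ _ (dy_cellwise cv) (dy_cellwise cv)).
rewrite -sumcellsZ -!sumcellsD; apply: eq_sumcells => i j iN jN.
by rewrite /Ecell !massZl.
Qed.

Lemma nodes_boundary v : VN v ->
  (forall j, (j <= N)%N -> nodes v 0%N j = 0) /\
  (forall j, (j <= N)%N -> nodes v N j = 0).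
Proof.
move=> [_ v0 _].
have xin := node_x_in N0 N6 lx0 lx1; have yin := node_y_in N0 N6 ly0 ly1.
have x0 : node_x lx N 0 = 0 by exact: node_x0.
have xN : node_x lx N N = 1 by exact: node_xN.
split => l lN; apply: v0; rewrite ?x0 ?xN;
  have := xin _ lN; have := yin _ lN => h1 h2; split;
  try (by split => /=; rewrite ?in_itv/=; lra);
  by case => /=; rewrite ?in_itv/=; lra.
Qed.
End fe.

(** * Reweighting a finite element function in y *)
Section testfun.
Context {R : realType}.

Lemma expR_diff_le (s t : R) : `|expR s - expR t| <= `|s - t| * (expR s + expR t).
Proof.
wlog st : s t / s <= t.
  move=> H; have [/H//|/ltW/H h] := leP s t.
  by rewrite distrC (distrC s) (addrC (expR s)).
rewrite distrC (distrC s) !ger0_norm ?subr_ge0 ?ler_expR//.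
have E : expR s = expR t * expR (s - t) by rewrite -expRD addrC subrK.
have := expR_ge1Dx (s - t); have t0 := expR_gt0 t; have s0 := expR_gt0 s.
move=> /(ler_wpM2l (ltW t0)); rewrite -E.
have : 0 <= (t - s) * expR s by rewrite mulr_ge0 ?subr_ge0// ltW.
lra.
Qed.

Definition clamp (t : R) : R := Num.max 0 (Num.min 1 t).

Lemma clamp_id t : 0 <= t <= 1 -> clamp t = t.
Proof. by move=> /andP[t0 t1]; rewrite /clamp min_r// max_r. Qed.
Lemma clamp_ge1 t : 1 <= t -> clamp t = 1.
Proof. by move=> t1; rewrite /clamp min_l// max_r. Qed.
Lemma clamp_le0 t : t <= 0 -> clamp t = 0.
Proof. by move=> t0; rewrite /clamp min_r ?max_l//; lra. Qed.

Lemma continuous_clamp : continuous clamp.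
Proof.
move=> t; apply: (@continuous_max _ _ (fun=> 0) (fun t : R => Num.min 1 t)).
  exact: cst_continuous.
apply: (@continuous_min _ _ (fun=> 1) (fun t : R => t)); first exact: cst_continuous.
exact: cvg_id.
Qed.

Lemma cvg_sum_seq (I T : Type) (F : set_system T) (r : seq I) (f : I -> T -> R)
    (l : I -> R) : Filter F -> (forall j, f j x @[x --> F] --> l j) ->
  (\sum_(j <- r) f j x) @[x --> F] --> \sum_(j <- r) l j.
Proof.
move=> FF fl; elim: r => [|j r IH].
  rewrite big_nil; under eq_fun do rewrite big_nil; exact: cvg_cst.
rewrite big_cons; under eq_fun do rewrite big_cons; exact: cvgD.
Qed.

Lemma bil_bilinear a b c d (P : quad) (S : set (R * R)) :
  a < b -> c < d -> bilinear_on S (bil a b c d P).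
Proof.
move: P => [[[p q] r] s] ab cd.
pose be := (q - p) / (b - a); pose ga := (r - p) / (d - c).
pose om := (s - r - q + p) / ((b - a) * (d - c)).
exists (p - be * a - ga * c + om * a * c), (be - om * c), (ga - om * a), om.
move=> [x y] _; rewrite /bil /be /ga /om /=; field.
by rewrite !subr_eq0 !gt_eqF.
Qed.

Variables (lx ly : R) (N : nat).
Hypotheses (N0 : (0 < N)%N) (N6 : (6 %| N)%N) (lx0 : 0 < lx) (lx1 : lx <= 1 / 2)
  (ly0 : 0 < ly) (ly1 : ly <= 1 / 4).
Let X := node_x lx N.
Let Y := node_y ly N.
Local Notation VN := (fe_space lx ly N).
Local Notation hx := (width_x lx N).
Local Notation hy := (width_y ly N).

Definition ramp j (y : R) := clamp ((y - Y j) / hy j).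

(** The nodal interpolant of [G] with its values on the line [y = Y j] multiplied by
    [W j]. Each [ramp] climbs from 0 to 1 across one row of cells, so the sum
    telescopes below the current row; this gives one formula on the whole square,
    for which continuity is immediate. *)
Definition reweight (W : nat -> R) (G : R * R -> R) (p : R * R) : R :=
  \sum_(j < N) (W j.+1 * G (p.1, Y j.+1) - W j * G (p.1, Y j)) * ramp j p.2.

Variables (W : nat -> R) (G : R * R -> R).
Hypothesis VG : VN G.

Let hy0 j : (j < N)%N -> 0 < hy j.
Proof. exact: hy_gt0. Qed.

(** The ramps are 1 below row [l] and 0 above it. *)
Lemma reweight_row x y l : 0 <= x <= 1 -> (l < N)%N -> Y l <= y <= Y l.+1 ->
  reweight W G (x, y) = W l * G (x, Y l) +
    (W l.+1 * G (x, Y l.+1) - W l * G (x, Y l)) * ((y - Y l) / hy l).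
Proof.
move=> x01 lN /andP[ly_ yl].
have h0 := hy0 lN.
pose f j := W j * G (x, Y j).
have f0 : f 0%N = 0.
  rewrite /f; case: VG => _ -> ; first by rewrite mulr0.
  have -> : Y 0%N = 0 by exact: node_y0.
  by split; [split => /=; rewrite ?in_itv/=; lra|case => /=; rewrite ?in_itv/=; lra].
transitivity (\sum_(j < N) ((if (j < l)%N then f j.+1 - f j else 0) +
    (if j == l :> nat then (f j.+1 - f j) * ((y - Y l) / hy l) else 0))).
  apply: eq_bigr => j _; rewrite /= -/(f j) -/(f j.+1) /ramp.
  have jN := ltn_ord j; have hj := hy0 jN.
  have incr := node_y_incr N0 N6 ly0 ly1.
  have [jl|jl|jl] := ltngtP j l.
  - rewrite addr0 clamp_ge1 ?mulr1// ler_pdivlMr// mul1r /width_y -/Y.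
    have : Y j.+1 <= Y l by apply: incr; rewrite jl ltnW.
    by lra.
  - rewrite addr0 clamp_le0 ?mulr0// pmulr_lle0 ?invr_gt0//.
    have : Y l.+1 <= Y j by apply: incr; rewrite jl ltnW.
    by lra.
  - rewrite add0r jl clamp_id//; apply/andP; split.
      by apply: divr_ge0; [rewrite subr_ge0|exact: ltW].
    by rewrite ler_pdivrMr// mul1r /width_y -/Y; lra.
rewrite big_split/= -[X in X + _]big_mkcond -[X in _ + X]big_mkcond/=.
rewrite -(big_ord_widen N (fun j => f j.+1 - f j) (ltnW lN)) (big_pred1 (Ordinal lN))//=.
by rewrite telescope_ord f0 subr0.
Qed.

Lemma reweight_cell i l : (i < N)%N -> (l < N)%N ->
  forall p, (`[X i, X i.+1] `*` `[Y l, Y l.+1]) p ->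
  reweight W G p = bil (X i) (X i.+1) (Y l) (Y l.+1)
    (qrows (W l) (W l.+1) (nodal (nodes lx ly N G) i l)) p.
Proof.
move=> iN lN [x y] [/= xi yl].
have xi' := xi; have yl' := yl; move: xi' yl'; rewrite ?in_itv/= => xi' yl'.
have hx0 := hx_gt0 N0 N6 lx0 lx1 iN; have h0 := hy0 lN.
have /andP[X1 X2] := node_x_in N0 N6 lx0 lx1 (ltnW iN).
have /andP[X3 X4] := node_x_in N0 N6 lx0 lx1 iN.
rewrite (reweight_row _ lN yl'); last by rewrite /X in xi' *; lra.
have C1 := fe_closed_cell N0 N6 lx0 lx1 ly0 ly1 VG iN lN.
rewrite (C1 (x, Y l)) ?(C1 (x, Y l.+1)); last first.
- by split => //=; rewrite ?in_itv/= lexx -subr_ge0 ltW.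
- by split => //=; rewrite ?in_itv/= lexx andbT -subr_ge0 ltW.
rewrite /bil/= -/X -/Y /qrows /= /width_y -/Y.
have : Y l.+1 - Y l != 0 by exact: lt0r_neq0.
have : X i.+1 - X i != 0 by exact: lt0r_neq0.
move: (nodes lx ly N G i l) (nodes lx ly N G i.+1 l).
move: (nodes lx ly N G i l.+1) (nodes lx ly N G i.+1 l.+1).
move: (Y l.+1) (Y l) (X i.+1) (X i) (W l) (W l.+1) => y1 y0 x1 x0 w0 w1 r s p q e1 e2.
by field; rewrite e1 e2.
Qed.

Lemma nodes_reweight i j : (i <= N)%N -> (j <= N)%N ->
  nodes lx ly N (reweight W G) i j = W j * nodes lx ly N G i j.
Proof.
move=> iN jN; rewrite /nodes -/X -/Y.
have xi := node_x_in N0 N6 lx0 lx1 iN.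
have [jN'|jN'] := ltnP j N.
  have h0 := hy0 jN'.
  rewrite (reweight_row xi jN'); last by rewrite lexx -subr_ge0 ltW.
  by rewrite subrr mul0r mulr0 addr0.
have {jN jN'} -> : j = N by apply/eqP; rewrite eqn_leq jN.
have N1 : (N.-1 < N)%N by rewrite prednK.
have h0 := hy0 N1.
have := @reweight_row (X i) (Y N) N.-1 xi N1; rewrite prednK// => ->; last first.
  by rewrite lexx andbT -subr_ge0; move: h0; rewrite /width_y prednK// => /ltW.
move: h0; rewrite /width_y prednK// -/Y => h0.
by rewrite divff ?lt0r_neq0//; ring.
Qed.

(** [G] is continuous on the closed square only, hence the detour through
    [q |-> (q.1, Y l)], which maps the square to itself. *)
Lemma reweight_continuous : {within Omega_bar, continuous (reweight W G)}.
Proof.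
have [cG _ _] := VG.
apply/subspace_continuousP => p Op.
apply: cvg_sum_seq => j; apply: cvgM; last first.
  apply: cvg_within_filter.
  apply: (@continuous_comp _ _ _ (fun p : R * R => p.2) (ramp j)).
    exact: cvg_snd.
  rewrite /ramp; apply: (@continuous_comp _ _ _ (fun y : R => (y - Y j) / hy j) clamp).
    apply: continuousM; last exact: cst_continuous.
    by apply: continuousB; [exact: cvg_id|exact: cst_continuous].
  exact: continuous_clamp.
have H l : (l <= N)%N -> G (q.1, Y l) @[q --> within Omega_bar (nbhs p)] --> G (p.1, Y l).
  move=> lN; have yl := node_y_in N0 N6 ly0 ly1 lN.
  have Oq q : Omega_bar q -> Omega_bar (q.1, Y l).
    by case=> /= h _; split => //=; rewrite ?in_itv.
  move/subspace_continuousP : cG => /(_ (p.1, Y l) (Oq _ Op)) cGp.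
  have cphi : (q.1, Y l) @[q --> p] --> (p.1, Y l).
    apply: (@cvg_pair _ _ _ (nbhs p) (nbhs p.1) (nbhs (Y l)) _ _ _ fst (fun=> Y l)).
      by case: (p) => x y; exact: cvg_fst.
    exact: cvg_cst.
  apply: (@cvg_comp _ _ _ (fun q : R * R => (q.1, Y l)) G _
    (within Omega_bar (nbhs (p.1, Y l))) _ _ cGp) => A nA.
  have nA' : nbhs (p.1, Y l) (fun z => Omega_bar z -> A z) := nA.
  suff : nbhs p (fun q => Omega_bar q -> A (q.1, Y l)) by [].
  have := cphi _ nA'; apply: (@filterS _ (nbhs p) (nbhs_filter p)) => q h /Oq.
  exact: h.
by apply: cvgB; apply: cvgMr; apply: H; [exact: ltn_ord|exact/ltnW/ltn_ord].
Qed.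

Lemma reweight_fe : VN (reweight W G).
Proof.
have [_ G0 _] := VG.
split; first exact: reweight_continuous.
- move=> [x y] [[/= + +] nO]; rewrite ?in_itv/= => x01 y01.
  have [xb|xi] := boolP ((x == 0) || (x == 1)).
    rewrite /reweight big1// => j _ /=.
    have G0' l : (l <= N)%N -> G (x, Y l) = 0.
      move=> lN; have yl := node_y_in N0 N6 ly0 ly1 lN.
      apply: G0; split; first by split => /=; rewrite ?in_itv.
      by case => /=; rewrite ?in_itv/=; case/orP: xb => /eqP ->; lra.
    by rewrite (G0' _ (ltn_ord j)) (G0' _ (ltnW (ltn_ord j))) !mulr0 subrr mul0r.
  move: xi; rewrite negb_or => /andP[x0 x1].
  have [y0|y1] : y = 0 \/ y = 1.
    have [y0|y0] := eqVneq y 0; [by left|right].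
    apply/eqP; apply: contrapT => /negP y1; apply: nO; split => /=; rewrite ?in_itv/=; lra.
  - have := @reweight_row x y 0%N x01 N0; rewrite y0.
    have -> : Y 0%N = 0 by exact: node_y0.
    rewrite subrr mul0r mulr0 addr0 => ->.
      rewrite G0 ?mulr0//; split; first by split => /=; rewrite ?in_itv//=; lra.
      by case => /=; rewrite ?in_itv/=; lra.
    by rewrite lexx/= -(node_y0 ly N) -subr_ge0; exact/ltW/hy0.
  - have N1 : (N.-1 < N)%N by rewrite prednK.
    have h0 := hy0 N1; have YN : Y N = 1 by exact: node_yN.
    have := @reweight_row x y N.-1 x01 N1; rewrite prednK// y1 YN => ->; last first.
      by rewrite lexx andbT -YN -subr_ge0; move: h0; rewrite /width_y prednK// => /ltW.
    move: h0; rewrite /width_y prednK// -/Y YN => h0.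
    rewrite divff ?lt0r_neq0// (_ : G (x, 1) = 0); first by ring.
    apply: G0; split; first by split => /=; rewrite ?in_itv//=; lra.
    by case => /=; rewrite ?in_itv/=; lra.
- move=> tau [[|i] [[|l] [/andP[i0 iN] /andP[l0 lN] ->]]] //.
  have Xi : X i < X i.+1 by rewrite -subr_gt0; exact: hx_gt0.
  have Yl : Y l < Y l.+1 by rewrite -subr_gt0; exact: hy0.
  have [a0 [a1 [a2 [a3 H]]]] := bil_bilinear
    (qrows (W l) (W l.+1) (nodal (nodes lx ly N G) i l)) setT Xi Yl.
  by exists a0, a1, a2, a3 => p /(reweight_cell iN lN) ->; exact: H.
Qed.
End testfun.

(** * Decay of the Green function in y *)
Section green.
Context {R : realType}.
Variables (lx ly : R) (N : nat).
Hypotheses (N0 : (0 < N)%N) (N6 : (6 %| N)%N) (lx0 : 0 < lx) (lx1 : lx <= 1 / 2)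
  (ly0 : 0 < ly) (ly1 : ly <= 1 / 4).
Let X := node_x lx N.
Let Y := node_y ly N.
Let n := (N %/ 2)%N.
Local Notation VN := (fe_space lx ly N).
Local Notation hx := (width_x lx N).
Local Notation hy := (width_y ly N).

Definition decay (sigma ys : R) (j : nat) : R := expR (`|Y j - ys| / sigma).

(** The weight changes by a small relative amount across a cell. This form,
    symmetric in the two nodes, is the hypothesis of [weighted_energy_le]. *)
Lemma decay_slope sigma ys j : 0 < sigma -> (j < N)%N ->
  `|decay sigma ys j.+1 - decay sigma ys j| <=
  hy j / sigma * (decay sigma ys j + decay sigma ys j.+1).
Proof.
move=> s0 jN; rewrite /decay.
set A := `|Y j.+1 - ys|; set B := `|Y j - ys|.
have H : `|A / sigma - B / sigma| <= hy j / sigma.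
  rewrite -mulrBl normrM (@ger0_norm _ sigma^-1) ?invr_ge0 ?(ltW s0)//.
  rewrite ler_wpM2r ?invr_ge0 ?(ltW s0)//; apply: le_trans (ler_dist_dist _ _) _.
  rewrite opprB addrA subrK ger0_norm//.
  exact/ltW/(hy_gt0 N0 N6 ly0 ly1 jN).
apply: le_trans (expR_diff_le _ _) _.
have := ler_wpM2r (addr_ge0 (expR_ge0 (A / sigma)) (expR_ge0 (B / sigma))) H.
lra.
Qed.

Variables (eps b c Cs : R).
Hypotheses (eps0 : 0 < eps) (b0 : 0 < b) (c0 : 0 < c) (Cs0 : 0 < Cs)
  (Csc : Cs / N%:R * c <= 1).

Definition fe_energy G i j := Ecell eps b c (stab (Cs / N%:R) n i) (hx i) (hy j)
  (nodal (nodes lx ly N G) i j).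

(** Testing with the reweighted [G] and with [G] gives the same value because the
    weight is 1 at the node [(X i0, Y j0)]. A weight depending on [y] alone is
    enough: the convection term stays exactly telescoping along rows. *)
Lemma green_weighted_energy sigma i0 j0 G :
  0 < sigma -> (i0 <= N)%N -> (j0 <= N)%N ->
  (forall j, (j < N)%N -> 56 * hy j <= sigma) ->
  256 * eps <= c * sigma ^+ 2 ->
  (forall j, (j < N)%N -> 192 * (hy j / sigma) ^+ 2 <= c * (Cs / N%:R)) ->
  (forall j, (j < N)%N -> 48 * b * (hy j / sigma) * lx <= eps) ->
  is_green eps b c (delta Cs lx ly N) VN (X i0, Y j0) G ->
  sumcells N hx hy (fun i j =>
    (decay sigma (Y j0) j + decay sigma (Y j0) j.+1) / 2 * fe_energy G i j) <=
  6 * sumcells N hx hy (fe_energy G).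
Proof.
move=> s0 iN jN ks es kd kl [VG GB].
set W := decay sigma (Y j0).
have [g0 gN] := nodes_boundary N0 N6 lx0 lx1 ly0 ly1 VG.
have nN : (n <= N)%N by exact: half_le.
have Vv := reweight_fe N0 N6 lx0 lx1 ly0 ly1 W VG.
have N0R : 0 < N%:R :> R by rewrite ltr0n.
have d0 : 0 <= Cs / N%:R by rewrite divr_ge0 ?ltW.
have nR0 : n%:R != 0 :> R.
  by move: N0R; rewrite (natr_half N6) pmulr_rgt0// => /lt0r_neq0.
have key := bform_cells N0 N6 lx0 lx1 ly0 ly1 eps b c Cs.
have BW : bform eps b c (delta Cs lx ly N) (reweight ly N W G) G =
    bform eps b c (delta Cs lx ly N) G G.
  rewrite !GB// -[LHS]/(nodes lx ly N (reweight ly N W G) i0 j0).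
  rewrite (nodes_reweight N0 N6 lx0 lx1 ly0 ly1 W VG iN jN).
  by rewrite /W /decay subrr normr0 mul0r expR0 mul1r.
have lxE i : (n <= i < N)%N -> (N - n)%:R * hx i = lx.
  move=> ni; rewrite (hx_fine _ N0 N6 ni) natrB// {1}(natr_half N6) -/n.
  by rewrite (natr_half N6) -/n; field; exact: nR0.
have hxg i : (i < N)%N -> 0 < hx i by exact: hx_gt0.
have hyg j : (j < N)%N -> 0 < hy j by exact: hy_gt0.
have W0 j : 0 < W j by exact: expR_gt0.
have WS j : (j < N)%N -> `|W j.+1 - W j| <= hy j / sigma * (W j + W j.+1).
  by move=> jN'; exact: decay_slope.
rewrite /fe_energy -/W.
apply: (weighted_energy_le eps0 b0 c0 d0 Csc hxg hyg g0 gN lxE s0 W0 WS ks es kd kl).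
have e1 := key _ _ Vv VG; have e2 := key _ _ VG VG.
rewrite BW e2 in e1; apply: (etrans _ (esym e1)).
apply: eq_sumcells => i j iN' jN'.
congr (Bcell _ _ _ _ _ _ _ _).
have nr := nodes_reweight N0 N6 lx0 lx1 ly0 ly1 W VG.
by rewrite /nodal/= !nr// ltnW.
Qed.
End green.

(** * Integrals against the x-derivative of a finite element function *)
Section cell_integrals.
Context {R : realType}.
Local Notation mu := (@lebesgue_measure R).

Lemma has_integral_le d (T : measurableType d) (m : {measure set T -> \bar R})
    (D : set T) (F H : T -> R) (u v : R) : measurable D ->
  (forall x, D x -> `|F x| <= H x) ->
  has_integral m D F u -> has_integral m D H v -> `|u| <= v.
Proof.
move=> mD FH [iF <-] [iH <-].
apply: le_trans (le_normr_Rintegral mD iF) _.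
apply: le_Rintegral => //.
exact: integrable_norm iF.
Qed.

Lemma has_integral_layer (a b c d beta eps : R) : a < b -> c < d ->
  0 < beta -> 0 < eps ->
  has_integral plane (orect a b c d) (fun z => layer_x beta eps z)
   (eps / beta * (expR (- (beta * (1 - b) / eps)) - expR (- (beta * (1 - a) / eps)))
    * (d - c)).
Proof.
move=> ab cd be0 e0.
pose f (x : R) := expR (- (beta * (1 - x) / eps)).
have d1 (x : R) : is_derive x 1 (fun x : R => - (beta * (1 - x) / eps)) (beta / eps).
  have := @is_derive_affine R (- (beta / eps)) (beta / eps) x.
  by congr (is_derive _ _ _ _); apply/funext => t; field; exact: lt0r_neq0.
have d2 (x : R) : is_derive x 1 f (f x * (beta / eps)).
  exact: (is_derive1_comp (is_derive_expR _) (d1 x)).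
have df (x : R) : is_derive x 1 (fun x => eps / beta * f x) (f x).
  have := is_deriveZ (eps / beta) (d2 x); congr (is_derive _ _ _ _).
  by rewrite /GRing.scale/=; field; rewrite !lt0r_neq0.
have cf : continuous f.
  by move=> x; have [/derivable1_diffP dd _] := d2 x; exact: differentiable_continuous dd.
have fb x : a < x < b -> `|f x| <= f b.
  move=> /andP[_ xb]; rewrite ger0_norm ?expR_ge0// ler_expR.
  rewrite lerN2 ler_wpM2r ?invr_ge0 ?(ltW e0)// ler_wpM2l ?(ltW be0)//; lra.
pose g (_ : R) : R := 1.
have g1 (y : R) : c < y < d -> `|g y| <= 1 by rewrite normr1.
have cg : continuous g by move=> y; exact: cst_continuous.
split.
  apply: (@integrable_orect _ _ _ _ _ _ (f b)).
    apply: measurable_funTS.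
    by apply: (measurableT_comp (continuous_measurable_fun cf)).
  by move=> [x y] [/= + _]; rewrite in_itv/= => /fb.
rewrite -[LHS](_ : Rintegral plane (orect a b c d) (fun z => f z.1 * 1) = _); last first.
  by apply: eq_Rintegral => z _; rewrite mulr1.
rewrite (Rintegral_orectM cf cg fb g1) (Rintegral_oo_FTC2 ab cf df) -mulrBr; congr (_ * _).
rewrite (Rintegral_oo_FTC2 (F := id) cd cg)// => y; exact: is_derive_id.
Qed.

End cell_integrals.

Lemma bil_one (R : realType) (a b c d : R) z : bil a b c d (1, 1, 1, 1) z = 1.
Proof. by rewrite /bil; ring. Qed.

Section cellint.
Context {R : realType}.
Variables (lx ly : R) (N : nat).
Hypotheses (N0 : (0 < N)%N) (N6 : (6 %| N)%N) (lx0 : 0 < lx) (lx1 : lx <= 1 / 2)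
  (ly0 : 0 < ly) (ly1 : ly <= 1 / 4).
Local Notation X := (node_x lx N).
Local Notation Y := (node_y ly N).
Local Notation hx := (width_x lx N).
Local Notation hy := (width_y ly N).
Variable G : R * R -> R.
Hypothesis VG : fe_space lx ly N G.
Local Notation g := (nodes lx ly N G).

(** [layer_x] on the mesh line [x = X l]. *)
Definition xlayer (beta eps : R) (l : nat) : R :=
  expR (- (beta * (1 - X l) / eps)).

Definition cellint (F : R * R -> R) i j :=
  Rintegral plane (cell X Y i j) (fun p => F p * dx G p).

Variables (i j : nat).
Hypotheses (iN : (i < N)%N) (jN : (j < N)%N).

Let hx0 : 0 < hx i. Proof. exact: hx_gt0. Qed.
Let hy0 : 0 < hy j. Proof. exact: hy_gt0. Qed.
Let xlt : X i < X i.+1. Proof. by rewrite -subr_gt0. Qed.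
Let ylt : Y j < Y j.+1. Proof. by rewrite -subr_gt0. Qed.

Let slope := qdx (hx i) (nodal g i j).

Let dxE p : cell X Y i j p -> dx G p = bil (X i) (X i.+1) (Y j) (Y j.+1) slope p.
Proof.
move=> cp.
exact: (dx_cellwise (fe_cellwise N0 N6 lx0 lx1 ly0 ly1 VG) iN jN cp).
Qed.

(** The x-derivative interpolates linearly in [y] between the slopes on the lower
    and upper edges. *)
Lemma slope_le p : cell X Y i j p -> `|dx G p| <= xvar g i j / hx i.
Proof.
move=> cp; rewrite dxE//; case: p cp => [x y] [/= _]; rewrite in_itv/= => /andP[y1 y2].
rewrite /slope /bil/=; set t := (y - _) / _.
have t0 : 0 <= t by apply: divr_ge0; [lra|exact: ltW].
have t1 : t <= 1 by rewrite /t ler_pdivrMr//; lra.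
set s := (x - _) / _.
set a := g i.+1 j - _; set d := g i.+1 j.+1 - _.
rewrite (_ : a / hx i * _ * _ + _ + _ + _ = (1 - t) * (a / hx i) + t * (d / hx i)); last first.
  by ring.
clearbody t.
apply: le_trans (ler_normD _ _) _.
have ih : 0 <= (hx i)^-1 by rewrite invr_ge0 ltW.
rewrite !normrM (ger0_norm t0) (ger0_norm ih) (@ger0_norm _ (1 - t)) ?subr_ge0//.
rewrite /xvar -/a -/d [leRHS]mulrDl; apply: lerD; rewrite ler_piMl// ?mulr_ge0//; lra.
Qed.

Section bounded.
Variables (F : R * R -> R) (M : R).
Hypotheses (cF : forall p, Omega p -> {for p, continuous F})
  (bF : forall p, cell X Y i j p -> `|F p| <= M).

Lemma has_cellint : has_integral plane (cell X Y i j) (fun p => F p * dx G p) (cellint F i j).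
Proof.
split => //.
have [iB' _] := has_integral_bilM slope (1, 1, 1, 1) xlt ylt.
apply: (@integrable_orect _ _ _ _ _ _ (M * (xvar g i j / hx i))); last first.
  by move=> p cp; rewrite normrM ler_pM// ?bF ?slope_le.
apply: measurable_funM.
  apply: open_continuous_measurable_fun2; first exact: open_orect.
  by move=> p /(cell_Omega N0 N6 lx0 lx1 ly0 ly1 iN jN)/cF.
move/integrableP : iB' => [/measurable_EFinP mB _].
apply: eq_measurable_fun mB => p /set_mem cp.
by rewrite bil_one mulr1 dxE.
Qed.
End bounded.

Lemma cellint_near F (phi M : R) : (forall p, Omega p -> {for p, continuous F}) ->
  (forall p, cell X Y i j p -> `|F p - phi| <= M) ->
  `|cellint F i j - phi * (hy j * ((g i.+1 j - g i j) + (g i.+1 j.+1 - g i j.+1)) / 2)|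
   <= M * (hy j * xvar g i j).
Proof.
move=> cF bF.
have mc : @measurable _ (measurableTypeR R * measurableTypeR R)%type (cell X Y i j).
  exact: measurable_orect.
have hF := has_cellint cF (M := M + `|phi|) _.
have {hF} hF : has_integral plane (cell X Y i j) (fun p => F p * dx G p) (cellint F i j).
  apply: hF => p cp; rewrite -[F p](subrK phi).
  by apply: le_trans (ler_normD _ _) _; rewrite lerD2r bF.
have hB := has_integralZ (- phi) mc (has_integral_bilM slope (1, 1, 1, 1) xlt ylt).
have hD := has_integralD mc hF hB.
have h1 := has_integralZ (M * (xvar g i j / hx i)) mc
  (has_integral_monomial 0 0 xlt ylt).
have := has_integral_le mc _ hD h1.
have -> : (X i.+1 - X i) * (Y j.+1 - Y j) * mass slope (1, 1, 1, 1) =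
  hy j * ((g i.+1 j - g i j) + (g i.+1 j.+1 - g i j.+1)) / 2.
  rewrite /slope /mass/= /width_x/= /width_x /width_y; field.
  exact: lt0r_neq0.
rewrite mulNr => H; apply: le_trans (H _) _.
  move=> p cp; rewrite !expr0 mulr1 mulr1.
  rewrite (_ : _ + _ = (F p - phi) * dx G p); last first.
    by rewrite dxE// bil_one; ring.
  by rewrite normrM ler_pM ?bF ?slope_le.
rewrite le_eqVlt; apply/orP; left; apply/eqP; rewrite /width_x /width_y; field.
exact: lt0r_neq0.
Qed.

Lemma cellint_le F (M : R) : (forall p, Omega p -> {for p, continuous F}) ->
  (forall p, cell X Y i j p -> `|F p| <= M) ->
  `|cellint F i j| <= M * (hy j * xvar g i j).
Proof.
move=> cF bF; have := @cellint_near F 0 M cF.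
by rewrite mul0r subr0; apply => p cp; rewrite subr0 bF.
Qed.

(** The integral of the exponential over the cell is a difference of nodal values,
    so that these bounds telescope along a row, as [telescoping_sum_le] expects. *)
Lemma cellint_layer F (M beta eps : R) : 0 < beta -> 0 < eps -> 0 <= M ->
  (forall p, Omega p -> {for p, continuous F}) ->
  (forall p, cell X Y i j p -> `|F p| <= M / eps * layer_x beta eps p) ->
  `|cellint F i j| <= M / beta * (xlayer beta eps i.+1 - xlayer beta eps i) / hx i
    * (hy j * xvar g i j).
Proof.
move=> be0 e0 M0 cF bF.
have mc : @measurable _ (measurableTypeR R * measurableTypeR R)%type (cell X Y i j).
  exact: measurable_orect.
have ME : 0 <= M / eps by rewrite divr_ge0// ltW.
have hF : has_integral plane (cell X Y i j) (fun p => F p * dx G p) (cellint F i j).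
  apply: (has_cellint cF (M := M / eps)) => p cp; apply: le_trans (bF p cp) _.
  rewrite ler_piMr// -expR0 ler_expR oppr_le0 divr_ge0 ?(ltW e0)//.
  rewrite mulr_ge0 ?(ltW be0)//.
  have [/= + _] := cell_Omega N0 N6 lx0 lx1 ly0 ly1 iN jN cp.
  by rewrite in_itv/=; lra.
have hL := has_integralZ (M / eps * (xvar g i j / hx i)) mc
  (has_integral_layer xlt ylt be0 e0).
have := has_integral_le mc _ hF hL => H; apply: le_trans (H _) _.
  move=> p cp; rewrite normrM mulrAC ler_pM// ?bF ?slope_le//.
rewrite le_eqVlt; apply/orP; left; apply/eqP; rewrite /xlayer /width_x /width_y; field.
by rewrite !lt0r_neq0.
Qed.
End cellint.

(** * Laplacians and their Lipschitz bounds *)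
Section regularity.
Context {R : realType}.
Implicit Types (u v L : R * R -> R).

(** [laplacian] is a value of a total derivation operator and does not say that the
    derivatives exist, so it is not additive as it stands; this relation is. *)
Definition has_laplacian u L := exists Dx Dy Dxx Dyy : R * R -> R,
  forall p, Omega p ->
  [/\ is_derive p.1 1 (fun t : R => u (t, p.2)) (Dx p),
      is_derive p.2 1 (fun t : R => u (p.1, t)) (Dy p),
      is_derive p.1 1 (fun t : R => Dx (t, p.2)) (Dxx p),
      is_derive p.2 1 (fun t : R => Dy (p.1, t)) (Dyy p) &
      L p = Dxx p + Dyy p].

Lemma laplacianE u L : has_laplacian u L -> forall p, Omega p -> laplacian u p = L p.
Proof.
move=> [Dx [Dy [Dxx [Dyy H]]]] [x y] Op.
have [_ _ hxx hyy ->] := H _ Op.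
have [/= x01 y01] := Op; move: (x01) (y01); rewrite !in_itv/= => x01' y01'.
rewrite /laplacian; congr (_ + _).
- apply: (@derive1_near_eq _ _ (fun t => Dx (t, y)) 0 1) => // t t01.
  have [+ _ _ _ _] := H (t, y) (conj (t01 : (t, y).1 \in `]0, 1[) y01).
  by move=> [_ <-]; rewrite /dx derive1E.
- apply: (@derive1_near_eq _ _ (fun t => Dy (x, t)) 0 1) => // t t01.
  have [_ + _ _ _] := H (x, t) (conj x01 (t01 : (x, t).2 \in `]0, 1[)).
  by move=> [_ <-]; rewrite /dy derive1E.
Qed.

Lemma has_laplacianD u v L1 L2 : has_laplacian u L1 -> has_laplacian v L2 ->
  has_laplacian (fun p => u p + v p) (fun p => L1 p + L2 p).
Proof.
move=> [Dx [Dy [Dxx [Dyy H]]]] [Dx' [Dy' [Dxx' [Dyy' H']]]].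
exists (fun p => Dx p + Dx' p), (fun p => Dy p + Dy' p),
  (fun p => Dxx p + Dxx' p), (fun p => Dyy p + Dyy' p) => p Op.
have [a1 a2 a3 a4 a5] := H _ Op; have [b1 b2 b3 b4 b5] := H' _ Op.
split; [exact: is_deriveD a1 b1|exact: is_deriveD a2 b2|exact: is_deriveD a3 b3|
  exact: is_deriveD a4 b4|by rewrite a5 b5; ring].
Qed.

Lemma has_laplacian_eq u v L : (forall p, Omega p -> u p = v p) ->
  has_laplacian u L -> has_laplacian v L.
Proof.
move=> uv [Dx [Dy [Dxx [Dyy H]]]]; exists Dx, Dy, Dxx, Dyy => -[x y] Op.
have [a1 a2 a3 a4 a5] := H _ Op; split => //.
- apply: near_eq_is_derive a1.
  have : \forall t \near x, t \in `]0, 1[ by apply: near_in_itvoo; case: Op.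
  by apply: filterS => t t01; apply: uv; case: Op.
- apply: near_eq_is_derive a2.
  have : \forall t \near y, t \in `]0, 1[ by apply: near_in_itvoo; case: Op.
  by apply: filterS => t t01; apply: uv; case: Op.
Qed.

Lemma lipschitz_of_derive (f df : R -> R) (M x x' : R) :
  0 < x < 1 -> 0 < x' < 1 ->
  (forall t : R, 0 < t < 1 -> is_derive t 1 f (df t)) ->
  (forall t : R, 0 < t < 1 -> `|df t| <= M) ->
  `|f x' - f x| <= M * `|x' - x|.
Proof.
move=> + + fd dM; wlog xx : x x' / x <= x'.
  move=> H x01 x01'; have [/H|/ltW/H h] := leP x x'; first exact.
  by rewrite distrC (distrC x'); exact: h.
move=> x01 x01'; have [->|/eqP xne] := eqVneq x x'; first by rewrite !subrr normr0 mulr0.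
have xlt : x < x' by rewrite lt_neqAle xx andbT; apply/eqP.
have [||c] := @MVT R f df x x' xlt.
- by move=> t; rewrite in_itv/= => t01; apply: fd; lra.
- apply: derivable_within_continuous => t; rewrite in_itv/= => t01.
  by have [|//] := fd t; lra.
rewrite in_itv/= => c01 ->; rewrite normrM ler_wpM2r//.
by apply: dM; lra.
Qed.

Lemma Omega_open : open (@Omega R).
Proof. exact: (@open_orect R 0 1 0 1). Qed.

Lemma OmegaW p : @Omega R p -> Omega_bar p.
Proof.
by case: p => x y [/=]; rewrite !in_itv/= => /andP[a b] /andP[c d];
  split; rewrite /= in_itv/= !ltW.
Qed.

(** Third derivatives give Lipschitz bounds of the Laplacian in each variable. The
    supremum [M] of the bound is taken along one horizontal or vertical line. *)
Lemma laplacian_bounds u w : has_bounds u w -> exists L,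
  [/\ has_laplacian u L,
      forall p, Omega p -> {for p, continuous L},
      forall p, Omega p -> `|L p| <= w 2 0%N p + w 0%N 2 p,
      forall M y x x' : R, 0 < y < 1 -> 0 < x < 1 -> 0 < x' < 1 ->
        (forall t : R, 0 < t < 1 -> w 3 0%N (t, y) + w 1%N 2 (t, y) <= M) ->
        `|L (x', y) - L (x, y)| <= M * `|x' - x| &
      forall M x y y' : R, 0 < x < 1 -> 0 < y < 1 -> 0 < y' < 1 ->
        (forall t : R, 0 < t < 1 -> w 2 1%N (x, t) + w 0%N 3 (x, t) <= M) ->
        `|L (x, y') - L (x, y)| <= M * `|y' - y|].
Proof.
move=> [D [D0 Dc Dd] Dw].
exists (fun p => D 2 0%N p + D 0%N 2 p).
have Oxy (x y : R) : 0 < x < 1 -> 0 < y < 1 -> Omega (x, y).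
  by move=> h1 h2; split; rewrite /= in_itv.
split.
- apply: (@has_laplacian_eq (D 0%N 0%N)); first by move=> p /OmegaW/D0.
  exists (D 1%N 0%N), (D 0%N 1%N), (D 2 0%N), (D 0%N 2) => p Op.
  have [h1 h2] := Dd 0%N 0%N p isT Op.
  have [h3 _] := Dd 1%N 0%N p isT Op.
  by have [_ h4] := Dd 0%N 1%N p isT Op.
- move=> p Op.
  have cD i j : (i + j <= 3)%N -> {for p, continuous (D i j)}.
    move=> ij; have cij : {within Omega, continuous (D i j)}.
      by apply: continuous_subspaceW (Dc i j ij) => q /OmegaW.
    by move: cij; rewrite continuous_open_subspace; [apply; rewrite inE|exact: Omega_open].
  by apply: continuousD; exact: cD.
- move=> p Op; apply: le_trans (ler_normD _ _) _.
  by apply: lerD; apply: Dw => //; exact: OmegaW.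
- move=> M y x x' y01 x01 x01' wM.
  apply: (@lipschitz_of_derive (fun t => D 2 0%N (t, y) + D 0%N 2 (t, y))
    (fun t => D 3 0%N (t, y) + D 1%N 2 (t, y))) => // t t01.
    have [h1 _] := Dd 2 0%N _ isT (Oxy _ _ t01 y01).
    have [h2 _] := Dd 0%N 2 _ isT (Oxy _ _ t01 y01).
    exact: is_deriveD h1 h2.
  apply: le_trans (ler_normD _ _) _; apply: le_trans (wM _ t01).
  by apply: lerD; apply: Dw => //; apply/OmegaW/Oxy.
- move=> M x y y' x01 y01 y01' wM.
  apply: (@lipschitz_of_derive (fun t => D 2 0%N (x, t) + D 0%N 2 (x, t))
    (fun t => D 2 1%N (x, t) + D 0%N 3 (x, t))) => // t t01.
    have [_ h1] := Dd 2 0%N _ isT (Oxy _ _ x01 t01).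
    have [_ h2] := Dd 0%N 2 _ isT (Oxy _ _ x01 t01).
    exact: is_deriveD h1 h2.
  apply: le_trans (ler_normD _ _) _; apply: le_trans (wM _ t01).
  by apply: lerD; apply: Dw => //; apply/OmegaW/Oxy.
Qed.

Lemma layer_y_le (eps : R) p : Omega p -> 0 < eps -> 0 <= layer_y eps p <= 2.
Proof.
case: p => x y [/= _]; rewrite in_itv/= => /andP[y0 y1] e0.
rewrite /layer_y/= addr_ge0 ?expR_ge0//=.
have s0 : 0 < Num.sqrt eps by rewrite sqrtr_gt0.
have h t : 0 <= t -> expR (- (t / Num.sqrt eps)) <= 1.
  by move=> t0; rewrite -expR0 ler_expR oppr_le0 divr_ge0// ltW.
have := h y (ltW y0); have := h (1 - y); rewrite subr_ge0 => /(_ (ltW y1)); lra.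
Qed.

Lemma powR_half_integers (eps : R) : 0 < eps ->
  [/\ eps `^ (- 0%:R) = 1, eps `^ (- 1%:R) = eps^-1, eps `^ (- 2%:R) = eps^-1 ^+ 2,
   eps `^ (- 3%:R) = eps^-1 ^+ 3 & eps `^ (- (1%:R / 2)) = (Num.sqrt eps)^-1].
Proof.
move=> e0; have e1 := ltW e0.
split.
- by rewrite oppr0 powRr0.
- exact: powR_inv1.
- by rewrite powRN powR_mulrn// exprVn.
- by rewrite powRN powR_mulrn// exprVn.
- by rewrite powRN mul1r powR12_sqrt.
Qed.
End regularity.

(** * Three bounds for the upstream integral *)
Section assembly.
Context {R : realType}.

Lemma norm_le_sqrt (A K E : R) : 0 <= K -> A ^+ 2 <= K ^+ 2 * E ->
  `|A| <= K * Num.sqrt E.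
Proof.
move=> K0 H; rewrite -sqrtr_sqr -[K]ger0_norm// -sqrtr_sqr -sqrtrM ?sqr_ge0//.
exact: ler_wsqrtr.
Qed.

Lemma dist_midpoint (a d x : R) : a < x < d -> `|x - (a + d) / 2| <= d - a.
Proof. by move=> /andP[h1 h2]; rewrite ler_norml; apply/andP; split; lra. Qed.

Lemma ln_le_sqrt (N : nat) : (0 < N)%N -> ln N%:R <= 2 * Num.sqrt N%:R :> R.
Proof.
move=> N0; have N0R : 0 < N%:R :> R by rewrite ltr0n.
have s0 : 0 < Num.sqrt N%:R :> R by rewrite sqrtr_gt0.
rewrite -[X in ln X](sqr_sqrtr (ltW N0R)) lnXn// mulr2n mulr_natl.
have := @le_ln1Dx R (Num.sqrt N%:R - 1).
have -> : 1 + (Num.sqrt N%:R - 1) = Num.sqrt N%:R :> R by ring.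
move=> h.
have : ln (Num.sqrt N%:R) <= Num.sqrt N%:R - 1 :> R by apply: h; lra.
by rewrite mulr2n; lra.
Qed.

(** [N >= 6 > 4 >= exp 1]. *)
Lemma ln_ge1 (N : nat) : (0 < N)%N -> (6 %| N)%N -> 1 <= ln N%:R :> R.
Proof.
move=> N0 N6; have N6' : (6 <= N)%N by exact: dvdn_leq.
have e2 : expR (1 / 2) <= 2 :> R.
  have := @expR_ge1Dx R (- (1 / 2)); rewrite expRN => h.
  have e0 := @expR_gt0 R (1 / 2).
  have := ler_wpM2r (ltW e0) h; rewrite mulVf ?lt0r_neq0//; lra.
rewrite -ler_expR lnK ?posrE ?ltr0n//.
have -> : (1 : R) = 1 / 2 + 1 / 2 by field.
rewrite expRD; apply: (@le_trans _ _ (2 * 2)); first by apply: ler_pM; rewrite ?expR_ge0.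
have : (6 : R) <= N%:R by rewrite ler_nat.
by lra.
Qed.

Variables (b c beta Cs eps lx ly : R) (N : nat).
Hypotheses (b0 : 0 < b) (c0 : 0 < c) (be0 : 0 < beta) (Cs0 : 0 < Cs)
  (eps0 : 0 < eps) (N0 : (0 < N)%N) (N6 : (6 %| N)%N).
Hypotheses (lx1 : lx <= 1 / 2) (ly1 : ly <= 1 / 4)
  (lxE : lx = 5 / 2 * eps / beta * ln N%:R)
  (lyE : ly = 5 / 2 * Num.sqrt eps * ln N%:R).
Local Notation X := (node_x lx N).
Local Notation Y := (node_y ly N).
Local Notation hx := (width_x lx N).
Local Notation hy := (width_y ly N).
Local Notation n := (N %/ 2)%N.
Local Notation d0 := (Cs / N%:R).
Variable G : R * R -> R.
Hypothesis VG : fe_space lx ly N G.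
Local Notation g := (nodes lx ly N G).
Local Notation EE := (energy eps b c d0 N n hx hy g).
Local Notation cint := (cellint lx ly N G).

Let ell1 : 1 <= ln N%:R :> R. Proof. exact: ln_ge1. Qed.
Let NR0 : 0 < N%:R :> R. Proof. by rewrite ltr0n. Qed.

Lemma lx_gt0 : 0 < lx.
Proof. by rewrite lxE mulr_gt0 ?(lt_le_trans _ ell1)// divr_gt0// mulr_gt0. Qed.
Lemma ly_gt0 : 0 < ly.
Proof. by rewrite lyE !mulr_gt0 ?(lt_le_trans _ ell1)// sqrtr_gt0. Qed.
Let lx0 := lx_gt0.
Let ly0 := ly_gt0.
Let dl0 : 0 < d0. Proof. exact: divr_gt0. Qed.
Let hxg i : (i < N)%N -> 0 < hx i. Proof. exact: hx_gt0. Qed.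
Let hyg j : (j < N)%N -> 0 < hy j. Proof. exact: hy_gt0. Qed.
Let nN : (n <= N)%N. Proof. exact: half_le. Qed.
Let g0 j : (j <= N)%N -> g 0%N j = 0.
Proof. by have [+ _] := nodes_boundary N0 N6 lx0 lx1 ly0 ly1 VG; apply. Qed.
Let gN j : (j <= N)%N -> g N j = 0.
Proof. by have [_ +] := nodes_boundary N0 N6 lx0 lx1 ly0 ly1 VG; apply. Qed.

Lemma sum_hx_coarse : \sum_(i < N | (i < n)%N) hx i <= 1.
Proof.
rewrite -(big_ord_widen N hx nN) /width_x telescope_ord.
rewrite (node_xn _ N0 N6) (node_x0 _ N); have := lx0; lra.
Qed.

Lemma sum_hx_fine : \sum_(i < N | (n <= i)%N) hx i <= lx.
Proof.
rewrite -(big_geq_mkord _ _ xpredT hx) /width_x telescope_sumr//.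
by rewrite (node_xn _ N0 N6) (node_xN _ N0 N6); lra.
Qed.

Lemma energy_le (J : pred nat) : EE J <= EE xpredT.
Proof.
rewrite /energy [leRHS](bigID (fun j : 'I_N => J j))/= lerDl.
apply: sumr_ge0 => j _; apply: sumr_ge0 => i _.
rewrite mulr_ge0 ?mulr_ge0 ?(ltW (hxg _)) ?(ltW (hyg _))//.
by apply: Ecell_ge0 => //; apply: stab_ge0; exact: ltW.
Qed.

Lemma sum_rows_le1 (J : pred nat) : \sum_(j < N | J j) hy j <= 1.
Proof.
rewrite -(sum_hy ly N0 N6) [leRHS](bigID (fun j : 'I_N => J j))/= lerDl.
by apply: sumr_ge0 => j _; exact/ltW/hyg.
Qed.

Section component.
Variables (F : R * R -> R).
Hypothesis (cF : forall p, Omega p -> {for p, continuous F}).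

(** The part of the inner product of [F] and [delta * b * dx G] that lies over the rows
    in [J]. *)
Definition upstream (J : pred nat) : R :=
  d0 * b * \sum_(j < N | J j) \sum_(i < N | (i < n)%N) cint F i j.

Lemma bound_crude (J : pred nat) (M : R) : 0 <= M ->
  (forall i j p, (i < n)%N -> (j < N)%N -> J j -> cell X Y i j p -> `|F p| <= M) ->
  `|upstream J| <= M * Num.sqrt (12 * d0) * Num.sqrt (EE J).
Proof.
move=> M0 FM; apply: norm_le_sqrt; first by rewrite mulr_ge0 ?sqrtr_ge0.
have H := upstream_sum_le eps0 b0 c0 dl0 hxg hyg sum_hx_coarse (g := g) (I := cint F)
  (sum_rows_le1 J) M0.
rewrite /upstream exprMn; apply: le_trans (ler_wpM2l (sqr_ge0 _) (H _)) _.
  move=> i j ni jN Jj; have iN : (i < N)%N by exact: leq_trans ni nN.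
  apply: cellint_le => // p cp; exact: (FM i j).
rewrite [in leRHS]exprMn sqr_sqrtr; last by apply: mulr_ge0 => //; exact: ltW.
rewrite le_eqVlt; apply/orP; left; apply/eqP; field.
by rewrite !lt0r_neq0.
Qed.

(** At the transition line the layer function is
    [exp (- (beta * lx / eps)) = N^(-rho)], by the choice of [lx]. *)
Lemma bound_layer (M : R) : 0 <= M ->
  (forall p, Omega p -> `|F p| <= M / eps * layer_x beta eps p) ->
  `|upstream xpredT| <=
    Num.sqrt (12 * Cs) * (M / beta) * N%:R `^ (- rho) * Num.sqrt (EE xpredT).
Proof.
move=> M0 FM; apply: norm_le_sqrt.
  by rewrite !mulr_ge0 ?sqrtr_ge0 ?powR_ge0// invr_ge0 ltW.
pose H := 2 * (1 - lx) / N%:R.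
have H0 : 0 < H by rewrite divr_gt0//; have := lx1; lra.
have HN : 1 <= H * N%:R by rewrite divfK ?lt0r_neq0//; have := lx1; lra.
have Mb : 0 <= M / beta by rewrite divr_ge0// ltW.
have hE i : (i < n)%N -> hx i = H by move=> ni; exact: hx_coarse.
have sy : \sum_(j < N) hy j <= 1 by rewrite (sum_hy ly N0 N6).
have exm i : (i < n)%N -> xlayer lx N beta eps i <= xlayer lx N beta eps i.+1.
  move=> ni; rewrite ler_expR lerN2 ler_wpM2r ?invr_ge0 ?(ltW eps0)//.
  rewrite ler_wpM2l ?(ltW be0)// lerD2l lerN2.
  by have := hxg (leq_trans ni nN); rewrite subr_gt0 => /ltW.
have exn : xlayer lx N beta eps n = N%:R `^ (- rho).
  rewrite /powR gt_eqF// /xlayer (node_xn _ N0 N6) lxE /rho; congr expR; field.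
  by rewrite !lt0r_neq0.
have S := telescoping_sum_le eps0 b0 c0 dl0 nN hxg hyg (I := cint F) (g := g)
  (ex := xlayer lx N beta eps) Mb H0 hE sy exm (expR_ge0 _).
rewrite /upstream exprMn; apply: le_trans (ler_wpM2l (sqr_ge0 _) (S _)) _.
  move=> i j ni jN; have iN : (i < N)%N by exact: leq_trans ni nN.
  rewrite -(hE _ ni); apply: cellint_layer => // p cp; apply: FM.
  exact: (cell_Omega N0 N6 lx0 lx1 ly0 ly1 iN jN).
have c120 : 0 <= 12 * Cs by rewrite mulr_ge0// ltW.
rewrite exn; set P := N%:R `^ _.
rewrite 2![in leRHS]exprMn sqr_sqrtr//.
have E0 : 0 <= EE xpredT by apply: energy_ge0 => //.
rewrite [leLHS](_ : _ = (12 * Cs * (M ^+ 2 * beta^-1 ^+ 2) * P ^+ 2 * EE xpredT)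
   * (H * N%:R)^-1); last first.
  by field; rewrite !lt0r_neq0.
rewrite [leRHS](_ : _ = 12 * Cs * (M ^+ 2 * beta^-1 ^+ 2) * P ^+ 2 * EE xpredT);
  last by rewrite !exprMn.
rewrite ler_piMr//; last by rewrite invf_le1// (lt_le_trans _ HN).
apply: mulr_ge0 => //; apply: mulr_ge0; last exact: sqr_ge0.
by apply: mulr_ge0 => //; apply: mulr_ge0; exact: sqr_ge0.
Qed.

(** The three summands of [abel_sum_le] with [del0 = Cs / N], freezing error
    [e = 17 / sqrt N] and [lx / eps = 5/2 * ln N / beta]. Here [3468 = 12 * 17^2],
    and [17 = 2 + 15] adds the oscillations over a cell in [x] and in [y]. *)
Definition abel_constant : R := 3468 / (b ^+ 2 * Cs) + 15 / 2 / beta + 18 / c.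
Local Notation K1 := abel_constant.

(** The bound on the oscillation in [y] is asked only for points in one row of
    cells. It must allow the side layer, whose Lipschitz constant is
    [O(eps^(-1/2))] on rows of height [3 * ly / N = 15/2 * sqrt eps * ln N / N],
    with [ln N <= 2 * sqrt N]. *)
Lemma bound_abel (J : pred nat) (M L : R) : 0 <= M ->
  \sum_(j < N | J j) hy j <= L ->
  (forall p, Omega p -> `|F p| <= M) ->
  (forall y x x' : R, 0 < y < 1 -> 0 < x < 1 -> 0 < x' < 1 ->
     `|F (x', y) - F (x, y)| <= M * `|x' - x|) ->
  (forall j, (j < N)%N -> J j -> forall x y y' : R, 0 < x < 1 ->
     0 < y < 1 -> 0 < y' < 1 -> `|y' - y| <= hy j ->
     `|F (x, y') - F (x, y)| <= M * (15 / Num.sqrt N%:R)) ->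
  `|upstream J| <= d0 * b * M * Num.sqrt (3 * K1 * L * ln N%:R) * Num.sqrt (EE xpredT).
Proof.
move=> M0 kL FM Fx Fy.
have s0 : 0 < Num.sqrt N%:R :> R by rewrite sqrtr_gt0.
have ss : Num.sqrt N%:R ^+ 2 = N%:R :> R by rewrite sqr_sqrtr// ltW.
have s1 : 1 <= Num.sqrt N%:R :> R by rewrite -[leLHS]sqrtr1 ler_wsqrtr// ler1n.
have L0 : 0 <= L by apply: le_trans kL; apply: sumr_ge0 => j _; exact/ltW/hyg.
pose cx i := (X i + X i.+1) / 2; pose cy j := (Y j + Y j.+1) / 2.
have cxO i : (i < N)%N -> 0 < cx i < 1.
  move=> iN; have /andP[h1 h2] := node_x_in N0 N6 lx0 lx1 (ltnW iN).
  have /andP[h3 h4] := node_x_in N0 N6 lx0 lx1 iN.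
  by have := hxg iN; rewrite /width_x /cx => ?; apply/andP; split; lra.
have cyO j : (j < N)%N -> 0 < cy j < 1.
  move=> jN; have /andP[h1 h2] := node_y_in N0 N6 ly0 ly1 (ltnW jN).
  have /andP[h3 h4] := node_y_in N0 N6 ly0 ly1 jN.
  by have := hyg jN; rewrite /width_y /cy => ?; apply/andP; split; lra.
have hE i : (i < n)%N -> hx i = 2 * (1 - lx) / N%:R by move=> ni; exact: hx_coarse.
have hs i : (i < n)%N -> hx i <= 2 / Num.sqrt N%:R.
  move=> ni; rewrite (hE _ ni) -mulrA ler_wpM2l// -[X in _ / X]ss expr2 invfM mulrA.
  rewrite -[leRHS]mul1r ler_wpM2r ?invr_ge0 ?(ltW s0)//.
  rewrite ler_pdivrMr// mul1r; have := lx0; lra.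
have e0 : 0 <= 17 / Num.sqrt N%:R :> R by rewrite divr_ge0// ltW.
have b2C : 0 <= b ^+ 2 * Cs by rewrite mulr_ge0 ?sqr_ge0// ltW.
have A1 : 0 <= 3468 / (b ^+ 2 * Cs) by exact: divr_ge0 (ler0n _ _) b2C.
have A2 : 0 <= 18 / c by exact: divr_ge0 (ler0n _ _) (ltW c0).
have A3 : 0 <= 15 / 2 / beta.
  by apply: divr_ge0 (ltW be0); exact: divr_ge0 (ler0n _ _) (ler0n _ _).
have K10 : 0 <= K1 by exact: addr_ge0 (addr_ge0 A1 A3) A2.
apply: norm_le_sqrt.
  by rewrite !mulr_ge0 ?sqrtr_ge0 ?(ltW dl0)// ltW.
have S := abel_sum_le eps0 b0 c0 dl0 nN hxg hyg g0 gN sum_hx_coarse sum_hx_fine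
  (I := cint F) (phi := fun i j => F (cx i, cy j)) kL M0 e0.
rewrite /upstream exprMn; apply: le_trans (ler_wpM2l (sqr_ge0 _) (S _ _ _)) _.
- move=> i j ni jN Jj; have iN : (i < N)%N by exact: leq_trans ni nN.
  apply: cellint_near => // -[x y] cp.
  have [/= + +] := cell_Omega N0 N6 lx0 lx1 ly0 ly1 iN jN cp.
  have [/= + +] := cp; rewrite !in_itv/= => xi yj x01 y01.
  have -> : F (x, y) - F (cx i, cy j) =
      (F (x, y) - F (cx i, y)) + (F (cx i, y) - F (cx i, cy j)) by ring.
  apply: le_trans (ler_normD _ _) _.
  have h1 := Fx y (cx i) x y01 (cxO i iN) x01.
  have h2 : `|F (cx i, y) - F (cx i, cy j)| <= M * (15 / Num.sqrt N%:R).
    apply: (Fy j) => //; [exact: cxO|exact: cyO|].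
    by exact: dist_midpoint.
  have h3 : M * `|x - cx i| <= M * (2 / Num.sqrt N%:R).
    rewrite ler_wpM2l//; apply: le_trans (hs i ni).
    by exact: dist_midpoint.
  lra.
- move=> i j ni jN Jj; apply: FM.
  have iN : (i < N)%N by exact: leq_trans ni nN.
  by split; rewrite /= in_itv/=; [exact: cxO|exact: cyO].
- move=> i j ni jN Jj; have ni' : (i < n)%N by exact: ltnW.
  have iN : (i.+1 < N)%N by exact: leq_trans ni nN.
  apply: le_trans (Fx _ _ _ (cyO _ jN) (cxO _ (ltnW iN)) (cxO _ iN)) _.
  rewrite ler_wpM2l// ger0_norm.
    have := hE _ ni; have := hE _ ni'; rewrite /width_x /cx; lra.
  have := hxg (ltnW iN); have := hxg iN; rewrite /width_x /cx; lra.
have kl0 : 0 <= 3 * K1 * L * ln N%:R.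
  by apply: mulr_ge0; [rewrite !mulr_ge0|exact: le_trans ell1].
rewrite [in leRHS]exprMn sqr_sqrtr//; set Z := 12 * _ / _ + _ + _.
rewrite [leLHS](_ : _ = (d0 * b * M) ^+ 2 * (3 * L) * (Z * EE J)); last by ring.
rewrite [leRHS](_ : _ = (d0 * b * M) ^+ 2 * (3 * L) * (K1 * ln N%:R * EE xpredT));
  last by ring.
apply: ler_wpM2l.
  by apply: mulr_ge0; [exact: sqr_ge0|exact: mulr_ge0].
have ZE : Z = 3468 / (b ^+ 2 * Cs) + 15 / 2 / beta * ln N%:R + 18 / c.
  rewrite /Z expr_div_n ss lxE; field; by rewrite !lt0r_neq0.
have Z0 : 0 <= Z.
  rewrite ZE; apply: addr_ge0 _ A2; apply: addr_ge0 A1 _; apply: mulr_ge0 A3 _.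
  exact: le_trans ell1.
apply: ler_pM => //; [by apply: energy_ge0| |exact: energy_le].
rewrite ZE /K1; have := ler_wpM2l A1 ell1; have := ler_wpM2l A2 ell1; lra.
Qed.
End component.
End assembly.

(** * The four parts of the solution *)
Section components.
Context {R : realType}.
Variables (beta eps C : R).
Hypotheses (be0 : 0 < beta) (eps0 : 0 < eps) (eps1 : eps <= 1) (C0 : 0 < C).

Lemma layer_x_in p : Omega p -> 0 <= layer_x beta eps p <= 1.
Proof.
case: p => x y [/= + _]; rewrite in_itv/= => /andP[x0 x1].
rewrite /layer_x/= expR_ge0/= -[leRHS]expR0 ler_expR oppr_le0.
by apply: divr_ge0 (ltW eps0); apply: mulr_ge0 (ltW be0) _; lra.
Qed.

(** The factor [eps] of the diffusion term makes the second x-derivative of the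
    exponential layers [O(1 / eps)] and the second y-derivative of the side layer
    [O(1)]. *)
Definition scaled (L : R * R -> R) (p : R * R) : R := eps * L p.

Lemma continuous_scaled L : (forall p, Omega p -> {for p, continuous L}) ->
  forall p, Omega p -> {for p, continuous (scaled L)}.
Proof. by move=> cL p Op; apply: continuousM; [exact: cst_continuous|exact: cL]. Qed.

Lemma norm_scaled x : `|eps * x| = eps * `|x|.
Proof. by rewrite normrM gtr0_norm. Qed.

Definition component E L := [/\ has_laplacian E L &
  forall p, Omega p -> {for p, continuous (scaled L)}].

Lemma smooth_component E : has_bounds E (fun _ _ _ => C) -> exists L,
  [/\ component E L,
      forall p, Omega p -> `|scaled L p| <= 2 * C * eps,
      forall y x x' : R, 0 < y < 1 -> 0 < x < 1 -> 0 < x' < 1 ->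
        `|scaled L (x', y) - scaled L (x, y)| <= 2 * C * eps * `|x' - x| &
      forall x y y' : R, 0 < x < 1 -> 0 < y < 1 -> 0 < y' < 1 ->
        `|scaled L (x, y') - scaled L (x, y)| <= 2 * C * eps * `|y' - y|].
Proof.
move=> /laplacian_bounds[L [hL cL bL xL yL]]; exists L; split.
- by split => //; exact: continuous_scaled.
- move=> p Op; rewrite norm_scaled mulrC ler_wpM2r ?(ltW eps0)//.
  by have := bL p Op; lra.
- move=> y x x' y01 x01 x01'; rewrite -mulrBr norm_scaled.
  rewrite [_ * eps]mulrC -mulrA ler_wpM2l ?(ltW eps0)//.
  by apply: xL => // t _; lra.
- move=> x y y' x01 y01 y01'; rewrite -mulrBr norm_scaled.
  rewrite [_ * eps]mulrC -mulrA ler_wpM2l ?(ltW eps0)//.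
  by apply: yL => // t _; lra.
Qed.

Let pw := powR_half_integers eps0.

Lemma exp_component E :
  has_bounds E (fun i _ p => C * eps `^ (- i%:R) * layer_x beta eps p) -> exists L,
  component E L /\
  forall p, Omega p -> `|scaled L p| <= 2 * C / eps * layer_x beta eps p.
Proof.
move=> /laplacian_bounds[L [hL cL bL _ _]]; exists L; split.
  by split => //; exact: continuous_scaled.
move=> p Op; rewrite norm_scaled; have := bL p Op.
have [-> _ -> _ _] := pw; have /andP[l0 _] := layer_x_in Op.
move: (layer_x beta eps p) l0 => l l0 H.
apply: le_trans (ler_wpM2l (ltW eps0) H) _.
rewrite (_ : eps * _ = (1 + eps ^+ 2) * (C / eps * l)); last first.
  by field; exact: lt0r_neq0.
rewrite [leRHS](_ : _ = 2 * (C / eps * l)); last by ring.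
have Cl : 0 <= C / eps * l by apply: mulr_ge0 l0; apply: divr_ge0; exact: ltW.
apply: ler_wpM2r => //.
have : eps ^+ 2 <= 1 by rewrite exprn_ile1// ltW.
by lra.
Qed.

Lemma corner_component E :
  has_bounds E (fun i j p => C * eps `^ (- (i%:R + j%:R / 2)) *
     layer_x beta eps p * layer_y eps p) -> exists L,
  component E L /\
  forall p, Omega p -> `|scaled L p| <= 4 * C / eps * layer_x beta eps p.
Proof.
move=> /laplacian_bounds[L [hL cL bL _ _]]; exists L; split.
  by split => //; exact: continuous_scaled.
move=> p Op; rewrite norm_scaled; have := bL p Op.
have [_ e1 e2 _ _] := pw; have /andP[l0 _] := layer_x_in Op.
have /andP[m0 m2] := layer_y_le Op eps0.
rewrite (_ : 2 + 0 / 2 = 2%:R :> R); last by rewrite mul0r addr0.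
rewrite (_ : 0 + 2 / 2 = 1%:R :> R); last by rewrite add0r divff.
rewrite e1 e2.
move: (layer_x beta eps p) l0 => l l0; move: (layer_y eps p) m0 m2 => m m0 m2 H.
apply: le_trans (ler_wpM2l (ltW eps0) H) _.
rewrite (_ : eps * _ = ((1 + eps) * m) * (C / eps * l)); last first.
  by field; exact: lt0r_neq0.
rewrite [leRHS](_ : _ = (2 * 2) * (C / eps * l)); last by ring.
have Cl : 0 <= C / eps * l by apply: mulr_ge0 l0; apply: divr_ge0; exact: ltW.
by apply: ler_wpM2r => //; apply: ler_pM => //; have := eps1; have := eps0; lra.
Qed.

Lemma side_component E :
  has_bounds E (fun _ j p => C * eps `^ (- (j%:R / 2)) * layer_y eps p) ->
  exists L,
  [/\ component E L,
      forall p, Omega p -> `|scaled L p| <= 2 * C * layer_y eps p,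
      forall y x x' : R, 0 < y < 1 -> 0 < x < 1 -> 0 < x' < 1 ->
        `|scaled L (x', y) - scaled L (x, y)| <= 4 * C * `|x' - x| &
      forall x y y' : R, 0 < x < 1 -> 0 < y < 1 -> 0 < y' < 1 ->
        `|scaled L (x, y') - scaled L (x, y)| <= 4 * C / Num.sqrt eps * `|y' - y|].
Proof.
move=> /laplacian_bounds[L [hL cL bL xL yL]]; exists L.
have [p0 p1 p2 p3 p12] := pw.
have s0 : 0 < Num.sqrt eps by rewrite sqrtr_gt0.
have ss : Num.sqrt eps ^+ 2 = eps by rewrite sqr_sqrtr// ltW.
have s1 : Num.sqrt eps <= 1 by rewrite -[leRHS]sqrtr1 ler_wsqrtr.
have e0 : eps `^ (- (0 / 2)) = 1 by rewrite mul0r.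
have e2 : eps `^ (- (2 / 2)) = eps^-1 by rewrite divff.
have e1 : eps `^ (- (1 / 2)) = (Num.sqrt eps)^-1 by [].
have e3 : eps `^ (- (3 / 2)) = (Num.sqrt eps)^-1 ^+ 3.
  rewrite -e1 -powR_mulrn ?powR_ge0// -powRrM; congr (_ `^ _); by field.
have Oxy (x y : R) : 0 < x < 1 -> 0 < y < 1 -> Omega (x, y).
  by move=> h1 h2; split; rewrite /= in_itv.
split.
- by split => //; exact: continuous_scaled.
- move=> p Op; rewrite norm_scaled; have := bL p Op; rewrite e0 e2.
  have /andP[m0 m2] := layer_y_le Op eps0.
  move: (layer_y eps p) m0 m2 => m m0 m2 H.
  apply: le_trans (ler_wpM2l (ltW eps0) H) _.
  rewrite (_ : eps * _ = (1 + eps) * (C * m)); last by field; exact: lt0r_neq0.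
  rewrite -[leRHS]mulrA ler_wpM2r ?mulr_ge0 ?(ltW C0)//; have := eps1; lra.
- move=> y x x' y01 x01 x01'; rewrite -mulrBr norm_scaled.
  have := xL (4 * C / eps) y x x' y01 x01 x01' => H.
  apply: le_trans (ler_wpM2l (ltW eps0) (H _)) _; last first.
    by rewrite le_eqVlt; apply/orP; left; apply/eqP; field; exact: lt0r_neq0.
  move=> t t01; rewrite e0 e2.
  have /andP[m0 m2] := layer_y_le (Oxy t y t01 y01) eps0.
  move: (layer_y eps _) m0 m2 => m m0 m2.
  rewrite (_ : _ + _ = ((1 + eps) * m) * (C / eps)); last by field; exact: lt0r_neq0.
  rewrite [leRHS](_ : _ = (2 * 2) * (C / eps)); last by ring.
  have Cl : 0 <= C / eps by apply: divr_ge0; exact: ltW.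
  by apply: ler_wpM2r => //; apply: ler_pM => //; have := eps1; have := eps0; lra.
- move=> x y y' x01 y01 y01'; rewrite -mulrBr norm_scaled.
  have := yL (4 * C * (Num.sqrt eps)^-1 ^+ 3) x y y' x01 y01 y01' => H.
  apply: le_trans (ler_wpM2l (ltW eps0) (H _)) _; last first.
    rewrite -{1}ss; rewrite le_eqVlt; apply/orP; left; apply/eqP; field.
    exact: lt0r_neq0.
  move=> t t01; rewrite e1 e3.
  have /andP[m0 m2] := layer_y_le (Oxy x t x01 t01) eps0.
  move: (layer_y eps _) m0 m2 => m m0 m2; move: (Num.sqrt eps) s0 s1 => s s0 s1.
  rewrite (_ : _ + _ = ((s ^+ 2 + 1) * m) * (C * s^-1 ^+ 3)); last first.
    by field; exact: lt0r_neq0.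
  rewrite [leRHS](_ : _ = (2 * 2) * (C * s^-1 ^+ 3)); last by ring.
  have Cl : 0 <= C * s^-1 ^+ 3 by rewrite mulr_ge0 ?exprn_ge0 ?invr_ge0 ?ltW.
  apply: ler_wpM2r => //; apply: ler_pM => //; first by rewrite addr_ge0 ?sqr_ge0.
  have : s ^+ 2 <= 1 by rewrite exprn_ile1// ltW.
  by lra.
Qed.
End components.

(** * Rows of the mesh *)
Lemma two_thirds_le N : ((2 * N) %/ 3 <= N)%N.
Proof. lia. Qed.

Section splitting.
Context {R : realType}.
Variables (b c beta Cs eps lx ly : R) (N : nat).
Hypotheses (b0 : 0 < b) (c0 : 0 < c) (be0 : 0 < beta) (Cs0 : 0 < Cs)
  (eps0 : 0 < eps) (N0 : (0 < N)%N) (N6 : (6 %| N)%N).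
Hypotheses (lx0 : 0 < lx) (lx1 : lx <= 1 / 2) (ly0 : 0 < ly) (ly1 : ly <= 1 / 4).
Local Notation X := (node_x lx N).
Local Notation Y := (node_y ly N).
Local Notation hx := (width_x lx N).
Local Notation hy := (width_y ly N).
Local Notation n := (N %/ 2)%N.
Local Notation d0 := (Cs / N%:R).
Variable G : R * R -> R.
Hypothesis VG : fe_space lx ly N G.
Local Notation g := (nodes lx ly N G).
Local Notation EE := (energy eps b c d0 N n hx hy g).
Local Notation cint := (cellint lx ly N G).
Local Notation up := (upstream b Cs lx ly N G).

Let Nr0 : 0 < N%:R :> R. Proof. by rewrite ltr0n. Qed.
Let hxg i : (i < N)%N -> 0 < hx i. Proof. exact: hx_gt0. Qed.
Let hyg j : (j < N)%N -> 0 < hy j. Proof. exact: hy_gt0. Qed.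
Let mc i j : @measurable _ (measurableTypeR R * measurableTypeR R)%type (cell X Y i j).
Proof. exact: measurable_orect. Qed.

Definition bounded_continuous (F : R * R -> R) :=
  (forall p, Omega p -> {for p, continuous F}) /\
  exists M, forall p, Omega p -> `|F p| <= M.

Lemma bounded_cellint F i j : bounded_continuous F -> (i < N)%N -> (j < N)%N ->
  has_integral plane (cell X Y i j) (fun p => F p * dx G p) (cint F i j).
Proof.
move=> [cF [M FM]] iN jN; apply: (has_cellint N0 N6 lx0 lx1 ly0 ly1 VG iN jN cF (M := M)).
by move=> p /(cell_Omega N0 N6 lx0 lx1 ly0 ly1 iN jN)/FM.
Qed.

Lemma bounded_continuousD F1 F2 : bounded_continuous F1 -> bounded_continuous F2 ->
  bounded_continuous (fun p => F1 p + F2 p).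
Proof.
move=> [c1 [M1 b1]] [c2 [M2 b2]]; split.
  by move=> p Op; apply: continuousD; [exact: c1|exact: c2].
exists (M1 + M2) => p Op; apply: le_trans (ler_normD _ _) _.
by apply: lerD; [exact: b1|exact: b2].
Qed.

Lemma upstreamD F1 F2 J : bounded_continuous F1 -> bounded_continuous F2 ->
  up (fun p => F1 p + F2 p) J = up F1 J + up F2 J.
Proof.
move=> B1 B2; rewrite /upstream -mulrDr -big_split/=; congr (_ * _).
apply: eq_bigr => j _; rewrite -big_split/=; apply: eq_bigr => i _.
have iN := ltn_ord i; have jN := ltn_ord j.
have [_ <-] := has_integralD (mc i j) (bounded_cellint B1 iN jN) (bounded_cellint B2 iN jN).
by apply: eq_Rintegral => p _; rewrite mulrDl.
Qed.

Lemma upstream_split F (J : pred nat) :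
  up F xpredT = up F J + up F (fun j => ~~ J j).
Proof. by rewrite /upstream -mulrDr (bigID (fun j : 'I_N => J j)). Qed.

Lemma L2_upstream F H : bounded_continuous F -> (forall p, Omega p -> H p = F p) ->
  L2_inner H (fun p => delta Cs lx ly N p * b * dx G p) = up F xpredT.
Proof.
move=> B HF; rewrite L2_innerE (OmegaE lx ly N0 N6).
rewrite (@Rintegral_cells _ X Y N N _ (fun i j => stab d0 n i * b * cint F i j)) //.
- rewrite /upstream mulr_sumr; apply: eq_bigr => j _.
  rewrite mulr_sumr [RHS]big_mkcond/=; apply: eq_bigr => i _.
  by rewrite /stab; case: ifP => // _; rewrite !mul0r.
- by move=> i /hxg; rewrite subr_gt0.
- by move=> i /hyg; rewrite subr_gt0.
move=> i j iN jN.
have := has_integralZ (stab d0 n i * b) (mc i j) (bounded_cellint B iN jN).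
apply: has_integral_eq => // p cp.
rewrite (delta_cell N0 N6 lx0 lx1 ly0 ly1 Cs iN jN cp) HF; first by ring.
exact: (cell_Omega N0 N6 lx0 lx1 ly0 ly1 iN jN).
Qed.

(** Markov's inequality for the weighted energy. *)
Lemma rows_energy_le (J : pred nat) (A : R) (w : nat -> R) : 0 < A ->
  (forall j, 0 <= w j) ->
  (forall j, (j < N)%N -> J j -> A <= w j) ->
  sumcells N hx hy (fun i j => w j * fe_energy lx ly N eps b c Cs G i j) <=
    6 * sumcells N hx hy (fe_energy lx ly N eps b c Cs G) ->
  EE J <= 6 / A * EE xpredT.
Proof.
move=> A0 w0 Jw H.
have E0 i j : 0 <= fe_energy lx ly N eps b c Cs G i j.
  by apply: Ecell_ge0 => //; apply: stab_ge0; rewrite divr_ge0 ?ltW.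
have S : A * EE J <= sumcells N hx hy
    (fun i j => w j * fe_energy lx ly N eps b c Cs G i j).
  rewrite /energy mulr_sumr big_mkcond/=; apply: ler_sum => j _.
  have hk (i : 'I_N) : 0 <= hx i * hy j.
    by apply: mulr_ge0; apply: ltW; [exact: hxg|exact: hyg].
  case: ifPn => Jj.
    rewrite mulr_sumr; apply: ler_sum => i _.
    rewrite mulrCA; apply: ler_wpM2l => //.
    by apply: ler_wpM2r; [exact: E0|exact: Jw].
  by apply: sumr_ge0 => i _; apply: mulr_ge0 => //; apply: mulr_ge0.
rewrite -(ler_pM2l A0); apply: le_trans S _.
rewrite (_ : A * _ = 6 * EE xpredT) //.
by field; exact: lt0r_neq0.
Qed.

(** Clamping the nodes to [[y - s, y + s]] leaves the heights of these rows
    unchanged, and the clamped heights of all rows telescope. *)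
Lemma near_rows_width (y s : R) (J : pred nat) : 0 <= s ->
  (forall j, (j < N)%N -> J j -> `|Y j - y| <= s /\ `|Y j.+1 - y| <= s) ->
  \sum_(j < N | J j) hy j <= 2 * s.
Proof.
move=> s0 Js.
pose cl (t : R) := Num.max (y - s) (Num.min (y + s) t).
have clE t : `|t - y| <= s -> cl t = t.
  by rewrite ler_norml => /andP[h1 h2]; rewrite /cl min_r ?max_r//; lra.
have cl_incr t u : t <= u -> cl t <= cl u.
  move=> tu; rewrite /cl /Order.max /Order.min.
  by case: (ltP (y + s) t) => h1; case: (ltP (y + s) u) => h2;
    case: ltP => h3; case: ltP => h4; lra.
have cl1 t : y - s <= cl t by rewrite /cl le_max lexx.
have cl2 t : cl t <= y + s by rewrite /cl /Order.max /Order.min;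
  case: (ltP (y + s) t) => h1; case: ltP => h2; lra.
apply: (@le_trans _ _ (\sum_(j < N) (cl (Y j.+1) - cl (Y j)))).
  rewrite big_mkcond/=; apply: ler_sum => j _; case: ifPn => Jj.
    by have [h1 h2] := Js j (ltn_ord j) Jj; rewrite !clE.
  by rewrite subr_ge0 cl_incr// -subr_ge0; exact/ltW/hyg.
rewrite (telescope_ord (fun j => cl (Y j))).
by have := cl1 (Y 0%N); have := cl2 (Y N); lra.
Qed.

(** The coarse rows, which make up the strip [[ly, 1 - ly]] of [y]. *)
Definition midrow (j : nat) := (N %/ 3 <= j < (2 * N) %/ 3)%N.

Lemma midrow_y i j p : (i < N)%N -> (j < N)%N -> midrow j -> cell X Y i j p ->
  ly <= p.2 <= 1 - ly.
Proof.
case: p => x y iN jN /andP[j1 j2] [/= _]; rewrite in_itv/= => /andP[y1 y2].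
have incr := node_y_incr N0 N6 ly0 ly1.
have N23 : ((2 * N) %/ 3 <= N)%N by exact: two_thirds_le.
rewrite -{1}(node_y_third ly N0 N6) -{1}(node_y_two_thirds ly N0 N6).
apply/andP; split.
  by apply: (le_trans _ (ltW y1)); apply: incr; rewrite j1 ltnW.
by apply: (le_trans (ltW y2)); apply: incr; rewrite j2.
Qed.

Lemma layer_rows_width : \sum_(j < N | ~~ midrow j) hy j <= 2 * ly.
Proof.
have N23 : ((2 * N) %/ 3 <= N)%N by exact: two_thirds_le.
have N13 : (N %/ 3 <= (2 * N) %/ 3)%N by rewrite leq_div2r// leq_pmull.
have := sum_hy ly N0 N6; rewrite (bigID (fun j : 'I_N => midrow j))/=.
have -> : \sum_(j < N | midrow j) hy j = 1 - 2 * ly.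
  transitivity (\sum_(N %/ 3 <= j < (2 * N) %/ 3) hy j).
    rewrite -(big_mkord midrow hy) (big_nat_widen _ _ _ xpredT _ N23)/=.
    rewrite [RHS](big_nat_widenl _ 0)//=.
    by apply: eq_bigl => j; exact: andbC.
  rewrite telescope_sumr// (node_y_third ly N0 N6) (node_y_two_thirds ly N0 N6).
  by ring.
by lra.
Qed.

Lemma layer_row_hy j : (j < N)%N -> ~~ midrow j -> hy j = 3 * ly / N%:R.
Proof.
by move=> jN nj; have [//|[jm _]] := hy_cases ly N0 N6 jN; rewrite /midrow jm in nj.
Qed.

(** The condition on [x] in [Omega0] holds for all small [x], as [xs.1 >= 0]. So
    if a row of cells in a strip lay within [s] of the level of [xs], its first
    cell [tau] would meet [Omega0] in positive area and belong to [Omega0'],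
    although a corner of [tau] lies outside the middle strip. One of the
    two edges of the row may still be close to [xs.2]. *)
Lemma far_layer_rows k K xs j : 0 < k -> 0 < K -> 0 < ln N%:R :> R -> 0 <= xs.1 ->
  Omega0' lx ly k K N xs `<=` Omega_s lx ly `|` Omega_1 lx ly ->
  (j < N)%N -> ~~ midrow j ->
  K * sigma_y k N * ln N%:R <= `|Y j - xs.2| \/
  K * sigma_y k N * ln N%:R <= `|Y j.+1 - xs.2|.
Proof.
move=> k0 K0 l0 x0 sub jN nmid; set s := K * _ * _.
have [h1|h1] := leP s `|Y j - xs.2|; first by left.
have [h2|h2] := leP s `|Y j.+1 - xs.2|; first by right.
exfalso.
pose tau : set (R * R) := `[X 0, X 1] `*` `[Y j, Y j.+1].
have mt : mesh lx ly N tau by exists 1%N, j.+1; split.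
have x01 : 0 < X 1%N by have := hxg N0; rewrite /width_x (node_x0 lx N) subr0.
have ylt := hyg jN.
have yl2 : Y j < Y j.+1 by move: ylt; rewrite /width_y subr_gt0.
have pos : area (Omega0 k K N xs `&` tau) <> 0%E.
  pose x1 := Num.min (X 1%N) (K * sigma_x k N * ln N%:R).
  have x1_gt0 : 0 < x1.
    rewrite lt_min x01/= !mulr_gt0// /sigma_x ?invr_gt0//.
  have sub1 : orect 0 x1 (Y j) (Y j.+1) `<=` Omega0 k K N xs `&` tau.
    move=> [x y] [/=]; rewrite !in_itv/= => /andP[xa xb] /andP[ya yb].
    have xX : x < X 1%N by apply: (lt_le_trans xb); rewrite /x1 ge_min lexx.
    have xK : x <= K * sigma_x k N * ln N%:R.
      by apply/ltW/(lt_le_trans xb); rewrite /x1 ge_min lexx orbT.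
    split; first split.
    - apply: (@cell_Omega _ lx ly N N0 N6 lx0 lx1 ly0 ly1 0 j N0 jN).
      by split; rewrite /= in_itv/= ?(node_x0 lx N) ?xa ?ya.
    - by rewrite /=; lra.
    - rewrite /= ler_norml; move: h1 h2; rewrite -/s !ltr_norml => /andP[? ?] /andP[? ?].
      by apply/andP; split; lra.
    - by split; rewrite /= in_itv/= ?(node_x0 lx N); apply/andP; split; exact: ltW.
  move=> A0.
  have mO : @measurable _ (measurableTypeR R * measurableTypeR R)%type
      (Omega0 k K N xs `&` tau).
    pose a := K * sigma_x k N * ln N%:R.
    have -> : Omega0 k K N xs `&` tau =
      (`]0, 1[ `&` `]-oo, (xs.1 + a)] `&` `[X 0, X 1]) `*`
      (`]0, 1[ `&` `[(xs.2 - s), (xs.2 + s)] `&` `[Y j, Y j.+1]).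
      apply/seteqP; split=> -[x y] /=.
        case=> -[u1 u3 u4] T1; case: u1 => /= u1 u2; case: T1 => /= t1 t2; move: u3 u4 => /= u3 u4.
        have /andP[u5 u6] : - s <= y - xs.2 <= s by rewrite -ler_norml.
        split => /=.
          by split => //; split => //; rewrite in_itv/= /a; lra.
        split => //; split => //.
        by rewrite in_itv/=; apply/andP; split; lra.
      move=> [[[u1 +] t1] [[u2 +] t2]]; rewrite /= !in_itv/= => u3 /andP[u4 u5].
      split; split => //=; first by rewrite /a in u3; lra.
      by rewrite ler_norml; apply/andP; split; rewrite -/s; lra.
    by apply: measurableX; apply: measurableI => //; apply: measurableI.
  have : (plane (orect 0 x1 (Y j) (Y j.+1)) <= plane (Omega0 k K N xs `&` tau))%E.
    have le_pl := @le_measure _ _ _ (@plane R) (orect 0 x1 (Y j) (Y j.+1)) (Omega0 k K N xs `&` tau).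
    by apply: le_pl => //; rewrite inE//; exact: measurable_orect.
  have -> : plane (Omega0 k K N xs `&` tau) = 0%E := A0.
  have yle : Y j <= Y j.+1 by rewrite -subr_ge0 ltW.
  rewrite (area_orectE (ltW x1_gt0) yle) lee_fin leNgt.
  by rewrite mulr_gt0 ?subr_gt0// -subr_gt0.
have tin : tau `<=` Omega_s lx ly `|` Omega_1 lx ly.
  by apply: subset_trans sub => p tp; exists tau.
move: nmid; rewrite /midrow negb_and -!ltnNge => /orP[jl|jl].
  have : tau (0, Y j).
    by split; rewrite /= in_itv/= ?(node_x0 lx N);
      have := x01; have := ylt; rewrite /width_y; lra.
  have : Y j < ly.
    rewrite -[ltRHS](node_y_third ly N0 N6).
    apply: (@lt_le_trans _ _ (Y j.+1)); first exact: yl2.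
    by apply: (node_y_incr N0 N6 ly0 ly1); rewrite jl leq_div.
  by move=> yl /tin [] [/= _]; rewrite in_itv/=; lra.
have : tau (0, Y j.+1).
  by split; rewrite /= in_itv/= ?(node_x0 lx N);
    have := x01; have := ylt; rewrite /width_y; lra.
have : 1 - ly < Y j.+1.
  rewrite -[ltLHS](node_y_two_thirds ly N0 N6).
  apply: (@le_lt_trans _ _ (Y j)); last exact: yl2.
  by apply: (node_y_incr N0 N6 ly0 ly1); rewrite -ltnS jl ltnW.
by move=> yl /tin [] [/= _]; rewrite in_itv/=; lra.
Qed.
End splitting.

(** * The two cases of the estimate *)
Section conclusion.
Context {R : realType}.

Lemma powR_quarter (x : R) : 0 <= x -> x `^ (1 / 4) = Num.sqrt (Num.sqrt x).
Proof.
move=> x0; rewrite -!powR12_sqrt ?powR_ge0// -powRrM.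
by congr (_ `^ _); field.
Qed.

Lemma powR_five_quarters (x : R) : 0 < x ->
  x `^ (- (5 / 4)) = x^-1 * Num.sqrt (Num.sqrt x)^-1.
Proof.
move=> x0; rewrite powRN (_ : 5 / 4 = 1 + 1 / 4); last by field.
rewrite powRD; last by rewrite (gt_eqF x0) implybT.
rewrite powRr1 ?(ltW x0)// (powR_quarter (ltW x0)) invfM; congr (_ * _).
by rewrite sqrtrV ?sqrtr_ge0.
Qed.

Lemma powR_rho_sqr (x : R) : 0 < x -> (x `^ (- rho)) ^+ 2 = (x ^+ 5)^-1.
Proof.
move=> x0; rewrite -powR_mulrn ?powR_ge0// -powRrM /rho.
rewrite (_ : - (5 / 2) * 2%:R = - 5%:R); last by field.
by rewrite powRN powR_mulrn// ltW.
Qed.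

Variables (b c beta Cs eps lx ly C0 : R) (N : nat).
Hypotheses (b0 : 0 < b) (c0 : 0 < c) (be0 : 0 < beta) (Cs0 : 0 < Cs)
  (eps0 : 0 < eps) (N0 : (0 < N)%N) (N6 : (6 %| N)%N) (C00 : 0 < C0)
  (epsN : eps <= N%:R^-1).
Hypotheses (lx1 : lx <= 1 / 2) (ly1 : ly <= 1 / 4)
  (lxE : lx = 5 / 2 * eps / beta * ln N%:R)
  (lyE : ly = 5 / 2 * Num.sqrt eps * ln N%:R).
Local Notation X := (node_x lx N).
Local Notation Y := (node_y ly N).
Local Notation hx := (width_x lx N).
Local Notation hy := (width_y ly N).
Local Notation n := (N %/ 2)%N.
Local Notation d0 := (Cs / N%:R).
Variable G : R * R -> R.
Hypothesis VG : fe_space lx ly N G.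
Local Notation g := (nodes lx ly N G).
Local Notation EE := (energy eps b c d0 N n hx hy g).
Local Notation e := (Num.sqrt (EE xpredT)).
Local Notation up := (upstream b Cs lx ly N G).
Local Notation P := (N%:R `^ (- rho) : R).
Local Notation ell := (ln N%:R : R).
Local Notation K1 := (abel_constant b c beta Cs).

Let Nr0 : 0 < N%:R :> R. Proof. by rewrite ltr0n. Qed.
Let Nr1 : 1 <= N%:R :> R. Proof. by rewrite ler1n. Qed.
Let ell1 : 1 <= ell. Proof. exact: ln_ge1. Qed.
Let ell0 : 0 <= ell. Proof. exact: le_trans ell1. Qed.
Let eps1 : eps <= 1.
Proof. by apply: le_trans epsN _; rewrite invf_le1. Qed.
Let lx0 : 0 < lx. Proof. exact: (lx_gt0 be0 eps0 N0 N6 lxE). Qed.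
Let ly0 : 0 < ly. Proof. exact: (ly_gt0 eps0 N0 N6 lyE). Qed.
Let dl0 : 0 < d0. Proof. exact: divr_gt0. Qed.
Let P0 : 0 <= P. Proof. exact: powR_ge0. Qed.
Let e0 : 0 <= e. Proof. exact: sqrtr_ge0. Qed.
Let se0 : 0 < Num.sqrt eps. Proof. by rewrite sqrtr_gt0. Qed.
Let d0Cs : d0 <= Cs.
Proof. by rewrite ler_pdivrMr// ler_peMr// ltW. Qed.
Let K10 : 0 <= K1.
Proof.
apply: addr_ge0; last exact: divr_ge0 (ler0n _ _) (ltW c0).
apply: addr_ge0; first by apply: divr_ge0 (ler0n _ _) _; rewrite mulr_ge0 ?sqr_ge0 ?ltW.
by apply: divr_ge0 (ltW be0); exact: divr_ge0 (ler0n _ _) (ler0n _ _).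
Qed.

Lemma energy_normE : energy_norm eps b c (delta Cs lx ly N) G = e.
Proof. by rewrite (energy_cells N0 N6 lx0 lx1 ly0 ly1 eps b c Cs VG). Qed.

Lemma mid_layer_y i j p : (i < N)%N -> (j < N)%N -> midrow N j -> cell X Y i j p ->
  layer_y eps p <= 2 * P.
Proof.
move=> iN jN mj cp.
have := midrow_y N0 N6 ly0 ly1 iN jN mj cp; case: p {cp} => x y /= /andP[y1 y2].
have H t : ly <= t -> expR (- (t / Num.sqrt eps)) <= P.
  move=> lt; rewrite /powR gt_eqF// ler_expR /rho mulNr lerN2.
  rewrite ler_pdivlMr//; apply: le_trans lt; rewrite lyE; lra.
by have := H y y1; have := H (1 - y); rewrite /layer_y/=; lra.
Qed.

Definition smooth_part (F : R * R -> R) :=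
  [/\ forall p, Omega p -> {for p, continuous F},
      forall p, Omega p -> `|F p| <= 2 * C0 * eps,
      forall y x x' : R, 0 < y < 1 -> 0 < x < 1 -> 0 < x' < 1 ->
        `|F (x', y) - F (x, y)| <= 2 * C0 * eps * `|x' - x| &
      forall x y y' : R, 0 < x < 1 -> 0 < y < 1 -> 0 < y' < 1 ->
        `|F (x, y') - F (x, y)| <= 2 * C0 * eps * `|y' - y|].

Definition side_part (F : R * R -> R) :=
  [/\ forall p, Omega p -> {for p, continuous F},
      forall p, Omega p -> `|F p| <= 4 * C0,
      forall y x x' : R, 0 < y < 1 -> 0 < x < 1 -> 0 < x' < 1 ->
        `|F (x', y) - F (x, y)| <= 4 * C0 * `|x' - x| &
      forall x y y' : R, 0 < x < 1 -> 0 < y < 1 -> 0 < y' < 1 ->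
        `|F (x, y') - F (x, y)| <= 4 * C0 / Num.sqrt eps * `|y' - y|].

(** The exponential layers, and the side layer in the middle rows, are [O(N^(-rho))]
    in both cases; what is left is the smooth part and the side layer in the
    strips. *)
Lemma inner_le_parts u : decomposes beta eps C0 u -> exists FS F2,
  [/\ smooth_part FS, side_part F2 &
   `|L2_inner (fun p => eps * laplacian u p)
       (fun p => delta Cs lx ly N p * b * dx G p)| <=
   `|up FS xpredT| + `|up F2 (fun j => ~~ midrow N j)|
    + Num.sqrt (12 * Cs) * (6 * C0 / beta + 4 * C0) * P * e].
Proof.
move=> [S [E1 [E2 [E12 [uE hS h1 h2 h12]]]]].
have [LS [[hLS cS] bS xS yS]] := smooth_component eps0 hS.
have [L1 [[hL1 c1] b1]] := exp_component be0 eps0 eps1 C00 h1.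
have [L2 [[hL2 c2] b2 x2 y2]] := side_component eps0 eps1 C00 h2.
have [L12 [[hL12 c12] b12]] := corner_component be0 eps0 eps1 C00 h12.
pose FS := scaled eps LS; pose F1 := scaled eps L1.
pose F2 := scaled eps L2; pose F12 := scaled eps L12.
have b2' p : Omega p -> `|F2 p| <= 4 * C0.
  move=> Op; apply: le_trans (b2 p Op) _; have /andP[_ h] := layer_y_le Op eps0.
  by have := ler_wpM2l (ltW C00) h; lra.
exists FS, F2; split; [by split|by split|].
have lay p : Omega p -> layer_x beta eps p <= 1.
  by move=> Op; have /andP[] := layer_x_in be0 eps0 Op.
have BS : bounded_continuous FS by split => //; exists (2 * C0 * eps).
have B2 : bounded_continuous F2 by split => //; exists (4 * C0).
have B1 : bounded_continuous F1.
  split => //; exists (2 * C0 / eps) => p Op; apply: le_trans (b1 p Op) _.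
  rewrite ler_piMr ?lay// divr_ge0 ?(ltW eps0)//; have := C00; lra.
have B12 : bounded_continuous F12.
  split => //; exists (4 * C0 / eps) => p Op; apply: le_trans (b12 p Op) _.
  rewrite ler_piMr ?lay// divr_ge0 ?(ltW eps0)//; have := C00; lra.
have BD := bounded_continuousD.
have L2u := L2_upstream b Cs N0 N6 lx0 lx1 ly0 ly1 VG.
rewrite (L2u (fun p => FS p + F1 p + F2 p + F12 p)); last 2 first.
- by apply: (BD) => //; apply: (BD) => //; apply: BD.
- move=> p Op.
  have hL := has_laplacianD (has_laplacianD (has_laplacianD hLS hL1) hL2) hL12.
  have hu : has_laplacian u (fun p => LS p + L1 p + L2 p + L12 p).
    by apply: has_laplacian_eq hL => q /OmegaW/uE.
  by rewrite (laplacianE hu Op) /FS /F1 /F2 /F12 /scaled; ring.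
have UD := upstreamD b Cs N0 N6 lx0 lx1 ly0 ly1 VG.
rewrite UD; [|by apply: (BD) => //; apply: BD|by []].
rewrite UD; [|by apply: BD|by []].
rewrite UD//.
rewrite [up F2 xpredT](upstream_split _ _ _ _ _ _ _ (midrow N)).
have U1 := bound_layer b0 c0 be0 Cs0 eps0 N0 N6 lx1 ly1 lxE lyE VG c1 (M := 2 * C0) _ b1.
have U12 := bound_layer b0 c0 be0 Cs0 eps0 N0 N6 lx1 ly1 lxE lyE VG c12 (M := 4 * C0) _ b12.
have Um := bound_crude b0 c0 be0 Cs0 eps0 N0 N6 lx1 ly1 lxE lyE VG c2 (J := midrow N)
  (M := 4 * C0 * P).
have {U1} U1 : `|up F1 xpredT| <= Num.sqrt (12 * Cs) * (2 * C0 / beta) * P * e.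
  by apply: U1; rewrite mulr_ge0// ltW.
have {U12} U12 : `|up F12 xpredT| <= Num.sqrt (12 * Cs) * (4 * C0 / beta) * P * e.
  by apply: U12; rewrite mulr_ge0// ltW.
have {Um} Um : `|up F2 (midrow N)| <= 4 * C0 * P * Num.sqrt (12 * Cs) * e.
  apply: le_trans (Um _ _) _.
  - by rewrite !mulr_ge0// ltW.
  - move=> i j p ni jN mj cp.
    have iN : (i < N)%N by apply: leq_trans ni _; exact: half_le.
    have Op := cell_Omega N0 N6 lx0 lx1 ly0 ly1 iN jN cp.
    apply: le_trans (b2 p Op) _.
    have C20 : 0 <= 2 * C0 by rewrite mulr_ge0// ltW.
    have := ler_wpM2l C20 (mid_layer_y iN jN mj cp); lra.
  apply: ler_pM; rewrite ?sqrtr_ge0 ?mulr_ge0 ?sqrtr_ge0 ?(ltW C00)//.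
    by rewrite ler_wpM2l ?mulr_ge0 ?(ltW C00)// ler_wsqrtr// ler_wpM2l.
  apply: ler_wsqrtr; exact: (energy_le b c0 be0 Cs0 eps0 N0 N6 lx1 ly1 lxE lyE).
move: U1 U12 Um; set q12 := Num.sqrt (12 * Cs).
set A := up FS _; set B := up F1 _; set D := up F12 _.
set M := up F2 (midrow N); set L := up F2 _ => U1 U12 Um.
apply: le_trans (ler_normD _ _) _.
have T1 := ler_normD (A + B) (M + L); have T2 := ler_normD A B.
have T3 := ler_normD M L.
have -> : q12 * (6 * C0 / beta + 4 * C0) * P * e = q12 * (2 * C0 / beta) * P * e
    + q12 * (4 * C0 / beta) * P * e + 4 * C0 * P * q12 * e by ring.
lra.
Qed.
Lemma smooth_abel F (J : pred nat) (L : R) : smooth_part F ->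
  \sum_(j < N | J j) hy j <= L ->
  `|up F J| <= d0 * b * (2 * C0 * eps) * Num.sqrt (3 * K1 * L * ell) * e.
Proof.
move=> [cF bF xF yF] JL.
have M0 : 0 <= 2 * C0 * eps by rewrite !mulr_ge0// ltW.
apply: (bound_abel b0 c0 be0 Cs0 eps0 N0 N6 lx1 ly1 lxE lyE VG cF M0 JL) => //.
move=> j jN _ x y y' x01 y01 y01' yy.
apply: le_trans (yF x y y' x01 y01 y01') _; apply: ler_wpM2l => //.
apply: le_trans yy _; apply: le_trans (hy_le N0 N6 ly0 ly1 jN) _.
have s0 : 0 < Num.sqrt N%:R :> R by rewrite sqrtr_gt0.
have s1 : 1 <= Num.sqrt N%:R :> R by rewrite -[leLHS]sqrtr1 ler_wsqrtr.
rewrite ler_pdivrMr// mulrAC ler_pdivlMr//.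
rewrite -[X in _ <= _ * X](sqr_sqrtr (ltW Nr0)); move: (Num.sqrt N%:R) s0 s1 => s s0 s1.
have := ler_wpM2l (ltW s0) s1; rewrite expr2; lra.
Qed.

Lemma side_abel F : side_part F ->
  `|up F (fun j => ~~ midrow N j)| <=
    d0 * b * (4 * C0) * Num.sqrt (3 * K1 * (2 * ly) * ell) * e.
Proof.
move=> [cF bF xF yF].
have M0 : 0 <= 4 * C0 by rewrite mulr_ge0// ltW.
apply: (bound_abel b0 c0 be0 Cs0 eps0 N0 N6 lx1 ly1 lxE lyE VG cF M0
  (layer_rows_width ly N0 N6)) => //.
move=> j jN nj x y y' x01 y01 y01' yy.
apply: le_trans (yF x y y' x01 y01 y01') _.
rewrite -mulrA ler_wpM2l// ler_pdivrMl//; apply: le_trans yy _.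
rewrite (layer_row_hy ly N0 N6 jN nj) lyE.
have s0 : 0 < Num.sqrt N%:R :> R by rewrite sqrtr_gt0.
have := ln_le_sqrt (R:=R) N0; rewrite ler_pdivrMr//.
rewrite -[X in _ -> _ <= _ * X](sqr_sqrtr (ltW Nr0)).
move: (Num.sqrt N%:R) s0 => s s0 ls.
rewrite (_ : _ * _ * s ^+ 2 = 15 * Num.sqrt eps * s); last first.
  by field; exact: lt0r_neq0.
have := ler_wpM2l (ltW se0) ls; lra.
Qed.

(** No decay of [G] enters here: the smooth part is summed by parts over all rows,
    and the side layer over the strips, of total height [2 * ly]. *)
Lemma bound_near_strips u : decomposes beta eps C0 u ->
  `|L2_inner (fun p => eps * laplacian u p)
       (fun p => delta Cs lx ly N p * b * dx G p)| <=
  (2 * C0 * b * Num.sqrt (3 * K1) + 4 * C0 * b * Num.sqrt (15 * K1)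
    + Num.sqrt (12 * Cs) * (6 * C0 / beta + 4 * C0))
  * (P + eps `^ (1 / 4) * d0) * ell * e.
Proof.
move=> /inner_le_parts[FS [F2 [hS h2 H]]].
have kS : \sum_(j < N | xpredT j) hy j <= 1 by rewrite (sum_hy ly N0 N6).
have US := smooth_abel (J := xpredT) hS kS; have U2 := side_abel h2.
have s3 : Num.sqrt (3 * K1 * 1 * ell) <= Num.sqrt (3 * K1) * ell.
  rewrite mulr1 sqrtrM ?mulr_ge0// ler_wpM2l ?sqrtr_ge0//.
  rewrite -[leRHS]ger0_norm// -sqrtr_sqr ler_wsqrtr// expr2 ler_peMl//.
pose r := Num.sqrt (Num.sqrt eps).
have r0 : 0 <= r by exact: sqrtr_ge0.
have rE : eps `^ (1 / 4) = r by rewrite powR_quarter// ltW.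
have s15 : Num.sqrt (3 * K1 * (2 * ly) * ell) = Num.sqrt (15 * K1) * r * ell.
  rewrite lyE (_ : _ * _ * ell = 15 * K1 * Num.sqrt eps * ell ^+ 2); last by field.
  have k15 : 0 <= 15 * K1 by rewrite mulr_ge0.
  by rewrite sqrtrM ?mulr_ge0 ?sqrtr_ge0// sqrtr_sqr (ger0_norm ell0) sqrtrM.
have er : eps <= r.
  have r1 : r <= 1 by rewrite -[leRHS]sqrtr1 ler_wsqrtr// -[leRHS]sqrtr1 ler_wsqrtr.
  have -> : eps = r ^+ 4.
    by rewrite (exprM r 2 2) !sqr_sqrtr ?sqrtr_ge0// ltW.
  rewrite exprS ler_piMr// exprn_ile1//.
have V1 : `|up FS xpredT| <= 2 * C0 * b * Num.sqrt (3 * K1) * (r * d0) * ell * e.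
  apply: le_trans US _; apply: ler_wpM2r => //.
  rewrite (_ : 2 * C0 * b * _ * _ * _ =
    (d0 * b * (2 * C0 * r)) * (Num.sqrt (3 * K1) * ell)); last by ring.
  apply: ler_pM => //; rewrite ?sqrtr_ge0//.
    by rewrite !mulr_ge0// ltW.
  by rewrite !ler_wpM2l ?mulr_ge0// ltW.
have V2 : `|up F2 (fun j => ~~ midrow N j)| <=
    4 * C0 * b * Num.sqrt (15 * K1) * (r * d0) * ell * e.
  apply: le_trans U2 _; rewrite s15 le_eqVlt; apply/orP; left; apply/eqP; ring.
rewrite rE; apply: le_trans H _.
set c1 := 2 * C0 * b * _ in V1 *; set c2 := 4 * C0 * b * _ in V2 *.
set c3 := Num.sqrt (12 * Cs) * _.
have c10 : 0 <= c1 by rewrite !mulr_ge0 ?sqrtr_ge0// ltW.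
have c20 : 0 <= c2 by rewrite !mulr_ge0 ?sqrtr_ge0// ltW.
have c30 : 0 <= c3.
  apply: mulr_ge0; first exact: sqrtr_ge0.
  by apply: addr_ge0; [apply: divr_ge0|]; rewrite ?mulr_ge0 ?ltW.
have rd : 0 <= r * d0 by rewrite mulr_ge0// ltW.
clearbody c1 c2 c3.
have W3 : c3 * P * e <= c3 * P * ell * e.
  by apply: ler_wpM2r => //; rewrite ler_peMr// mulr_ge0.
have q1 : 0 <= c1 * P * ell * e by rewrite !mulr_ge0.
have q2 : 0 <= c2 * P * ell * e by rewrite !mulr_ge0.
have q3 : 0 <= c3 * (r * d0) * ell * e.
  by apply: mulr_ge0 => //; apply: mulr_ge0 => //; exact: mulr_ge0.
lra.
Qed.

Section far.
Variables (k K : R) (xs : R * R).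
Hypotheses (k0 : 0 < k) (K4 : 4 <= K).
Let sig := k / Num.sqrt N%:R.
Let W := decay ly N sig xs.2.
Let Wm j := (W j + W j.+1) / 2.
Hypothesis weighted :
  sumcells N hx hy (fun i j => Wm j * fe_energy lx ly N eps b c Cs G i j) <=
  6 * sumcells N hx hy (fe_energy lx ly N eps b c Cs G).
Hypotheses (xs0 : 0 <= xs.1) (sub : Omega0' lx ly k K N xs `<=`
  Omega_s lx ly `|` Omega_1 lx ly).

(* [Wm] averages two nodal weights, so it is at least [A] as soon as one of
   them reaches [N^4] *)
Let A := N%:R ^+ 4 / 2 : R.
Let sN0 : 0 < Num.sqrt N%:R :> R. Proof. by rewrite sqrtr_gt0. Qed.
Let sig0 : 0 < sig. Proof. exact: divr_gt0. Qed.

Lemma sigma_yE : sigma_y k N = sig.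
Proof. by rewrite /sigma_y powRN mul1r powR12_sqrt// ltW. Qed.

Lemma weight_ge0 j : 0 <= W j. Proof. exact: expR_ge0. Qed.

Lemma N4E : N%:R ^+ 4 = expR (4 * ell) :> R.
Proof. by rewrite expRM_natl lnK. Qed.

Lemma weight_large j : 4 * sig * ell <= `|Y j - xs.2| -> N%:R ^+ 4 <= W j.
Proof.
move=> H; rewrite N4E /W /decay ler_expR ler_pdivlMr//.
by move: H; lra.
Qed.

Lemma weight_small j : W j < N%:R ^+ 4 -> `|Y j - xs.2| <= 4 * sig * ell.
Proof.
move=> H; rewrite leNgt; apply/negP => /ltW/weight_large; rewrite leNgt.
by rewrite H.
Qed.

(** The factor [N^(-4)] in the energy, together with [sqrt (Cs / N)], is exactly
    [N^(-rho)] with [rho = 5/2]. *)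
Lemma far_energy (J : pred nat) :
  (forall j, (j < N)%N -> J j -> A <= Wm j) ->
  Num.sqrt (12 * d0) * Num.sqrt (EE J) <= 12 * Num.sqrt Cs * P * e.
Proof.
move=> JA.
have A0 : 0 < A by rewrite /A divr_gt0// exprn_gt0.
have Wm0 j : 0 <= Wm j by rewrite /Wm divr_ge0// addr_ge0 ?weight_ge0.
have H := rows_energy_le c0 Cs0 eps0 N0 N6 lx0 lx1 ly0 ly1 A0 Wm0 JA weighted.
have E0 J' : 0 <= EE J'.
  by apply: energy_ge0 => // i; [exact: hx_gt0|exact: hy_gt0].
have d120 : 0 <= 12 * d0 by rewrite mulr_ge0// ltW.
have R0 : 0 <= 12 * Num.sqrt Cs * P by rewrite !mulr_ge0 ?sqrtr_ge0.
rewrite -sqrtrM// -[X in _ <= X * _]ger0_norm// -sqrtr_sqr -sqrtrM ?sqr_ge0//.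
apply: ler_wsqrtr; apply: le_trans (ler_wpM2l d120 H) _.
rewrite !exprMn sqr_sqrtr ?(ltW Cs0)// powR_rho_sqr//.
rewrite le_eqVlt; apply/orP; left; apply/eqP; rewrite /A; field.
exact: lt0r_neq0.
Qed.

(** The rows with [Wm < A] lie within [4 * sig * ell] of the level of [xs], since
    [N^4 = exp (4 * ell)]; this fixes the lower bound 4 for [K]. *)
Lemma bound_away_from_strips u : decomposes beta eps C0 u ->
  `|L2_inner (fun p => eps * laplacian u p)
       (fun p => delta Cs lx ly N p * b * dx G p)| <=
  (72 * C0 * Num.sqrt Cs + 2 * C0 * b * Cs * Num.sqrt (24 * K1 * k)
    + Num.sqrt (12 * Cs) * (6 * C0 / beta + 4 * C0))
  * (P + eps * N%:R `^ (- (5 / 4))) * ell * e.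
Proof.
move=> /inner_le_parts[FS [F2 [hS h2 H]]].
pose far := (fun j => A <= Wm j).
have [cS bS _ _] := hS; have [c2 b2 _ _] := h2.
have nearw : \sum_(j < N | ~~ far j) hy j <= 2 * (4 * sig * ell).
  apply: (near_rows_width N0 N6 ly0 ly1 (y := xs.2) (J := fun j => ~~ far j)).
    by rewrite !mulr_ge0// ltW.
  move=> j jN; rewrite /far -ltNge /Wm /A => h.
  have w1 := weight_ge0 j; have w2 := weight_ge0 j.+1.
  by split; apply: weight_small; lra.
have USn := smooth_abel (J := fun j => ~~ far j) hS nearw.
have USf : `|up FS far| <= 2 * C0 * (12 * Num.sqrt Cs * P * e).
  apply: le_trans (bound_crude b0 c0 be0 Cs0 eps0 N0 N6 lx1 ly1 lxE lyE VG cS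
    (M := 2 * C0) _ _) _.
  - by rewrite mulr_ge0// ltW.
  - move=> i j p ni jN _ cp.
    have iN : (i < N)%N by apply: leq_trans ni _; exact: half_le.
    apply: le_trans (bS p (cell_Omega N0 N6 lx0 lx1 ly0 ly1 iN jN cp)) _.
    by rewrite ler_piMr// mulr_ge0// ltW.
  - by rewrite -mulrA ler_wpM2l ?mulr_ge0 ?(ltW C00)//; exact: far_energy.
have U2 : `|up F2 (fun j => ~~ midrow N j)| <= 4 * C0 * (12 * Num.sqrt Cs * P * e).
  apply: le_trans (bound_crude b0 c0 be0 Cs0 eps0 N0 N6 lx1 ly1 lxE lyE VG c2
    (M := 4 * C0) _ _) _.
  - by rewrite mulr_ge0// ltW.
  - move=> i j p ni jN _ cp.
    have iN : (i < N)%N by apply: leq_trans ni _; exact: half_le.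
    exact: (b2 p (cell_Omega N0 N6 lx0 lx1 ly0 ly1 iN jN cp)).
  - rewrite -mulrA ler_wpM2l ?mulr_ge0 ?(ltW C00)//; apply: far_energy => j jN nj.
    have Kp : 0 < K by apply: lt_le_trans K4.
    have l0 : 0 < ell by exact: lt_le_trans ell1.
    have Ks : 4 * sig * ell <= K * sigma_y k N * ell.
      by rewrite sigma_yE ler_wpM2r// ler_wpM2r// ltW.
    have w1 := weight_ge0 j; have w2 := weight_ge0 j.+1; rewrite /A /Wm.
    have [h|h] := far_layer_rows N0 N6 lx0 lx1 ly0 ly1 k0 Kp l0 xs0 sub jN nj;
      have := weight_large (le_trans Ks h); lra.
have dE : d0 * Num.sqrt (3 * K1 * (2 * (4 * sig * ell)) * ell) =
    Cs * Num.sqrt (24 * K1 * k) * N%:R `^ (- (5 / 4)) * ell.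
  rewrite powR_five_quarters//.
  rewrite (_ : 3 * K1 * _ * _ = 24 * K1 * k * (Num.sqrt N%:R)^-1 * ell ^+ 2); last first.
    by rewrite /sig; ring.
  have k24 : 0 <= 24 * K1 * k by rewrite !mulr_ge0// ltW.
  have kN : 0 <= 24 * K1 * k * (Num.sqrt N%:R)^-1.
    by apply: mulr_ge0 => //; rewrite invr_ge0 ltW.
  rewrite (sqrtrM _ kN) sqrtr_sqr (ger0_norm ell0) (sqrtrM _ k24).
  by ring.
have {USn} USn : `|up FS (fun j => ~~ far j)| <=
   2 * C0 * b * Cs * Num.sqrt (24 * K1 * k) * (eps * N%:R `^ (- (5 / 4))) * ell * e.
  apply: le_trans USn _; rewrite le_eqVlt; apply/orP; left; apply/eqP.
  rewrite [LHS](_ : _ = b * (2 * C0 * eps) * e *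
    (d0 * Num.sqrt (3 * K1 * (2 * (4 * sig * ell)) * ell))); last by ring.
  by rewrite dE; ring.
apply: le_trans H _; rewrite (upstream_split _ _ _ _ _ _ _ far).
have TS := ler_normD (up FS far) (up FS (fun j => ~~ far j)).
set Q := N%:R `^ (- (5 / 4)) in USn *.
have Q0 : 0 <= Q by exact: powR_ge0.
set s := Num.sqrt Cs in USf U2 *.
have s0 : 0 <= s by exact: sqrtr_ge0.
set c1 := 2 * C0 * b * Cs * _ in USn *; set c3 := Num.sqrt (12 * Cs) * _.
have c10 : 0 <= c1 by rewrite !mulr_ge0 ?sqrtr_ge0// ltW.
have c30 : 0 <= c3.
  apply: mulr_ge0; first exact: sqrtr_ge0.
  by apply: addr_ge0; [apply: divr_ge0|]; rewrite ?mulr_ge0 ?ltW.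
have c20 : 0 <= 72 * C0 * s by rewrite !mulr_ge0// ltW.
clearbody c1 c3 s Q.
have W3 : (72 * C0 * s + c3) * (P * e) <= (72 * C0 * s + c3) * (P * ell * e).
  by rewrite ler_wpM2l ?addr_ge0// ler_wpM2r// ler_peMr.
have eQ : 0 <= eps * Q by rewrite mulr_ge0// ltW.
have q1 : 0 <= c1 * P * ell * e by rewrite !mulr_ge0.
have q2 : 0 <= (72 * C0 * s + c3) * (eps * Q) * ell * e.
  by apply: mulr_ge0 => //; apply: mulr_ge0 => //; apply: mulr_ge0 => //; exact: addr_ge0.
lra.
Qed.
End far.
End conclusion.

(** One summand per hypothesis of [green_weighted_energy] for
    [sigma = k / sqrt N], as cell heights are at most [3 / N]: [168 = 56 * 3];
    [256 / c] from [eps <= 1 / N]; [1728 = 192 * 3^2]; and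
    [720 = 48 * 3 * 5/2 * 2], the last two factors from
    [lx = 5/2 * eps / beta * ln N] and [ln N <= 2 * sqrt N]. *)
Definition decay_constant (R : realType) (b c beta Cs : R) : R :=
  168 + 256 / c + 1728 / (c * Cs) + 720 * b / beta.

Lemma green_decay (R : realType) (b c beta Cs eps lx ly k : R) (N i0 j0 : nat)
    (G : R * R -> R) :
  0 < b -> 0 < c -> 0 < beta -> 0 < Cs -> 0 < eps ->
  (0 < N)%N -> (6 %| N)%N -> eps <= N%:R^-1 -> lx <= 1 / 2 -> ly <= 1 / 4 ->
  lx = 5 / 2 * eps / beta * ln N%:R -> ly = 5 / 2 * Num.sqrt eps * ln N%:R ->
  Cs / N%:R * c <= 1 -> decay_constant b c beta Cs <= k ->
  (i0 <= N)%N -> (j0 <= N)%N ->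
  is_green eps b c (delta Cs lx ly N) (fe_space lx ly N)
    (node_x lx N i0, node_y ly N j0) G ->
  sumcells N (width_x lx N) (width_y ly N)
    (fun i j => (decay ly N (k / Num.sqrt N%:R) (node_y ly N j0) j +
                 decay ly N (k / Num.sqrt N%:R) (node_y ly N j0) j.+1) / 2 *
                fe_energy lx ly N eps b c Cs G i j) <=
  6 * sumcells N (width_x lx N) (width_y ly N) (fe_energy lx ly N eps b c Cs G).
Proof.
move=> b0 c0 be0 Cs0 eps0 N0 N6 epsN lx1 ly1 lxE lyE Csc kk iN jN Gg.
have lx0 := lx_gt0 be0 eps0 N0 N6 lxE; have ly0 := ly_gt0 eps0 N0 N6 lyE.
have Nr0 : 0 < N%:R :> R by rewrite ltr0n.
have Nr1 : 1 <= N%:R :> R by rewrite ler1n.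
have sq := sqr_sqrtr (ltW Nr0).
have s0 : 0 < Num.sqrt N%:R :> R by rewrite sqrtr_gt0.
have s1 : 1 <= Num.sqrt N%:R :> R by rewrite -[leLHS]sqrtr1 ler_wsqrtr.
have lns := ln_le_sqrt (R := R) N0.
have cCs : 0 < c * Cs by exact: mulr_gt0.
have a1 : 0 <= 256 / c by exact: divr_ge0 (ler0n _ _) (ltW c0).
have a2 : 0 <= 1728 / (c * Cs) by exact: divr_ge0 (ler0n _ _) (ltW cCs).
have a3 : 0 <= 720 * b / beta.
  by apply: divr_ge0 (ltW be0); exact: mulr_ge0 (ler0n _ _) (ltW b0).
move: kk; rewrite /decay_constant => kk.
have k1 : 168 <= k by apply: le_trans kk; move: a1 a2 a3; clear; lra.
have k0 : 0 < k by exact: lt_le_trans k1.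
have k2 : 256 <= c * k.
  by rewrite -ler_pdivrMl// mulrC; apply: le_trans kk; move: a1 a2 a3; clear; lra.
have k3 : 1728 <= c * Cs * k.
  by rewrite -ler_pdivrMl// mulrC; apply: le_trans kk; move: a1 a2 a3; clear; lra.
have k4 : 720 * b <= beta * k.
  by rewrite -ler_pdivrMl// mulrC; apply: le_trans kk; move: a1 a2 a3; clear; lra.
have hs j : (j < N)%N -> width_y ly N j / (k / Num.sqrt N%:R) <= 3 / (k * Num.sqrt N%:R).
  move=> jN'; have h := hy_le N0 N6 ly0 ly1 jN'.
  rewrite ler_pdivrMr ?divr_gt0//; apply: le_trans h _.
  rewrite le_eqVlt; apply/orP; left; apply/eqP; rewrite -{1}sq.
  by field; rewrite !lt0r_neq0.
have hs0 j : (j < N)%N -> 0 <= width_y ly N j / (k / Num.sqrt N%:R).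
  by move=> jN'; rewrite divr_ge0 ?divr_ge0 ?(ltW k0) ?(ltW s0)// ltW// hy_gt0.
move: sq s0 s1 lns hs hs0; set s := Num.sqrt N%:R => sq s0 s1 lns hs hs0.
apply: (green_weighted_energy N0 N6 lx0 lx1 ly0 ly1 eps0 b0 c0 Cs0 Csc _ iN jN _ _ _ _ Gg).
- exact: divr_gt0.
- move=> j jN'; have := hy_le N0 N6 ly0 ly1 jN'; rewrite -sq => h.
  rewrite ler_pdivlMr//.
  have : 56 * (width_y ly N j * s ^+ 2) <= 168.
    by move: h; rewrite ler_pdivlMr ?exprn_gt0//; clear; lra.
  have := hy_gt0 N0 N6 ly0 ly1 jN'; have := k1; move: s0 s1; clear; nra.
- apply: le_trans (ler_wpM2l (ler0n _ _) epsN) _; rewrite -sq expr_div_n mulrA.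
  rewrite ler_wpM2r ?invr_ge0 ?sqr_ge0//; move: k1 k2; clear; nra.
- move=> j jN'; have h := hs j jN'; have h0 := hs0 j jN'.
  have h2 : (width_y ly N j / (k / s)) ^+ 2 <= (3 / (k * s)) ^+ 2.
    by rewrite !expr2; exact: ler_pM.
  apply: le_trans (ler_wpM2l (ler0n _ _) h2) _.
  rewrite -sq mulrA -[leLHS](_ : 1728 / k ^+ 2 / s ^+ 2 = _); last first.
    by field; rewrite !lt0r_neq0.
  rewrite ler_wpM2r ?invr_ge0 ?sqr_ge0// ler_pdivrMr ?exprn_gt0//; move: k1 k3; clear; nra.
- move=> j jN'; have h := hs j jN'; have h0 := hs0 j jN'.
  have q1 : width_y ly N j / (k / s) * lx <= 3 / (k * s) * (5 / 2 * eps / beta * (2 * s)).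
    rewrite lxE; apply: ler_pM => //.
      by rewrite -lxE ltW.
    rewrite ler_wpM2l//; apply: divr_ge0 (ltW be0); apply: mulr_ge0 (ltW eps0).
    exact: divr_ge0 (ler0n _ _) (ler0n _ _).
  rewrite -mulrA; apply: le_trans (ler_wpM2l _ q1) _; first by rewrite mulr_ge0// ltW.
  rewrite [leLHS](_ : _ = 720 * b / (beta * k) * eps); last first.
    by field; rewrite !lt0r_neq0.
  apply: ler_piMl (ltW eps0) _; rewrite ler_pdivrMr ?mul1r; first exact: k4.
  exact: mulr_gt0.
Qed.

Theorem theorem5p2 (R : realType) (b c beta Cs : R)
  (hb : 0 < b) (hc : 0 < c) (hbeta : 0 < beta) (hbb : beta <= b)
  (hCs : 0 < Cs) :
  exists k0 : R, 0 < k0 /\ forall k : R, k0 <= k ->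
  exists K0 : R, 0 < K0 /\ forall K : R, K0 <= K ->
  forall (f : R * R -> R) (C0 : R),
  class_C Omega_bar 1 f -> 0 < C0 ->
  exists C : R, 0 < C /\
  forall (eps : R) (N : nat) (u : R * R -> R),
  let lx := lambda_x beta eps N in
  let ly := lambda_y eps N in
  let del := delta Cs lx ly N in
  0 < eps -> (0 < N)%N -> (6 %| N)%N ->
  eps <= N%:R^-1 ->
  lx = rho * eps * beta^-1 * ln N%:R ->
  ly = rho * Num.sqrt eps * ln N%:R ->
  Cs * N%:R^-1 <= 1 / c ->
  is_solution eps b c f u -> decomposes beta eps C0 u ->
  forall xs : R * R,
  mesh_node lx ly N xs -> (Omega_s lx ly `|` Omega_1 lx ly) xs ->
  forall G : R * R -> R,
  is_green eps b c del (fe_space lx ly N) xs G ->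
  (Omega0' lx ly k K N xs `<=` Omega_s lx ly `|` Omega_1 lx ly ->
   `|L2_inner (fun p => eps * laplacian u p) (fun p => del p * b * dx G p)|
   <= C * (N%:R `^ (- rho) + eps * N%:R `^ (- (5 / 4))) * ln N%:R
      * energy_norm eps b c del G) /\
  (~ (Omega0' lx ly k K N xs `<=` Omega_s lx ly `|` Omega_1 lx ly) ->
   `|L2_inner (fun p => eps * laplacian u p) (fun p => del p * b * dx G p)|
   <= C * (N%:R `^ (- rho) + eps `^ (1 / 4) * delta_y Cs N) * ln N%:R
      * energy_norm eps b c del G).
Proof.
pose k0 := decay_constant b c beta Cs.
have a1 : 0 <= 256 / c by exact: divr_ge0 (ler0n _ _) (ltW hc).
have a2 : 0 <= 1728 / (c * Cs).
  by apply: divr_ge0 (ler0n _ _) _; rewrite mulr_ge0// ltW.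
have a3 : 0 <= 720 * b / beta.
  by apply: divr_ge0 (ltW hbeta); exact: mulr_ge0 (ler0n _ _) (ltW hb).
have k00 : 0 < k0 by rewrite /k0 /decay_constant; lra.
exists k0; split=> // k kk; exists 4; split=> // K K4 f C0 _ C00.
have k_gt0 : 0 < k by apply: lt_le_trans kk.
set kap := abel_constant b c beta Cs.
pose Cfar := 72 * C0 * Num.sqrt Cs + 2 * C0 * b * Cs * Num.sqrt (24 * kap * k)
  + Num.sqrt (12 * Cs) * (6 * C0 / beta + 4 * C0).
pose Cnear := 2 * C0 * b * Num.sqrt (3 * kap) + 4 * C0 * b * Num.sqrt (15 * kap)
  + Num.sqrt (12 * Cs) * (6 * C0 / beta + 4 * C0).
have C0' := ltW C00; have b0' := ltW hb; have Cs0' := ltW hCs.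
have tail0 : 0 <= Num.sqrt (12 * Cs) * (6 * C0 / beta + 4 * C0).
  apply: mulr_ge0 (sqrtr_ge0 _) _; apply: addr_ge0; last exact: mulr_ge0.
  by apply: divr_ge0 (ltW hbeta); exact: mulr_ge0.
have Cfar0 : 0 < Cfar.
  apply: ltr_wpDr => //; apply: ltr_wpDr; first by rewrite !mulr_ge0 ?sqrtr_ge0.
  by rewrite !mulr_gt0// sqrtr_gt0.
have Cnear0 : 0 <= Cnear.
  by apply: addr_ge0 => //; rewrite addr_ge0 ?mulr_ge0 ?sqrtr_ge0.
exists (Cfar + Cnear); split; first exact: ltr_wpDr.
move=> eps N u lx ly del eps0 N0 N6 epsN lxE lyE CsN _ udec xs [i0 [j0 [iN jN xsE]]] _ G Gg.
have lx1 : lx <= 1 / 2 by rewrite /lx /lambda_x ge_min lexx.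
have ly1 : ly <= 1 / 4 by rewrite /ly /lambda_y ge_min lexx.
have lxE' : lx = 5 / 2 * eps / beta * ln N%:R by rewrite lxE.
have VG := Gg.1.
have Nr0 : 0 < N%:R :> R by rewrite ltr0n.
have Csc : Cs / N%:R * c <= 1 by rewrite -ler_pdivlMr.
have widen (A B T L E : R) : 0 <= A -> 0 <= B -> 0 <= T -> 0 <= L -> 0 <= E ->
    A * T * L * E <= (A + B) * T * L * E.
  by move=> A0 B0 T0 L0 E0; rewrite !ler_wpM2r// lerDl.
have L0 : 0 <= ln N%:R :> R by apply: le_trans (ln_ge1 N0 N6).
rewrite (energy_normE b c Cs hbeta eps0 N0 N6 lx1 ly1 lxE' lyE VG).
split=> sub.
- have lx0 := lx_gt0 hbeta eps0 N0 N6 lxE'.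
  have xs0 : 0 <= xs.1 by rewrite xsE; have /andP[] := node_x_in N0 N6 lx0 lx1 iN.
  move: Gg; rewrite xsE => Gg.
  have wt := green_decay hb hc hbeta hCs eps0 N0 N6 epsN lx1 ly1 lxE' lyE Csc kk iN jN Gg.
  have := bound_away_from_strips hb hc hbeta hCs eps0 N0 N6 C00 epsN lx1 ly1 lxE' lyE VG k_gt0 K4
    (xs := xs) _ xs0 sub udec.
  rewrite xsE => /(_ wt) h; apply: le_trans h _.
  apply: widen (ltW Cfar0) Cnear0 _ L0 (sqrtr_ge0 _).
  by rewrite addr_ge0 ?mulr_ge0 ?powR_ge0// ltW.
- apply: le_trans (bound_near_strips hb hc hbeta hCs eps0 N0 N6 C00 epsN lx1 ly1 lxE' lyE VG udec) _.
  rewrite [Cfar + _]addrC; apply: widen Cnear0 (ltW Cfar0) _ L0 (sqrtr_ge0 _).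
  by rewrite addr_ge0 ?mulr_ge0 ?powR_ge0 ?divr_ge0// ltW.
Qed.
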